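(* Let $\ell\in\mathbb{Z}_{\ge 0}$, let $f:\mathbb{C}_+\to\mathbb{C}$ and $g:\mathbb{C}_+\to\mathbb{C}_+$ be analytic functions, and let $W_{f,g}$ be a (not necessarily maximal) weighted composition operator, i.e. $W_{f,g}\preceq W_{f,g,\max}$. Then $W_{f,g}$ is hermitian on $\mathbb{B}_\ell(\mathbb{C}_+)$ if and only if both of the following conditions hold. (1) The operator $W_{f,g}$ is maximal, that is, $W_{f,g}=W_{f,g,\max}$. (2) One of the following three cases holds (for all $w\in\mathbb{C}_+$): (i) $g(w)=\mu$ and $f(w)=\dfrac{\varepsilon}{(w+\overline{\mu})^{\ell+2}}$, where $\mu\in\mathbb{C}_+$ and $\varepsilon\in\mathbb{R}$; (ii) $g(w)=w+\gamma$ and $f(w)=\lambda$, where $\gamma\in\mathbb{R}_{\ge 0}$ and $\lambda\in\mathbb{R}$; (iii) $g(w)=-\dfrac{\beta}{\alpha}-\dfrac{2}{\alpha w-\overline{\beta}}$ and $f(w)=\dfrac{\delta}{(\alpha w-\overline{\beta})^{\ell+2}}$, where $\alpha,\delta\in\mathbb{R}\setminus\{0\}$, $\beta\in\mathbb{C}$, and either $\operatorname{Re}\beta<0<\alpha\le\frac{(\operatorname{Re}\beta)^2}{2}$, or $\alpha<0=\operatorname{Re}\beta$. In this case, the operator $W_{f,g}$ is bounded.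
   Context: $\mathbb{C}_+=\{z\in\mathbb{C}:\operatorname{Re}z>0\}$. For $\ell\in\mathbb{Z}_{\ge0}$, the weighted Bergman space $\mathbb{B}_\ell(\mathbb{C}_+)$ is the Hilbert space of analytic functions $h:\mathbb{C}_+\to\mathbb{C}$ with $\|h\|^2=\frac1\pi\int_{-\infty}^{\infty}\int_0^\infty x^\ell|h(x+iy)|^2\,dx\,dy<\infty$. For analytic $f:\mathbb{C}_+\to\mathbb{C}$ and $g:\mathbb{C}_+\to\mathbb{C}_+$, the maximal weighted composition operator $W_{f,g,\max}$ has domain $\{h\in\mathbb{B}_\ell(\mathbb{C}_+): f\cdot(h\circ g)\in\mathbb{B}_\ell(\mathbb{C}_+)\}$ and acts by $W_{f,g,\max}h=f\cdot(h\circ g)$. For linear operators, $A\preceq B$ means $\operatorname{dom}(A)\subseteq\operatorname{dom}(B)$ and $Ax=Bx$ for $x\in\operatorname{dom}(A)$; $W_{f,g}$ denotes an operator with $W_{f,g}\preceq W_{f,g,\max}$. A linear (not necessarily bounded) operator $K$ is called hermitian if $K=K^*$, equality including equality of domains ($K$ being densely defined so that $K^*$ makes sense). The operator $W_{f,g}$ is called bounded on $\mathbb{B}_\ell(\mathbb{C}_+)$ if its domain is all of $\mathbb{B}_\ell(\mathbb{C}_+)$ and there is $L>0$ with $\|W_{f,g}h\|\le L\|h\|$ for every $h$.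
   Formalization: The statement is false as written; two corrections are made in (2): f identically 0 (any g) is added as a further case, and in (iii) the condition ''α<0=Re β'' is widened to ''α<0≤Re β'' (e.g. ℓ=0, α=−2, β=2, δ=4 gives a hermitian operator). *)

(* Defs.v *)
From HB Require Import structures.
From mathcomp Require Import all_boot all_order all_algebra.
From mathcomp Require Import all_classical all_reals all_analysis.
From mathcomp Require Import complex.

Set Implicit Arguments.
Unset Strict Implicit.
Unset Printing Implicit Defensive.

Import Order.TTheory GRing.Theory Num.Theory.
Import numFieldNormedType.Exports.

Local Open Scope classical_set_scope.
Local Open Scope ring_scope.
Local Open Scope complex_scope.

(* [complex.Re : R[i] -> R] is used throughout, not ['Re], which is
   [R[i]]-valued. *)
Definition Cplus (R : realType) := {z : R[i] | 0 < complex.Re z}.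

(* Extension by zero. Since C_+ is open, complex differentiability and
   integrals over C_+ do not depend on the values chosen outside C_+. *)
Definition zext (R : realType) (h : Cplus R -> R[i]) (z : R[i]) : R[i] :=
  oapp h 0 (insub z : option (Cplus R)).

(* [R[i]^o] is [R[i]] as a normed space over itself: [derivable] at [val w] in
   the direction 1 is then complex differentiability at [w]. *)
Definition analytic (R : realType) (h : Cplus R -> R[i]) : Prop :=
  forall w : Cplus R, derivable (zext h : R[i]^o -> R[i]^o) (val w) 1.

Definition weighted_integral (R : realType) (l : nat) (u : R[i] -> R) : \bar R :=
  ((pi^-1)%:E *
   \int[lebesgue_measure]_y
     \int[lebesgue_measure]_(x in `]0%R, +oo[) (x ^+ l * u (x +i* y))%:E)%E.

Definition bergman_sqnorm (R : realType) (l : nat) (h : Cplus R -> R[i]) : \bar R :=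
  weighted_integral l (fun z => complex.Re (`|zext h z| ^+ 2)).

Definition bergman (R : realType) (l : nat) : set (Cplus R -> R[i]) :=
  [set h | analytic h /\ (bergman_sqnorm l h < +oo)%E].

Definition bergman_norm (R : realType) (l : nat) (h : Cplus R -> R[i]) : R :=
  Num.sqrt (fine (bergman_sqnorm l h)).

Definition bergman_inner (R : realType) (l : nat) (h k : Cplus R -> R[i]) : R[i] :=
  fine (weighted_integral l (fun z => complex.Re (zext h z * (zext k z)^*))) +i*
  fine (weighted_integral l (fun z => complex.Im (zext h z * (zext k z)^*))).

(* A partially defined operator; the values of [app] outside [dom] are
   irrelevant, and [op_eq] ignores them. *)
Record operator (R : realType) := Operator {
  dom : set (Cplus R -> R[i]);
  app : (Cplus R -> R[i]) -> (Cplus R -> R[i]) }.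

Definition linear_operator (R : realType) (l : nat) (K : operator R) : Prop :=
  [/\ dom K `<=` bergman l,
      (forall h, dom K h -> bergman l (app K h)),
      dom K (fun=> 0) &
      forall (a : R[i]) h k, dom K h -> dom K k ->
        dom K (fun w => a * h w + k w) /\
        app K (fun w => a * h w + k w) = (fun w => a * app K h w + app K k w)].

Definition op_le (R : realType) (A B : operator R) : Prop :=
  dom A `<=` dom B /\ forall h, dom A h -> app A h = app B h.

Definition op_eq (R : realType) (A B : operator R) : Prop :=
  dom A = dom B /\ forall h, dom A h -> app A h = app B h.

Definition wcomp_max (R : realType) (l : nat)
    (f : Cplus R -> R[i]) (g : Cplus R -> Cplus R) : operator R :=
  {| dom := [set h | bergman l h /\ bergman l (fun w => f w * h (g w))];
     app := fun h w => f w * h (g w) |}.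

Definition densely_defined (R : realType) (l : nat) (K : operator R) : Prop :=
  forall h, bergman l h -> forall e : R, 0 < e ->
    exists2 k, dom K k & bergman_norm l (fun w => h w - k w) < e.

Definition is_adjoint_value (R : realType) (l : nat) (K : operator R)
    (u v : Cplus R -> R[i]) : Prop :=
  bergman l v /\
  forall h, dom K h -> bergman_inner l (app K h) u = bergman_inner l h v.

(* [xget] selects the value [v] of the adjoint at [u], which is unique as soon
   as [K] is densely defined. *)
Definition adjoint (R : realType) (l : nat) (K : operator R) : operator R :=
  {| dom := [set u | bergman l u /\ exists v, is_adjoint_value l K u v];
     app := fun u => xget (fun=> 0) [set v | is_adjoint_value l K u v] |}.

Definition hermitian_operator (R : realType) (l : nat) (K : operator R) : Prop :=
  densely_defined l K /\ op_eq K (adjoint l K).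

Definition bounded_operator (R : realType) (l : nat) (K : operator R) : Prop :=
  dom K = bergman l /\
  exists2 L : R, 0 < L &
    forall h, bergman l h -> bergman_norm l (app K h) <= L * bergman_norm l h.

Definition constant_case (R : realType) (l : nat)
    (f : Cplus R -> R[i]) (g : Cplus R -> Cplus R) : Prop :=
  exists (mu : Cplus R) (eps : R), forall w : Cplus R,
    g w = mu /\ f w = eps%:C / (val w + (val mu)^*) ^+ l.+2.

Definition translation_case (R : realType)
    (f : Cplus R -> R[i]) (g : Cplus R -> Cplus R) : Prop :=
  exists gamma lambda : R, 0 <= gamma /\ forall w : Cplus R,
    val (g w) = val w + gamma%:C /\ f w = lambda%:C.

(* For alpha < 0 the condition on beta is 0 <= Re beta, not only Re beta = 0:
   alpha = -2, beta = 2, delta = 4 give the hermitian operator with symbols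
   g(w) = 1 + 1 / (w + 1) and f(w) = 4 / (2 w + 2)^2 when l = 0, and this pair
   (f, g) has no other description of the three kinds. *)
Definition fractional_case (R : realType) (l : nat)
    (f : Cplus R -> R[i]) (g : Cplus R -> Cplus R) : Prop :=
  exists (alpha delta : R) (beta : R[i]),
    [/\ alpha != 0, delta != 0,
        (complex.Re beta < 0 /\ 0 < alpha <= complex.Re beta ^+ 2 / 2) \/
        (alpha < 0 /\ 0 <= complex.Re beta) &
        forall w : Cplus R,
          val (g w) = - (beta / alpha%:C) - 2 / (alpha%:C * val w - beta^*) /\
          f w = delta%:C / (alpha%:C * val w - beta^*) ^+ l.+2].

(* Main.v *)
(* Write [n = l + 2], [<h, k>] for the inner product and
   [K_w(z) = (z + conj w)^-n]. The kernels reproduce, [<h, K_w> = c h(w)] with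
   [c > 0]: if [h(w) = 0], then [x^l h(z) conj(K_w(z))] is, up to a factor, the
   d-bar derivative of [(x / (conj z + w))^(l+1) h(z) / (z - w)], and Green's
   formula with cut-off functions gives [<h, K_w> = 0].

   If [W] is hermitian, its adjoint sends [K_w] to [conj(f w) K_(g w)], so
   [f(z) K_w(g z) = conj(f w) K_(g w)(z)]. The logarithmic derivative of this
   identity in [z] shows that [g] is a Moebius map, and the symmetry of the
   identity in [z] and [w] leaves only the three cases.

   Conversely, in the second and third cases the maximal operator is a real
   multiple of a palindromic product of translations [h |-> h(. + t)] and
   inversions [h |-> w^-n h(k / w)]. These are bounded; inversions and real
   translations are symmetric (the latter by exchanging two reproducing
   integrals) and imaginary translations are unitary. An everywhere defined
   symmetric operator is hermitian, and a hermitian operator has no proper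
   symmetric extension, whence the maximality of [W]. *)
Require Import Defs.
From HB Require Import structures.
From mathcomp Require Import all_boot all_order all_algebra.
From mathcomp Require Import all_classical all_reals all_analysis.
From mathcomp Require Import measurable_realfun complex.
From mathcomp Require Import ring lra.

Set Implicit Arguments.
Unset Strict Implicit.
Unset Printing Implicit Defensive.

Import Order.TTheory GRing.Theory Num.Theory.
Import numFieldNormedType.Exports.

Local Open Scope classical_set_scope.
Local Open Scope ring_scope.
Local Open Scope complex_scope.

(** Only complex differentiability is given, so Green's formula is proved in Goursat's manner: the
    conjugate derivative must be continuous, but nothing is asked of the derivative in [z]. The
    point [w] is exceptional because [h(z) / (z - w)] is merely bounded there.

    The cut-offs depend on the hyperbolic distance to 1. Their d-bar derivative is at most [1 / x],
    uniformly, and tends to 0 at each point, while the primitive carries a spare factor [x]. This is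
    what lets dominated convergence work for every [h] of the space, with no decay assumed.

    A real translation by [t] is symmetric because [K_(p + t)(q)] depends only on [q + cj p + t].
    The double integral that expresses this need not converge absolutely: nothing forces decay along
    the imaginary direction. One function is therefore multiplied by [1 / (1 + e z)], and [e] tends
    to 0 at the end. *)

Local Notation Re := complex.Re.
Local Notation Im := complex.Im.

Local Notation cj := conjc.

Local Notation mR := measurableTypeR.

(** * Modulus and measurability of complex functions *)

Section ComplexModulus.
Variable R : realType.
Implicit Types (z w : R[i]) (x y : R).

(** The norm of [R[i]] takes values in [R[i]]; the estimates below use this real modulus instead. *)
Definition cabs z : R := Num.sqrt (Re z ^+ 2 + Im z ^+ 2).

Lemma cabsE z : cabs z = Normc.normc z.
Proof. by case: z. Qed.

Lemma normcabs z : `|z| = (cabs z)%:C.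
Proof. by rewrite cabsE. Qed.

Lemma cabs_ge0 z : 0 <= cabs z. Proof. exact: sqrtr_ge0. Qed.

Lemma sqr_cabs z : cabs z ^+ 2 = Re z ^+ 2 + Im z ^+ 2.
Proof. by rewrite sqr_sqrtr// addr_ge0// sqr_ge0. Qed.

Lemma cabs0 : cabs 0 = 0. Proof. by rewrite cabsE; exact: Normc.normc0. Qed.
Lemma cabs1 : cabs 1 = 1. Proof. by rewrite cabsE; exact: Normc.normc1. Qed.
Lemma cabsM z w : cabs (z * w) = cabs z * cabs w.
Proof. by rewrite !cabsE Normc.normcM. Qed.
Lemma cabsV z : cabs z^-1 = (cabs z)^-1.
Proof. by rewrite !cabsE Normc.normcV. Qed.
Lemma cabsX z n : cabs (z ^+ n) = cabs z ^+ n.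
Proof. by elim: n => [|n ih]; rewrite ?expr0 ?cabs1// !exprS cabsM ih. Qed.
Lemma cabsN z : cabs (- z) = cabs z.
Proof. by rewrite !cabsE; exact: normcN. Qed.
Lemma cabsJ z : cabs (cj z) = cabs z.
Proof. by case: z => a b; rewrite /cabs/= sqrrN. Qed.
Lemma cabsD z w : cabs (z + w) <= cabs z + cabs w.
Proof. by rewrite !cabsE; exact: le_normcD. Qed.
Lemma cabsB z w : cabs (z - w) <= cabs z + cabs w.
Proof. by rewrite (le_trans (cabsD _ _))// cabsN. Qed.
Lemma cabs_distC z w : cabs (z - w) = cabs (w - z).
Proof. by rewrite -cabsN opprB. Qed.
Lemma cabs_eq0 z : (cabs z == 0) = (z == 0).
Proof.
apply/eqP/eqP => [|->]; last exact: cabs0.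
by rewrite cabsE; exact: Normc.eq0_normc.
Qed.
Lemma cabs_gt0 z : (0 < cabs z) = (z != 0).
Proof. by rewrite lt_def cabs_ge0 andbT cabs_eq0. Qed.
Lemma cabsR x : cabs x%:C = `|x|.
Proof. by rewrite /cabs/= expr0n addr0 sqrtr_sqr. Qed.
Lemma absRe_le z : `|Re z| <= cabs z.
Proof. by rewrite -sqrtr_sqr ler_sqrt ?addr_ge0 ?sqr_ge0// lerDl sqr_ge0. Qed.
Lemma absIm_le z : `|Im z| <= cabs z.
Proof. by rewrite -sqrtr_sqr ler_sqrt ?addr_ge0 ?sqr_ge0// lerDr sqr_ge0. Qed.
Lemma cabs_le z : cabs z <= `|Re z| + `|Im z|.
Proof.
rewrite -(@ler_pXn2r _ 2) ?nnegrE ?addr_ge0 ?cabs_ge0//.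
rewrite sqr_cabs sqrrD -!normrX !(ger0_norm (sqr_ge0 _)).
by rewrite -addrA lerD2l lerDr mulrn_wge0// mulr_ge0.
Qed.

Lemma ReM z w : Re (z * w) = Re z * Re w - Im z * Im w.
Proof. by case: z => a b; case: w. Qed.
Lemma ImM z w : Im (z * w) = Re z * Im w + Im z * Re w.
Proof. by case: z => a b; case: w. Qed.
Lemma ReD z w : Re (z + w) = Re z + Re w.
Proof. by case: z => a b; case: w. Qed.
Lemma ImD z w : Im (z + w) = Im z + Im w.
Proof. by case: z => a b; case: w. Qed.
Lemma ReN z : Re (- z) = - Re z. Proof. by case: z. Qed.
Lemma ImN z : Im (- z) = - Im z. Proof. by case: z. Qed.
Lemma ReB z w : Re (z - w) = Re z - Re w. Proof. by rewrite ReD ReN. Qed.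
Lemma ImB z w : Im (z - w) = Im z - Im w. Proof. by rewrite ImD ImN. Qed.
Lemma ReJ z : Re (cj z) = Re z. Proof. by case: z. Qed.
Lemma ImJ z : Im (cj z) = - Im z. Proof. by case: z. Qed.
Lemma conjcM z w : cj (z * w) = cj z * cj w. Proof. exact: rmorphM. Qed.
Lemma conjcD z w : cj (z + w) = cj z + cj w. Proof. exact: rmorphD. Qed.
Lemma conjcN z : cj (- z) = - cj z. Proof. exact: rmorphN. Qed.
Lemma conjcB z w : cj (z - w) = cj z - cj w. Proof. exact: rmorphB. Qed.
Lemma conjcX z n : cj (z ^+ n) = cj z ^+ n. Proof. exact: rmorphXn. Qed.
Lemma conjcR x : cj x%:C = x%:C. Proof. by rewrite /= /conjc oppr0. Qed.
Lemma mulCJ z : z * cj z = (cabs z ^+ 2)%:C.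
Proof. by rewrite sqr_cabs; case: z => a b; simpc; rewrite !expr2 (mulrC a b) addNr. Qed.
Lemma Re_invc z : Re z^-1 = Re z / cabs z ^+ 2.
Proof. by rewrite sqr_cabs; case: z. Qed.
Lemma Im_invc z : Im z^-1 = - Im z / cabs z ^+ 2.
Proof. by rewrite sqr_cabs; case: z => a b /=; rewrite mulNr. Qed.
Lemma complexP z w : Re z = Re w -> Im z = Im w -> z = w.
Proof. by case: z => a b; case: w => c d /= -> ->. Qed.

End ComplexModulus.

Section ComplexMeasurability.
Context d (T : measurableType d) (R : realType).
Implicit Types F G : T -> R[i].

Definition cmeas F :=
  measurable_fun setT (fun t => Re (F t)) /\ measurable_fun setT (fun t => Im (F t)).

Lemma cmeas_cst (z : R[i]) : cmeas (fun=> z).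
Proof. by split; exact: measurable_cst. Qed.

Lemma cmeasD F G : cmeas F -> cmeas G -> cmeas (fun t => F t + G t).
Proof.
move=> [F1 F2] [G1 G2]; split.
- by under eq_fun do rewrite ReD; exact: measurable_funD.
- by under eq_fun do rewrite ImD; exact: measurable_funD.
Qed.

Lemma cmeasN F : cmeas F -> cmeas (fun t => - F t).
Proof.
move=> [F1 F2]; split.
- by under eq_fun do rewrite ReN; exact: measurable_funN.
- by under eq_fun do rewrite ImN; exact: measurable_funN.
Qed.

Lemma cmeasB F G : cmeas F -> cmeas G -> cmeas (fun t => F t - G t).
Proof. by move=> mF mG; apply: cmeasD => //; exact: cmeasN. Qed.

Lemma cmeasM F G : cmeas F -> cmeas G -> cmeas (fun t => F t * G t).
Proof.
move=> [F1 F2] [G1 G2]; split.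
- by under eq_fun do rewrite ReM; apply: measurable_funB; exact: measurable_funM.
- by under eq_fun do rewrite ImM; apply: measurable_funD; exact: measurable_funM.
Qed.

Lemma cmeasJ F : cmeas F -> cmeas (fun t => cj (F t)).
Proof.
move=> [F1 F2]; split.
- by under eq_fun do rewrite ReJ.
- by under eq_fun do rewrite ImJ; exact: measurable_funN.
Qed.

Lemma cmeasR (u : T -> R) : measurable_fun setT u -> cmeas (fun t => (u t)%:C).
Proof. by move=> mu; split => //=; exact: measurable_cst. Qed.

Lemma cmeasX F n : cmeas F -> cmeas (fun t => F t ^+ n).
Proof.
move=> mF; elim: n => [|n ih]; first exact: cmeas_cst.
by under eq_fun do rewrite exprS; exact: cmeasM.
Qed.

(** Inversion is continuous only away from 0, so the singleton is split off. *)
Lemma measurable_inv : measurable_fun [set: R] (@GRing.inv R).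
Proof.
have -> : [set: R] = [set 0] `|` ~` [set 0] by rewrite setUv.
have o0 : open (~` [set (0:R)]) by apply: closed_openC; exact: closed_eq.
apply/measurable_funU; [exact: measurable_set1|exact: open_measurable|].
split; first exact: measurable_fun_set1.
apply: open_continuous_measurable_fun => // x; rewrite inE/= => /eqP x0.
exact: inv_continuous.
Qed.

Lemma measurable_funV (u : T -> R) : measurable_fun setT u ->
  measurable_fun setT (fun t => (u t)^-1).
Proof. by move=> mu; apply: (measurableT_comp measurable_inv). Qed.

Lemma measurable_cabs2 F : cmeas F -> measurable_fun setT (fun t => cabs (F t) ^+ 2).
Proof.
move=> [F1 F2]; under eq_fun do rewrite sqr_cabs.
by apply: measurable_funD; exact: measurable_funX.
Qed.

Lemma measurable_cabs F : cmeas F -> measurable_fun setT (fun t => cabs (F t)).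
Proof.
move=> [F1 F2]; apply: (@measurableT_comp _ _ _ _ _ _ (@Num.sqrt R)).
  by apply: continuous_measurable_fun; exact: sqrt_continuous.
by apply: measurable_funD; exact: measurable_funX.
Qed.

Lemma cmeasV F : cmeas F -> cmeas (fun t => (F t)^-1).
Proof.
move=> mF; have m2 := measurable_funV (measurable_cabs2 mF).
case: mF => F1 F2; split.
- by under eq_fun do rewrite Re_invc; exact: measurable_funM.
- under eq_fun do rewrite Im_invc.
  by apply: measurable_funM => //; exact: measurable_funN.
Qed.

End ComplexMeasurability.

Section PlaneMeasurability.
Variable R : realType.

(** The product sigma-algebra is generated by rectangles; an open set belongs to it as the countable
    union of the squares with rational centre and half-side that it contains. *)
Lemma measurable_box_open (U : set (mR R * mR R)) :
  (forall p, U p -> exists2 e : R, 0 < e &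
    forall q, `|q.1 - p.1| < e -> `|q.2 - p.2| < e -> U q) -> measurable U.
Proof.
move=> oU.
pose B (i : (rat * rat) * rat) : set (mR R * mR R) :=
  `](ratr i.1.1 - ratr i.2), (ratr i.1.1 + ratr i.2)[ `*`
  `](ratr i.1.2 - ratr i.2), (ratr i.1.2 + ratr i.2)[.
have -> : U = \bigcup_(i in [set i | B i `<=` U]) B i.
  apply/seteqP; split => [p Up|p [i iU /iU//]].
  have [e e0 eU] := oU p Up.
  (* With a half-side between [e / 4] and [e / 2] and a centre within [e / 4] of [p] in each
     coordinate, the square contains [p] and stays within [e] of it. *)
  have e4 : 0 < e / 4 by apply: divr_gt0.
  have : 0 < e / 2 by apply: divr_gt0.
  have : e / 4 < e / 2 by lra.
  move=> /rat_in_itvoo[r]; rewrite in_itv/= => /andP[r1 r2] _.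
  have [a] : exists a : rat, ratr a \in `](p.1 - e / 4), (p.1 + e/4)[ by
    apply: rat_in_itvoo; lra.
  rewrite in_itv/= => /andP[a1 a2].
  have [b] : exists b : rat, ratr b \in `](p.2 - e / 4), (p.2 + e/4)[ by
    apply: rat_in_itvoo; lra.
  rewrite in_itv/= => /andP[b1 b2].
  exists ((a, b), r); last by split; rewrite /= in_itv/=; apply/andP; split; lra.
  move=> q [/=]; rewrite !in_itv/= => /andP[? ?] /andP[? ?].
  by apply: eU; rewrite ltr_norml; apply/andP; split; lra.
rewrite bigcup_mkcond; apply: countable_bigcupT_measurable => // i.
by case: ifPn => // _; apply: measurableX; exact: measurable_itv.
Qed.

Lemma measurable_fun_box (D : set (mR R * mR R)) (u : mR R * mR R -> R) :
  (forall p, D p -> forall e : R, 0 < e -> exists2 r : R, 0 < r &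
    forall q, `|q.1 - p.1| < r -> `|q.2 - p.2| < r -> D q /\ `|u q - u p| < e) ->
  measurable_fun D u.
Proof.
move=> uD mD; apply: (measurability _ (RGenOInfty.measurableE R)) => //.
move=> /= _ [_ [a ->] <-]; rewrite preimage_itvoy.
apply: measurable_box_open => p [Dp /= ap].
have [|r r0 H] := uD p Dp (u p - a); first by rewrite subr_gt0.
exists r => // q q1 q2; have [Dq] := H q q1 q2.
rewrite ltr_norml => /andP[+ _]; rewrite opprB ltrBDr subrK => uq.
by split.
Qed.

End PlaneMeasurability.

(** * Complex integrals and the inner product of square-integrable functions *)

Section ComplexIntegral.
Context d (T : measurableType d) (R : realType) (mu : {measure set T -> \bar R}).
Implicit Types (F G : T -> R[i]) (u v : T -> R).

Definition rintegrable u := mu.-integrable setT (EFin \o u).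
Local Notation rint u := (\int[mu]_t (u t)) (only parsing).

Lemma rintegrable_le u v : measurable_fun setT u -> rintegrable v ->
  (forall t, `|u t| <= v t) -> rintegrable u.
Proof.
move=> mf iv uv; apply: le_integrable iv => //; first exact/measurable_EFinP.
by move=> t _ /=; rewrite lee_fin (le_trans (uv t))// ler_norm.
Qed.

Lemma eq_rintegrable u v : u =1 v -> rintegrable u -> rintegrable v.
Proof. by move=> /funext ->. Qed.

Lemma rintegrableD u v : rintegrable u -> rintegrable v ->
  rintegrable (fun t => u t + v t).
Proof.
move=> iu iv; rewrite /rintegrable.
have -> : EFin \o (fun t => u t + v t) = (EFin \o u) \+ (EFin \o v).
  by apply/funext => t /=; rewrite EFinD.
exact: integrableD.
Qed.

Lemma rintegrableZ (c : R) u : rintegrable u -> rintegrable (fun t => c * u t).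
Proof.
move=> iu; rewrite /rintegrable.
have -> : EFin \o (fun t => c * u t) = (fun t => c%:E * (EFin \o u) t)%E.
  by apply/funext => t /=; rewrite EFinM.
exact: integrableZl.
Qed.

Lemma rintegrableN u : rintegrable u -> rintegrable (fun t => - u t).
Proof.
by move=> iu; under eq_fun do rewrite -mulN1r; exact: rintegrableZ.
Qed.

Lemma rintegrableB u v : rintegrable u -> rintegrable v ->
  rintegrable (fun t => u t - v t).
Proof. by move=> iu iv; apply: rintegrableD => //; exact: rintegrableN. Qed.

Lemma rintegrable_measurable u : rintegrable u -> measurable_fun setT u.
Proof. by move=> /measurable_int/measurable_EFinP. Qed.

Lemma rintegrable_norm u : rintegrable u -> rintegrable (fun t => `|u t|).
Proof. by move=> iu; exact: integrable_norm. Qed.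

Lemma rintD u v : rintegrable u -> rintegrable v ->
  rint (fun t => u t + v t) = rint u + rint v :> R.
Proof. by move=> iu iv; rewrite RintegralD. Qed.

Lemma rintZ (c : R) u : rintegrable u -> rint (fun t => c * u t) = c * rint u :> R.
Proof. by move=> iu; rewrite RintegralZl. Qed.

Lemma rintN u : rintegrable u -> rint (fun t => - u t) = - rint u :> R.
Proof.
by move=> iu; under eq_Rintegral do rewrite -mulN1r; rewrite rintZ// mulN1r.
Qed.

Lemma rintB u v : rintegrable u -> rintegrable v ->
  rint (fun t => u t - v t) = rint u - rint v :> R.
Proof. by move=> iu iv; rewrite RintegralB. Qed.

Lemma rint_le u v : rintegrable u -> rintegrable v -> (forall t, u t <= v t) ->
  rint u <= rint v.
Proof. by move=> iu iv uv; apply: le_Rintegral => // t _; exact: uv. Qed.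

Lemma rintE u : rintegrable u -> (rint u)%:E = (\int[mu]_t (u t)%:E)%E.
Proof. by move=> iu; rewrite /Rintegral fineK//; exact: integrable_fin_num. Qed.

Lemma rint_dominated (u_ : nat -> T -> R) u v :
  (forall n, measurable_fun setT (u_ n)) -> measurable_fun setT u ->
  rintegrable v -> (forall n t, `|u_ n t| <= v t) ->
  (forall t, u_ n t @[n --> \oo] --> u t) ->
  rintegrable u /\ (rint (u_ n) : R^o) @[n --> \oo] --> (rint u : R^o).
Proof.
move=> mu_ mf iv uv cu.
have f_f : {ae mu, forall t, setT t -> (fun n => (u_ n t)%:E) @ \oo --> (u t)%:E}.
  by apply: aeW => t _; apply: cvg_EFin; [exact: nearW|exact: cu].
have f_g : {ae mu, forall t n, setT t -> (`|(u_ n t)%:E| <= (v t)%:E)%E}.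
  by apply: aeW => t n _; rewrite lee_fin.
have [iu _ H] := dominated_convergence measurableT
  (fun n => measurableT_comp (@EFin_measurable R setT) (mu_ n))
  (measurableT_comp (@EFin_measurable R setT) mf) f_f iv f_g.
split; first exact: iu.
by apply: fine_cvg; rewrite rintE.
Qed.

Definition cintegrable F :=
  rintegrable (fun t => Re (F t)) /\ rintegrable (fun t => Im (F t)).

Definition cint F : R[i] := (rint (fun t => Re (F t))) +i* (rint (fun t => Im (F t))).

Lemma cintegrable_cmeas F : cintegrable F -> cmeas F.
Proof. by move=> [F1 F2]; split; exact: rintegrable_measurable. Qed.

Lemma cintegrable_le F v : cmeas F -> rintegrable v -> (forall t, cabs (F t) <= v t) ->
  cintegrable F.
Proof.
move=> [F1 F2] iv Fv; split; apply: rintegrable_le iv _ => // t.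
- exact: le_trans (absRe_le _) (Fv t).
- exact: le_trans (absIm_le _) (Fv t).
Qed.

Lemma cintegrable_cabs F : cintegrable F -> rintegrable (fun t => cabs (F t)).
Proof.
move=> iF; have mF := cintegrable_cmeas iF; case: iF => F1 F2.
apply: rintegrable_le (rintegrableD (rintegrable_norm F1) (rintegrable_norm F2)) _.
  exact: measurable_cabs.
by move=> t; rewrite ger0_norm ?cabs_ge0//; exact: cabs_le.
Qed.

Lemma cintegrableZ (c : R[i]) F : cintegrable F -> cintegrable (fun t => c * F t).
Proof.
move=> [F1 F2]; split.
- apply: eq_rintegrable (fun t => esym (ReM _ _)) _.
  by apply: rintegrableB; exact: rintegrableZ.
- apply: eq_rintegrable (fun t => esym (ImM _ _)) _.
  by apply: rintegrableD; exact: rintegrableZ.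
Qed.

Lemma cintD F G : cintegrable F -> cintegrable G ->
  cint (fun t => F t + G t) = cint F + cint G.
Proof.
move=> [F1 F2] [G1 G2]; apply: complexP; rewrite ?ReD ?ImD/= -rintD//;
  by apply: eq_Rintegral => t _; rewrite ?ReD ?ImD.
Qed.

Lemma cintZ (c : R[i]) F : cintegrable F -> cint (fun t => c * F t) = c * cint F.
Proof.
move=> [F1 F2]; apply: complexP; rewrite ?ReM ?ImM/=.
- rewrite -!rintZ// -rintB; try exact: rintegrableZ.
  by apply: eq_Rintegral => t _; rewrite ReM.
- rewrite -!rintZ// -rintD; try exact: rintegrableZ.
  by apply: eq_Rintegral => t _; rewrite ImM.
Qed.

Lemma cintJ F : cintegrable F -> cint (fun t => cj (F t)) = cj (cint F).
Proof.
move=> [F1 F2]; apply: complexP; rewrite ?ReJ ?ImJ/=.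
- by apply: eq_Rintegral => t _; rewrite ReJ.
- by rewrite -rintN//; apply: eq_Rintegral => t _; rewrite ImJ.
Qed.

Lemma cintegrableJ F : cintegrable F -> cintegrable (fun t => cj (F t)).
Proof.
move=> [F1 F2]; split.
- by under eq_fun do rewrite ReJ.
- by under eq_fun do rewrite ImJ; exact: rintegrableN.
Qed.

Lemma eq_cint F G : F =1 G -> cint F = cint G.
Proof. by move=> FG; congr cint; apply/funext. Qed.

(** Functions are not taken modulo null sets, so [nsq] may vanish at a nonzero function; on the
    Bergman space the reproducing property excludes this. *)
Definition sqint F := cmeas F /\ rintegrable (fun t => cabs (F t) ^+ 2).
Definition nsq F : R := rint (fun t => cabs (F t) ^+ 2).
Definition inner F G := cint (fun t => F t * cj (G t)).

Lemma sqint_mulJ F G : sqint F -> sqint G -> cintegrable (fun t => F t * cj (G t)).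
Proof.
move=> [mF iF] [mG iG].
apply: cintegrable_le (rintegrableD iF iG) _ => [|t].
  by apply: cmeasM => //; exact: cmeasJ.
rewrite cabsM cabsJ.
by have := sqr_ge0 (cabs (F t) - cabs (G t)); have := cabs_ge0 (F t);
  have := cabs_ge0 (G t); nra.
Qed.

Lemma sqintD F G : sqint F -> sqint G -> sqint (fun t => F t + G t).
Proof.
move=> [mF iF] [mG iG].
have mFG : cmeas (fun t => F t + G t) by exact: cmeasD.
split=> //; apply: rintegrable_le (rintegrableZ 2 (rintegrableD iF iG)) _.
  exact: measurable_cabs2.
move=> t; rewrite ger0_norm ?sqr_ge0//.
apply: (@le_trans _ _ ((cabs (F t) + cabs (G t)) ^+ 2)).
  by rewrite ler_pXn2r ?nnegrE ?addr_ge0 ?cabs_ge0// cabsD.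
by have := sqr_ge0 (cabs (F t) - cabs (G t)); nra.
Qed.

Lemma sqintZ (c : R[i]) F : sqint F -> sqint (fun t => c * F t).
Proof.
move=> [mF iF]; split; first by apply: cmeasM => //; exact: cmeas_cst.
by under eq_fun do rewrite cabsM exprMn; exact: rintegrableZ.
Qed.

Lemma inner_self F : sqint F -> inner F F = (nsq F)%:C.
Proof.
move=> [mF iF]; apply: complexP => /=.
  by apply: eq_Rintegral => t _; rewrite mulCJ.
rewrite -[RHS](mul0r (nsq F)) -rintZ//.
by apply: eq_Rintegral => t _; rewrite mulCJ /= mul0r.
Qed.

Lemma inner_conj F G : sqint F -> sqint G -> inner G F = cj (inner F G).
Proof.
move=> hF hG; rewrite -cintJ; last exact: sqint_mulJ.
by apply: eq_cint => t; rewrite conjcM conjcK mulrC.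
Qed.

Lemma innerDl F G H : sqint F -> sqint G -> sqint H ->
  inner (fun t => F t + G t) H = inner F H + inner G H.
Proof.
move=> hF hG hH; rewrite -cintD; try exact: sqint_mulJ.
by apply: eq_cint => t; rewrite mulrDl.
Qed.

Lemma innerZl (c : R[i]) F G : sqint F -> sqint G ->
  inner (fun t => c * F t) G = c * inner F G.
Proof.
move=> hF hG; rewrite -cintZ; last exact: sqint_mulJ.
by apply: eq_cint => t; rewrite mulrA.
Qed.

Lemma innerDr F G H : sqint F -> sqint G -> sqint H ->
  inner H (fun t => F t + G t) = inner H F + inner H G.
Proof.
move=> hF hG hH.
by rewrite inner_conj ?innerDl ?conjcD -?inner_conj//; exact: sqintD.
Qed.

Lemma innerZr (c : R[i]) F G : sqint F -> sqint G ->
  inner G (fun t => c * F t) = cj c * inner G F.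
Proof.
by move=> hF hG; rewrite inner_conj ?innerZl ?conjcM -?inner_conj//; exact: sqintZ.
Qed.

Lemma nsq_ge0 F : 0 <= nsq F.
Proof. by apply: Rintegral_ge0 => t _; exact: sqr_ge0. Qed.

Lemma nsqZ (c : R[i]) F : sqint F -> nsq (fun t => c * F t) = cabs c ^+ 2 * nsq F.
Proof.
move=> [mF iF]; rewrite /nsq -rintZ//.
by apply: eq_Rintegral => t _; rewrite cabsM exprMn.
Qed.

Lemma nsqD F G : sqint F -> sqint G ->
  nsq (fun t => F t + G t) = nsq F + nsq G + 2 * Re (inner F G).
Proof.
move=> hF hG; have hFG := sqintD hF hG.
have /(congr1 (@complex.Re R)) := inner_self hFG.
rewrite innerDl// !innerDr// (inner_conj hF hG) !inner_self//.
by rewrite !ReD ReJ /= => <-; ring.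
Qed.

(** The squared norm of [F - s * a * G], with [a] the inner product and [s] real, is a quadratic
    polynomial in [s] that is never negative. *)
Lemma cauchy_schwarz F G : sqint F -> sqint G ->
  cabs (inner F G) ^+ 2 <= nsq F * nsq G.
Proof.
move=> hF hG; set a := inner F G.
have H (s : R) : 0 <= nsq F + s ^+ 2 * cabs a ^+ 2 * nsq G - 2 * s * cabs a ^+ 2.
  have := nsq_ge0 (fun t => F t + (- s%:C * a) * G t).
  rewrite nsqD//; last exact: sqintZ.
  rewrite nsqZ// innerZr// -/a conjcM conjcN conjcR.
  rewrite cabsM cabsN cabsR exprMn real_normK ?num_real// -mulrA (mulrC _ a) mulCJ.
  rewrite mulNr ReN ReM /= mul0r subr0 => h; apply: le_trans h _.
  by rewrite le_eqVlt; apply/orP; left; apply/eqP; ring.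
have [G0|G0] := eqVneq (nsq G) 0.
  rewrite G0 mulr0 leNgt; apply/negP => a0.
  have {}a0 : cabs a != 0 by rewrite -sqrf_eq0 gt_eqF.
  (* The polynomial is affine here, and this [s] would give it the value -1. *)
  have := H ((nsq F + 1) / (2 * cabs a ^+ 2)).
  rewrite G0 mulr0 addr0.
  rewrite (_ : 2 * _ * _ = nsq F + 1); first by lra.
  by field.
have Gp : 0 < nsq G by rewrite lt_def G0 nsq_ge0.
have := mulr_ge0 (ltW Gp) (H (nsq G)^-1).
rewrite (_ : nsq G * _ = nsq F * nsq G - cabs a ^+ 2); first by rewrite subr_ge0.
by field.
Qed.

Lemma inner_eq0 F G : sqint F -> sqint G -> nsq G = 0 -> inner F G = 0.
Proof.
move=> hF hG G0; have := cauchy_schwarz hF hG; rewrite G0 mulr0 => h.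
by apply/eqP; rewrite -cabs_eq0 -sqrf_eq0 eq_le h sqr_ge0.
Qed.

(** The squared norm of a sum determines the real part of the inner product; [a = 1] and [a = i]
    recover both parts. *)
Lemma polarization (C : R) F G F' G' : sqint F -> sqint G -> sqint F' -> sqint G' ->
  nsq F' = C * nsq F -> nsq G' = C * nsq G ->
  (forall a : R[i], nsq (fun t => F' t + a * G' t) = C * nsq (fun t => F t + a * G t)) ->
  inner F' G' = C%:C * inner F G.
Proof.
move=> hF hG hF' hG' FF GG H.
have key (a : R[i]) : Re (cj a * inner F' G') = C * Re (cj a * inner F G).
  have := H a; rewrite !nsqD//; try exact: sqintZ.
  rewrite !nsqZ// !innerZr// FF GG => h; lra.
apply: complexP.
  by have := key 1; rewrite conjc1 !mul1r => ->; rewrite ReM /= mul0r subr0.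
have := key (0 +i* 1); rewrite !ReM !ImM /= !mul0r !sub0r !mulN1r !opprK => ->.
by rewrite addr0.
Qed.

End ComplexIntegral.

(** * Wirtinger derivatives *)

Section ComplexContinuity.
Variable R : realType.
Implicit Types (F G : R[i] -> R[i]) (z w : R[i]).

Definition ccont F z := forall e : R, 0 < e -> exists2 d : R, 0 < d &
  forall w, cabs (w - z) < d -> cabs (F w - F z) < e.

Lemma ltc_cabs z (e : R) : (`|z| < e%:C) = (cabs z < e).
Proof. by rewrite normcabs ltcR. Qed.

Lemma gt0_realC (e : R[i]) : 0 < e -> exists2 r : R, 0 < r & e = r%:C.
Proof.
by case: e => a b; rewrite ltcE /= => /andP[/eqP -> a0]; exists a.
Qed.

Lemma nbhs_cabsP z (P : R[i] -> Prop) :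
  (\forall w \near (z : R[i]^o), P w) <->
  exists2 d : R, 0 < d & forall w, cabs (w - z) < d -> P w.
Proof.
split=> [/nbhs_ballP[e /= e0 eP]|[d d0 dP]].
  have [d d0 ed] := gt0_realC e0; exists d => // w wd.
  by apply: eP; rewrite -ball_normE /= ed ltc_cabs cabs_distC.
apply/nbhs_ballP; exists d%:C => /=; first by rewrite ltcR.
by move=> w; rewrite -ball_normE /= ltc_cabs cabs_distC; exact: dP.
Qed.

Lemma ccontP F z : ccont F z <-> {for z, continuous (F : R[i]^o -> R[i]^o)}.
Proof.
split=> [cF P /nbhs_cabsP[e e0 eP]|cF e e0].
  by apply/nbhs_cabsP; have [d d0 dF] := cF _ e0; exists d => // w /dF/eP.
have : nbhs (F z : R[i]^o) [set u | cabs (u - F z) < e].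
  by apply/nbhs_cabsP; exists e.
by move=> /cF/nbhs_cabsP.
Qed.

Lemma ccont_cst (c : R[i]) z : ccont (fun=> c) z.
Proof. by move=> e e0; exists 1 => // w _; rewrite subrr cabs0. Qed.

Lemma ccont_id z : ccont id z.
Proof. by move=> e e0; exists e. Qed.

Lemma ccontD F G z : ccont F z -> ccont G z -> ccont (fun w => F w + G w) z.
Proof.
move=> cF cG e e0; have e2 : 0 < e / 2 by apply: divr_gt0.
have [d d0 dF] := cF _ e2; have [d' d'0 dG] := cG _ e2.
exists (Num.min d d'); first by rewrite lt_min d0.
move=> w; rewrite lt_min => /andP[/dF h /dG h'].
rewrite opprD addrACA (le_lt_trans (cabsD _ _))// (splitr e); exact: ltrD.
Qed.

Lemma ccontN F z : ccont F z -> ccont (fun w => - F w) z.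
Proof. by move=> /ccontP cF; apply/ccontP; exact: (@continuousN _ R[i]^o R[i]^o). Qed.

Lemma ccontM F G z : ccont F z -> ccont G z -> ccont (fun w => F w * G w) z.
Proof.
move=> cF cG e e0; set p := cabs (F z); set q := cabs (G z).
have p0 : 0 <= p by exact: cabs_ge0.
have q0 : 0 <= q by exact: cabs_ge0.
(* When both increments are below [r <= 1], the three error terms add up to at most
   [r * (1 + p + q)]. *)
pose r := Num.min 1 (e / (2 + p + q)).
have r0 : 0 < r by rewrite lt_min ltr01 divr_gt0//; lra.
have r1 : r <= 1 by rewrite ge_min lexx.
have re : r * (2 + p + q) <= e.
  by rewrite -ler_pdivlMr ?ge_min ?lexx ?orbT//; lra.
have [d d0 dF] := cF _ r0; have [d' d'0 dG] := cG _ r0.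
exists (Num.min d d'); first by rewrite lt_min d0.
move=> w; rewrite lt_min => /andP[/dF h /dG h'].
rewrite (_ : _ - _ = (F w - F z) * (G w - G z) + (F z * (G w - G z) + (F w - F z) * G z));
  last by ring.
rewrite (le_lt_trans (cabsD _ _))// (le_lt_trans (lerD (lexx _) (cabsD _ _)))//.
rewrite !cabsM -/p -/q.
have := cabs_ge0 (F w - F z); have := cabs_ge0 (G w - G z).
move: (cabs (F w - F z)) (cabs (G w - G z)) h h' => x y; nra.
Qed.

Lemma ccontV F z : F z != 0 -> ccont F z -> ccont (fun w => (F w)^-1) z.
Proof. by move=> F0 /ccontP cF; apply/ccontP; exact: (@continuousV _ R[i]^o). Qed.

Lemma ccontX F n z : ccont F z -> ccont (fun w => F w ^+ n) z.
Proof.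
move=> cF; elim: n => [|n ih]; first exact: ccont_cst.
by under eq_fun do rewrite exprS; exact: ccontM.
Qed.

Lemma ccontJ F z : ccont F z -> ccont (fun w => cj (F w)) z.
Proof.
move=> cF e /cF[d d0 dF]; exists d => // w /dF.
by rewrite -conjcB cabsJ.
Qed.

Lemma ccont_comp F G z : ccont F (G z) -> ccont G z -> ccont (fun w => F (G w)) z.
Proof.
by move=> cF cG e /cF[d /cG[d' d'0 dG] dF]; exists d' => // w /dG/dF.
Qed.

Lemma ccont_near F G z (d : R) : 0 < d -> (forall w, cabs (w - z) < d -> F w = G w) ->
  ccont F z -> ccont G z.
Proof.
move=> d0 FG cF e /cF[r r0 rF]; exists (Num.min d r); first by rewrite lt_min d0.
move=> w; rewrite lt_min => /andP[wd wr]; rewrite -!FG ?subrr ?cabs0//; exact: rF.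
Qed.

(* Wirtinger differentiability, [A] and [B] being the derivatives with respect
   to [z] and to its conjugate, in the form of Caratheodory. *)
Definition wirtinger F z A B := exists a b : R[i] -> R[i],
  [/\ a z = A, b z = B, ccont a z, ccont b z &
      forall w, F w = F z + a w * (w - z) + b w * cj (w - z)].

Lemma wirtinger_cont F z A B : wirtinger F z A B -> ccont F z.
Proof.
move=> [a [b [_ _ ca cb FE]]].
rewrite (_ : F = fun w => F z + a w * (w - z) + b w * cj (w - z)); last exact/funext.
have cd : ccont (fun w => w - z) z.
  by apply: ccontD; [exact: ccont_id|exact: ccont_cst].
apply: ccontD; last by apply: ccontM => //; exact: ccontJ.
by apply: ccontD; [exact: ccont_cst|exact: ccontM].
Qed.

Lemma wirtinger_littleo F z A B : wirtinger F z A B <->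
  forall e : R, 0 < e -> exists2 d : R, 0 < d & forall w, cabs (w - z) < d ->
    cabs (F w - F z - A * (w - z) - B * cj (w - z)) <= e * cabs (w - z).
Proof.
split=> [[a [b [<- <- ca cb FE]]] e e0|H].
  have e2 : 0 < e / 2 by apply: divr_gt0.
  have [d1 d10 H1] := ca _ e2; have [d2 d20 H2] := cb _ e2.
  exists (Num.min d1 d2); first by rewrite lt_min d10.
  move=> w; rewrite lt_min => /andP[/H1 aw /H2 bw].
  rewrite FE (_ : _ - _ = (a w - a z) * (w - z) + (b w - b z) * cj (w - z)); last by ring.
  rewrite (le_trans (cabsD _ _))// !cabsM cabsJ -mulrDl ler_wpM2r ?cabs_ge0//.
  by rewrite (splitr e) lerD// ltW.
(* The whole remainder is charged to the slope along [w - z]; the other slope is constant. *)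
pose a w := A + (F w - F z - A * (w - z) - B * cj (w - z)) / (w - z).
exists a, (fun=> B); split => //.
- by rewrite /a (subrr z) invr0 !mulr0 addr0.
- move=> e e0; have e2 : 0 < e / 2 by apply: divr_gt0.
  have [d d0 dF] := H _ e2; exists d => // w wd.
  rewrite {2}/a (subrr z) invr0 !mulr0 addr0 /a.
  rewrite addrAC subrr add0r cabsM cabsV.
  have [->|wz] := eqVneq w z; first by rewrite (subrr z) cabs0 invr0 mulr0.
  have wz0 : 0 < cabs (w - z) by rewrite cabs_gt0 subr_eq0.
  rewrite ltr_pdivrMr// (le_lt_trans (dF _ wd))// ltr_pM2r//; lra.
- exact: ccont_cst.
- move=> w; have [->|wz] := eqVneq w z; first by rewrite !subrr conjc0 !mulr0 !addr0.
  rewrite /a mulrDl mulfVK ?subr_eq0//; ring.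
Qed.

Lemma wirtinger_near F G z A B (d : R) : 0 < d ->
  (forall w, cabs (w - z) < d -> F w = G w) -> wirtinger F z A B -> wirtinger G z A B.
Proof.
move=> d0 FG /wirtinger_littleo H; apply/wirtinger_littleo => e /H[r r0 rF].
exists (Num.min d r); first by rewrite lt_min d0.
move=> w; rewrite lt_min => /andP[wd wr]; rewrite -!FG ?subrr ?cabs0//; exact: rF.
Qed.

Lemma wirtinger_cst (c : R[i]) z : wirtinger (fun=> c) z 0 0.
Proof.
exists (fun=> 0), (fun=> 0); split=> //; try exact: ccont_cst.
by move=> w; rewrite !mul0r !addr0.
Qed.

Lemma wirtinger_id z : wirtinger id z 1 0.
Proof.
exists (fun=> 1), (fun=> 0); split=> //; try exact: ccont_cst.
by move=> w; rewrite mul0r mul1r addr0 addrC subrK.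
Qed.

Lemma wirtinger_conj z : wirtinger (fun w => cj w) z 0 1.
Proof.
exists (fun=> 0), (fun=> 1); split=> //; try exact: ccont_cst.
by move=> w; rewrite mul0r mul1r addr0 conjcB addrC subrK.
Qed.

Lemma wirtingerD F G z A B A' B' : wirtinger F z A B -> wirtinger G z A' B' ->
  wirtinger (fun w => F w + G w) z (A + A') (B + B').
Proof.
move=> [a [b [<- <- ca cb FE]]] [a' [b' [<- <- ca' cb' GE]]].
exists (fun w => a w + a' w), (fun w => b w + b' w); split=> //; try exact: ccontD.
by move=> w; rewrite FE GE; ring.
Qed.

Lemma wirtingerM F G z A B A' B' : wirtinger F z A B -> wirtinger G z A' B' ->
  wirtinger (fun w => F w * G w) z (A * G z + F z * A') (B * G z + F z * B').
Proof.
move=> dF dG; have cG := wirtinger_cont dG.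
move: dF dG => [a [b [<- <- ca cb FE]]] [a' [b' [<- <- ca' cb' GE]]].
exists (fun w => a w * G w + F z * a' w), (fun w => b w * G w + F z * b' w).
split=> //; try by apply: ccontD; apply: ccontM => //; exact: ccont_cst.
move=> w; have FG : F z * G w = F z * (G z + a' w * (w - z) + b' w * cj (w - z)).
  by rewrite -GE.
rewrite {1}FE !mulrDl FG; ring.
Qed.

Lemma wirtingerZ (c : R[i]) F z A B : wirtinger F z A B ->
  wirtinger (fun w => c * F w) z (c * A) (c * B).
Proof.
by move=> /(wirtingerM (wirtinger_cst c z)); rewrite !mul0r !add0r.
Qed.

Lemma wirtingerX F z A B n : wirtinger F z A B ->
  wirtinger (fun w => F w ^+ n.+1) z (n.+1%:R * F z ^+ n * A) (n.+1%:R * F z ^+ n * B).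
Proof.
move=> dF; elim: n => [|n ih].
  by under eq_fun do rewrite expr1; rewrite expr0 !mul1r.
have := wirtingerM dF ih; under eq_fun do rewrite -exprS.
congr wirtinger; rewrite exprS -[n.+2]addn1 natrD; ring.
Qed.

Lemma wirtinger_comp F G z D A B : wirtinger F (G z) D 0 -> wirtinger G z A B ->
  wirtinger (fun w => F (G w)) z (D * A) (D * B).
Proof.
move=> /wirtinger_littleo H dG; have cG := wirtinger_cont dG.
case: dG => [a [b [<- <- ca cb GE]]].
(* A holomorphic outer function has a slope without conjugate term. At [G z] the quotient is 0
   because [0^-1 = 0], so the slope there is [D], as it should be. *)
have [d [<- cd FE]] : exists d : R[i] -> R[i], [/\ d (G z) = D, ccont d (G z) &
    forall u, F u = F (G z) + d u * (u - G z)].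
  have {}H : forall e : R, 0 < e -> exists2 d : R, 0 < d & forall w, cabs (w - G z) < d ->
      cabs (F w - F (G z) - D * (w - G z)) <= e * cabs (w - G z).
    move=> e /H[r r0 rF]; exists r => // w /rF; by rewrite mul0r subr0.
  exists (fun u => D + (F u - F (G z) - D * (u - G z)) / (u - G z)); split.
  - by rewrite (subrr (G z)) invr0 !mulr0 addr0.
  - move=> e e0; have e2 : 0 < e / 2 by apply: divr_gt0.
    have [r r0 rF] := H _ e2; exists r => // w wd.
    rewrite (subrr (G z)) invr0 mulr0 addr0.
    rewrite addrAC subrr add0r cabsM cabsV.
    have [->|wz] := eqVneq w (G z); first by rewrite (subrr (G z)) cabs0 invr0 mulr0.
    have wz0 : 0 < cabs (w - G z) by rewrite cabs_gt0 subr_eq0.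
    rewrite ltr_pdivrMr// (le_lt_trans (rF _ wd))// ltr_pM2r//; lra.
  - move=> w; have [->|wz] := eqVneq w (G z); first by rewrite !subrr !mulr0 !addr0.
    rewrite mulrDl mulfVK ?subr_eq0//; ring.
exists (fun w => d (G w) * a w), (fun w => d (G w) * b w).
split=> //; try by apply: ccontM => //; exact: ccont_comp cd cG.
by move=> w; rewrite FE [X in _ * (X - _)]GE; ring.
Qed.

Lemma wirtinger_inv z : z != 0 -> wirtinger (fun w => w^-1) z (- z^-1 ^+ 2) 0.
Proof.
move=> z0.
(* The value at [w = 0] is forced by the convention [0^-1 = 0]; being far from [z], it does not
   affect continuity there. *)
exists (fun w => if w == 0 then z^-1 * z^-1 else - (z^-1 * w^-1)), (fun=> 0).
split=> //.
- by rewrite (negbTE z0) expr2.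
- apply: (@ccont_near (fun w => - (z^-1 * w^-1)) _ _ (cabs z)).
  + by rewrite cabs_gt0.
  + move=> w; case: eqVneq => // ->; by rewrite sub0r cabsN ltxx.
  + by apply/ccontN/ccontM; [exact: ccont_cst|apply: ccontV => //; exact: ccont_id].
- exact: ccont_cst.
- move=> w; case: eqVneq => [->|w0].
    by rewrite invr0 mul0r addr0 sub0r mulrN mulfVK// subrr.
  by rewrite mul0r addr0; field; rewrite w0.
Qed.

Lemma wirtingerV F z A B : F z != 0 -> wirtinger F z A B ->
  wirtinger (fun w => (F w)^-1) z (- (F z)^-1 ^+ 2 * A) (- (F z)^-1 ^+ 2 * B).
Proof. by move=> F0; apply: wirtinger_comp; exact: wirtinger_inv. Qed.

Lemma wirtinger_unique F z A A' : wirtinger F z A 0 -> wirtinger F z A' 0 -> A = A'.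
Proof.
move=> /wirtinger_littleo H /wirtinger_littleo H'; apply/eqP; rewrite -subr_eq0.
rewrite -cabs_eq0 eq_le cabs_ge0 andbT; apply/ler_addgt0Pr => e e0; rewrite add0r.
have e2 : 0 < e / 2 by apply: divr_gt0.
have [d d0 dF] := H _ e2; have [d' d'0 dF'] := H' _ e2.
pose r := Num.min d d' / 2.
have r0 : 0 < r by rewrite divr_gt0// lt_min d0.
have m2 : r < Num.min d d' by rewrite /r gtr_pMr ?lt_min ?d0//; lra.
have rd : r < d by rewrite (lt_le_trans m2)// ge_min lexx.
have rd' : r < d' by rewrite (lt_le_trans m2)// ge_min lexx orbT.
have wz : z + r%:C - z = r%:C by rewrite addrAC subrr add0r.
have cr : cabs r%:C = r by rewrite cabsR gtr0_norm.
have := dF (z + r%:C); have := dF' (z + r%:C); rewrite wz cr.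
move=> /(_ rd') h' /(_ rd) h; rewrite -(ler_pM2r r0) -[in leLHS]cr -cabsM.
rewrite [X in cabs X](_ : _ = (F (z + r%:C) - F z - A' * r%:C - 0 * cj r%:C) -
  (F (z + r%:C) - F z - A * r%:C - 0 * cj r%:C)); last by ring.
rewrite (le_trans (cabsB _ _))// (le_trans (lerD h' h))//; lra.
Qed.

Lemma derivable_wirtinger F z :
  derivable (F : R[i]^o -> R[i]^o) z 1 <-> exists A, wirtinger F z A 0.
Proof.
split=> [/cvg_ex[/= A HA]|[A /wirtinger_littleo H]].
  exists A; apply/wirtinger_littleo => e e0.
  have : nbhs (A : R[i]^o) [set u | cabs (u - A) < e].
    by apply/nbhs_cabsP; exists e.
  move=> /HA/nbhs_cabsP[d d0 dF].
  exists d => // w wd; have [->|wz] := eqVneq w z.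
    by rewrite !subrr conjc0 !mulr0 !subr0 cabs0 mulr0.
  rewrite mul0r subr0; have wz0 : w - z != 0 by rewrite subr_eq0.
  have := dF (w - z); rewrite subr0 => /(_ wd wz0).
  rewrite /GRing.scale/= mulr1 subrK => /ltW h'.
  rewrite [X in cabs X](_ : _ = ((w - z)^-1 * (F w - F z) - A) * (w - z)).
    by rewrite cabsM ler_wpM2r// cabs_ge0.
  by field.
apply/cvg_ex; exists A => P /nbhs_cabsP[r r0 rP].
have r2 : 0 < r / 2 by apply: divr_gt0.
have [d d0 dF] := H _ r2.
apply/nbhs_cabsP; exists d => // w; rewrite subr0 => wd w0.
apply: rP; rewrite /GRing.scale/= mulr1.
have := dF (w + z); rewrite addrK mul0r subr0 => /(_ wd) h.
have w0' : 0 < cabs w by rewrite cabs_gt0.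
rewrite -(ltr_pM2r w0') -cabsM.
rewrite [X in cabs X](_ : _ = F (w + z) - F z - A * w); last by field.
rewrite (le_lt_trans h)// ltr_pM2r//; lra.
Qed.

End ComplexContinuity.

(** * Green's formula on a rectangle *)

Section Bisection.
Variable R : realType.

(** Cousin's lemma for rectangles: if [P] failed, repeated quartering would give nested rectangles
    on which it fails, shrinking to a point where the local hypothesis applies. It serves both
    Goursat's estimate and the boundedness of continuous functions. *)
Lemma rectangle_bisection (P : R -> R -> R -> R -> Prop) (a b c d : R) :
  a <= b -> c <= d ->
  (forall a' b' c' d', a' <= b' -> c' <= d' ->
    P a' ((a' + b') / 2) c' ((c' + d') / 2) -> P ((a' + b') / 2) b' c' ((c' + d') / 2) ->
    P a' ((a' + b') / 2) ((c' + d') / 2) d' -> P ((a' + b') / 2) b' ((c' + d') / 2) d' ->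
    a <= a' -> b' <= b -> c <= c' -> d' <= d -> P a' b' c' d') ->
  (forall x y, a <= x <= b -> c <= y <= d -> exists2 r : R, 0 < r &
    forall a' b' c' d', a <= a' -> a' <= x -> x <= b' -> b' <= b ->
      c <= c' -> c' <= y -> y <= d' -> d' <= d ->
      (b' - a') + (d' - c') < r -> P a' b' c' d') ->
  P a b c d.
Proof.
move=> ab cd Pquarter Ploc; apply: contrapT => nP.
pose ok (q : R * R * R * R) := [/\ a <= q.1.1.1, q.1.1.1 <= q.1.1.2 & q.1.1.2 <= b] /\
  [/\ c <= q.1.2, q.1.2 <= q.2 & q.2 <= d] /\ ~ P q.1.1.1 q.1.1.2 q.1.2 q.2.
pose quarter (q q' : R * R * R * R) := [/\ q.1.1.1 <= q'.1.1.1, q'.1.1.2 <= q.1.1.2,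
  q'.1.1.2 - q'.1.1.1 = (q.1.1.2 - q.1.1.1) / 2,
  q.1.2 <= q'.1.2 & q'.2 <= q.2] /\ q'.2 - q'.1.2 = (q.2 - q.1.2) / 2.
have step q : exists q', ok q -> ok q' /\ quarter q q'.
  have [okq|nokq] := pselect (ok q); last by exists q => /nokq.
  case: q okq => -[[a' b'] c'] d'; rewrite /ok /quarter/= => -[[? ? ?] [[? ? ?] nPq]].
  have half (x : R) : (x + x) / 2 = x by field.
  have [h1|h1] := pselect (P a' ((a' + b') / 2) c' ((c' + d') / 2)); last first.
    by exists (a', (a' + b') / 2, c', (c' + d') / 2) => _ /=;
      do ?split => //=; lra.
  have [h2|h2] := pselect (P ((a' + b') / 2) b' c' ((c' + d') / 2)); last first.
    by exists ((a' + b') / 2, b', c', (c' + d') / 2) => _ /=;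
      do ?split => //=; lra.
  have [h3|h3] := pselect (P a' ((a' + b') / 2) ((c' + d') / 2) d'); last first.
    by exists (a', (a' + b') / 2, (c' + d') / 2, d') => _ /=;
      do ?split => //=; lra.
  have [h4|h4] := pselect (P ((a' + b') / 2) b' ((c' + d') / 2) d'); last first.
    by exists ((a' + b') / 2, b', (c' + d') / 2, d') => _ /=;
      do ?split => //=; lra.
  by exfalso; apply: nPq; exact: Pquarter.
have [f fP] := choice step.
pose u n := iter n f (a, b, c, d).
have uok n : ok (u n).
  elim: n => [|n ih]; first by do ?split => //=; lra.
  exact: (fP _ ih).1.
have uq n : quarter (u n) (u n.+1) := (fP _ (uok n)).2.
have size n : (u n).1.1.2 - (u n).1.1.1 = (b - a) / 2 ^+ n /\
              (u n).2 - (u n).1.2 = (d - c) / 2 ^+ n.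
  elim: n => [|n [ih1 ih2]]; first by rewrite expr0 !divr1.
  have [[_ _ -> _ _] ->] := uq n.
  by rewrite ih1 ih2 exprS invfM; split; ring.
have mono m n : (m <= n)%N -> [/\ (u m).1.1.1 <= (u n).1.1.1,
    (u n).1.1.2 <= (u m).1.1.2, (u m).1.2 <= (u n).1.2 & (u n).2 <= (u m).2].
  elim: n => [|n ih]; first by rewrite leqn0 => /eqP ->.
  rewrite leq_eqVlt => /predU1P[->//|]; rewrite ltnS => /ih[e1 e2 e3 e4].
  have [[h1 h2 _ h3 h4] _] := uq n.
  by split; [exact: le_trans e1 h1|exact: le_trans h2 e2|exact: le_trans e3 h3|
    exact: le_trans h4 e4].
have cross1 m n : (u m).1.1.1 <= (u n).1.1.2.
  have [/mono[h _ _ _]|/ltnW/mono[_ h _ _]] := leqP m n.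
    by have [[_ h' _] _] := uok n; exact: le_trans h h'.
  by have [[_ h' _] _] := uok m; exact: le_trans h' h.
have cross2 m n : (u m).1.2 <= (u n).2.
  have [/mono[_ _ h _]|/ltnW/mono[_ _ _ h]] := leqP m n.
    by have [_ [[_ h' _] _]] := uok n; exact: le_trans h h'.
  by have [_ [[_ h' _] _]] := uok m; exact: le_trans h' h.
pose x := sup (range (fun n => (u n).1.1.1)); pose y := sup (range (fun n => (u n).1.2)).
have xu n : (u n).1.1.1 <= x.
  by apply: ub_le_sup; [exists b => _ [m _ <-]; exact: (cross1 m 0%N)|exists n].
have xl n : x <= (u n).1.1.2.
  by apply: ge_sup; [exists (u 0%N).1.1.1, 0%N|move=> _ [m _ <-]].
have yu n : (u n).1.2 <= y.
  by apply: ub_le_sup; [exists d => _ [m _ <-]; exact: (cross2 m 0%N)|exists n].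
have yl n : y <= (u n).2.
  by apply: ge_sup; [exists (u 0%N).1.2, 0%N|move=> _ [m _ <-]].
have [r r0 Pr] := Ploc x y (introT andP (conj (xu 0%N) (xl 0%N)))
  (introT andP (conj (yu 0%N) (yl 0%N))).
pose s := (b - a) + (d - c).
have s0 : 0 <= s by rewrite /s; lra.
have [n ns] : exists n : nat, s / 2 ^+ n < r.
  exists (Num.bound (s / r)).
  rewrite ltr_pdivrMr ?exprn_gt0// mulrC -ltr_pdivrMr//.
  apply: lt_le_trans (archi_boundP (divr_ge0 s0 (ltW r0))) _.
  by rewrite -natrX ler_nat ltnW// ltn_expl.
have [[? ? ?] [[? ? ?]]] := uok n; apply; apply: Pr => //.
have [-> ->] := size n; apply: le_lt_trans ns.
by rewrite -mulrDl.
Qed.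

End Bisection.

Section BoundedIntegrals.
Context d (T : measurableType d) (R : realType) (mu : {measure set T -> \bar R}).

Lemma integrable_of_bound (A : set T) (f : T -> R) (M : R) : measurable A ->
  (mu A < +oo)%E -> measurable_fun setT f -> (forall x, A x -> `|f x| <= M) ->
  mu.-integrable A (EFin \o f).
Proof.
move=> mA A0 mf fM; apply: measurable_bounded_integrable => //.
  exact: measurable_funTS.
by exists M; split; [exact: num_real|move=> N MN x Ax; exact: le_trans (fM _ Ax) (ltW MN)].
Qed.

Lemma Rintegral_near_cst (A : set T) (f : T -> R) (c e : R) : measurable A ->
  (mu A < +oo)%E -> measurable_fun setT f -> (forall x, A x -> `|f x - c| <= e) ->
  `|\int[mu]_(x in A) f x - c * fine (mu A)| <= e * fine (mu A).
Proof.
move=> mA A0 mf fc.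
have mfc : measurable_fun setT (fun x => f x - c).
  by apply: measurable_funB => //; exact: measurable_cst.
have ic (k : R) : mu.-integrable A (EFin \o (fun=> k)).
  by apply: (@integrable_of_bound _ _ `|k|) => //; exact: measurable_cst.
have i1 : mu.-integrable A (EFin \o (fun x => f x - c)).
  exact: integrable_of_bound fc.
have -> : \int[mu]_(x in A) f x = \int[mu]_(x in A) ((f x - c) + c).
  by apply: eq_Rintegral => x _; rewrite subrK.
rewrite RintegralD//; try exact: ic.
rewrite Rintegral_cst// addrK (le_trans (le_normr_Rintegral _ _))//.
rewrite -Rintegral_cst//; apply: le_Rintegral => //.
exact: integrable_norm.
Qed.

End BoundedIntegrals.

Section PlaneMeasure.
Variable R : realType.

Definition leb : {sigma_finite_measure set (mR R) -> \bar R} := @lebesgue_measure R.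
(** Declared sigma-finite so that it can be a factor of a further product: the symmetry of real
    translations exchanges two integrals over the plane. *)
Definition plane : set (mR R * mR R)%type -> \bar R := (leb \x leb)%E.
HB.instance Definition _ := Measure.on plane.
Let plane_sigma_finite : sigma_finite setT plane.
Proof.
have /sigma_finiteP[F [TF ndF Foo]] := sigma_finiteT leb.
exists (fun n => F n `*` F n).
  rewrite -setXTT TF predeqE => -[x y]; split.
    move=> [/= [n _ Fnx] [k _ Fky]]; exists (maxn n k) => //; split.
    - by move: x Fnx; exact/subsetPset/ndF/leq_maxl.
    - by move: y Fky; exact/subsetPset/ndF/leq_maxr.
  by move=> [n _ []/= ? ?]; split; exists n.
move=> k; have [? ?] := Foo k.
split; first exact: measurableX.
by rewrite /plane product_measure1E// lte_mul_pinfty// ge0_fin_numE.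
Qed.
HB.instance Definition _ := Measure_isSigmaFinite.Build _ _ _ plane plane_sigma_finite.

End PlaneMeasure.

Arguments leb R : clear implicits.
Arguments plane R : clear implicits.

Section Green.
Variable R : realType.
Local Notation leb := (leb R).
Local Notation plane := (plane R).

(* The ordinate comes first, as in the iterated integral
   [weighted_integral], where it is the outer variable. *)
Definition pl (p : mR R * mR R) : R[i] := p.2 +i* p.1.

(** Half-open, so that a rectangle is the disjoint union of its two halves. *)
Definition rect (a b c d : R) : set (mR R * mR R)%type := `]c, d] `*` `]a, b].

Lemma leb_itv (a b : R) : a <= b -> leb `]a, b]%classic = (b - a)%:E.
Proof.
rewrite /leb /= lebesgue_measure_itv /= lte_fin le_eqVlt => /predU1P[->|->//].
by rewrite ltxx subrr.
Qed.

Lemma measurable_rect a b c d : measurable (rect a b c d).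
Proof. by apply: measurableX; exact: measurable_itv. Qed.

Lemma plane_rect (a b c d : R) : a <= b -> c <= d ->
  plane (rect a b c d) = ((b - a) * (d - c))%:E.
Proof.
move=> ab cd; rewrite /plane/= product_measure1E; try exact: measurable_itv.
transitivity (leb `]c, d]%classic * leb `]a, b]%classic)%E; first by [].
by rewrite (leb_itv ab) (leb_itv cd) -EFinM mulrC.
Qed.

Lemma rect_lty (a b c d : R) : a <= b -> c <= d -> (plane (rect a b c d) < +oo)%E.
Proof. by move=> ab cd; rewrite plane_rect// ltry. Qed.

Lemma itv_lty (a b : R) : a <= b -> (leb `]a, b]%classic < +oo)%E.
Proof. by move=> ab; rewrite leb_itv// ltry. Qed.

Lemma rect_splitx (a m b c d : R) : a <= m -> m <= b ->
  rect a b c d = rect a m c d `|` rect m b c d /\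
  [disjoint rect a m c d & rect m b c d].
Proof.
move=> am mb; rewrite /rect; split.
  apply/seteqP; split=> -[y x]; rewrite /= !in_itv /=.
    move=> [-> /andP[-> ->]] /=; rewrite andbT.
    by have [|_] := leP x m; [left|right].
  by move=> [[-> /andP[h1 h2]]|[-> /andP[h1 h2]]]; split=> //; apply/andP; split; lra.
apply/disj_setPS => -[y x] /=; rewrite !in_itv /= => -[[_ /andP[_ h]] [_ /andP[h' _]]].
lra.
Qed.

Lemma rect_splity (a b c n d : R) : c <= n -> n <= d ->
  rect a b c d = rect a b c n `|` rect a b n d /\
  [disjoint rect a b c n & rect a b n d].
Proof.
move=> cn nd; rewrite /rect; split.
  apply/seteqP; split=> -[y x]; rewrite /= !in_itv /=.
    move=> [/andP[-> ->] ->] /=; rewrite andbT.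
    by have [|_] := leP y n; [left|right].
  by move=> [[/andP[h1 h2] ->]|[/andP[h1 h2] ->]]; split=> //; apply/andP; split; lra.
apply/disj_setPS => -[y x] /=; rewrite !in_itv /= => -[[/andP[_ h] _] [/andP[h' _] _]].
lra.
Qed.

Lemma itv_split (a m b : R) : a <= m -> m <= b ->
  `]a, b]%classic = `]a, m] `|` `]m, b] /\ [disjoint `]a, m]%classic & `]m, b]%classic].
Proof.
move=> am mb; split.
  apply/seteqP; split=> x; rewrite /= !in_itv /=.
    by move=> /andP[-> ->] /=; rewrite andbT; have [|_] := leP x m; [left|right].
  by move=> [/andP[h1 h2]|/andP[h1 h2]]; apply/andP; split; lra.
apply/disj_setPS => x /=; rewrite !in_itv /= => -[/andP[_ h] /andP[h' _]]; lra.
Qed.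

Variables (F D : R[i] -> R[i]) (a0 b0 c0 d0 M : R).
Hypothesis mF : cmeas (F \o pl).
Hypothesis mD : cmeas (D \o pl).
Let inQ z := [&& a0 <= Re z, Re z <= b0, c0 <= Im z & Im z <= d0].
Hypothesis FM : forall z, inQ z -> cabs (F z) <= M.
Hypothesis DM : forall z, inQ z -> cabs (D z) <= M.

Let vflux a b y := Re (F (b +i* y)) - Re (F (a +i* y)).
Let hflux c d x := Im (F (x +i* d)) - Im (F (x +i* c)).

(* The integral of [F dz] over the boundary of the rectangle is [i] times that
   of twice the conjugate derivative [D]; this is the real part of that identity. *)
Let defect a b c d : R := \int[plane]_(p in rect a b c d) (2 * Re (D (pl p))) -
  \int[leb]_(y in `]c, d]) vflux a b y + \int[leb]_(x in `]a, b]) hflux c d x.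

Let mvslice b : measurable_fun [set: mR R] (fun y => Re (F (b +i* y))).
Proof. exact: (measurable_fun_pair1 (b : mR R) mF.1). Qed.

Let mhslice c : measurable_fun [set: mR R] (fun x => Im (F (x +i* c))).
Proof. exact: (measurable_fun_pair2 (c : mR R) mF.2). Qed.

Let mvflux a b : measurable_fun [set: mR R] (vflux a b).
Proof. exact: measurable_funB. Qed.

Let mhflux c d : measurable_fun [set: mR R] (hflux c d).
Proof. exact: measurable_funB. Qed.

Let mRD : measurable_fun setT (fun p => 2 * Re (D (pl p))).
Proof. by apply: measurable_funM; [exact: measurable_cst|exact: mD.1]. Qed.

Let iRD a b c d : a0 <= a -> a <= b -> b <= b0 -> c0 <= c -> c <= d -> d <= d0 ->
  plane.-integrable (rect a b c d) (EFin \o (fun p => 2 * Re (D (pl p)))).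
Proof.
move=> *; apply: (@integrable_of_bound _ _ _ _ _ _ (2 * M)) => //.
- exact: measurable_rect.
- exact: rect_lty.
- move=> [y x] [/=]; rewrite !in_itv/= => /andP[? ?] /andP[? ?].
  rewrite normrM ger0_norm// ler_pM2l// (le_trans (absRe_le _))// DM//.
  by apply/and4P; split => /=; lra.
Qed.

Let vflux_bound a b y : a0 <= a -> a <= b -> b <= b0 -> c0 <= y -> y <= d0 ->
  `|vflux a b y| <= M + M.
Proof.
move=> a0a ab bb0 c0y yd0.
have Qa : inQ (a +i* y) by rewrite /inQ /= a0a (le_trans ab bb0) c0y.
have Qb : inQ (b +i* y) by rewrite /inQ /= (le_trans a0a ab) bb0 c0y.
apply: le_trans (ler_normB _ _) (lerD _ _).
  exact: le_trans (absRe_le _) (FM Qb).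
exact: le_trans (absRe_le _) (FM Qa).
Qed.

Let hflux_bound c d x : c0 <= c -> c <= d -> d <= d0 -> a0 <= x -> x <= b0 ->
  `|hflux c d x| <= M + M.
Proof.
move=> c0c cd dd0 a0x xb0.
have Qc : inQ (x +i* c) by rewrite /inQ /= a0x xb0 c0c (le_trans cd dd0).
have Qd : inQ (x +i* d) by rewrite /inQ /= a0x xb0 (le_trans c0c cd).
apply: le_trans (ler_normB _ _) (lerD _ _).
  exact: le_trans (absIm_le _) (FM Qd).
exact: le_trans (absIm_le _) (FM Qc).
Qed.

Let ivflux a b c d : a0 <= a -> a <= b -> b <= b0 -> c0 <= c -> c <= d -> d <= d0 ->
  leb.-integrable `]c, d] (EFin \o vflux a b).
Proof.
move=> a0a ab bb0 c0c cd dd0; apply: (@integrable_of_bound _ _ _ _ _ _ (M + M)) => //.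
- exact: itv_lty.
- move=> y /=; rewrite in_itv/= => /andP[cy yd].
  exact: vflux_bound a0a ab bb0 (le_trans c0c (ltW cy)) (le_trans yd dd0).
Qed.

Let ihflux a b c d : a0 <= a -> a <= b -> b <= b0 -> c0 <= c -> c <= d -> d <= d0 ->
  leb.-integrable `]a, b] (EFin \o hflux c d).
Proof.
move=> a0a ab bb0 c0c cd dd0; apply: (@integrable_of_bound _ _ _ _ _ _ (M + M)) => //.
- exact: itv_lty.
- move=> x /=; rewrite in_itv/= => /andP[ax xb].
  exact: hflux_bound c0c cd dd0 (le_trans a0a (ltW ax)) (le_trans xb bb0).
Qed.

(** The two halves run along their common side in opposite directions, so its contributions
    cancel. *)
Let defect_splitx a m b c d : a0 <= a -> a <= m -> m <= b -> b <= b0 ->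
  c0 <= c -> c <= d -> d <= d0 -> defect a b c d = defect a m c d + defect m b c d.
Proof.
move=> a0a am mb bb0 c0c cd dd0; have ab := le_trans am mb.
have [EQ DJ] := @rect_splitx a m b c d am mb; have [EQ' DJ'] := itv_split am mb.
rewrite /defect [in LHS]EQ Rintegral_setU//; try exact: measurable_rect; last first.
  by rewrite -EQ; exact: iRD.
rewrite [in LHS]EQ' Rintegral_setU//; last by rewrite -EQ'; apply: ihflux.
have -> : \int[leb]_(y in `]c, d]) vflux a b y =
    \int[leb]_(y in `]c, d]) (vflux a m y + vflux m b y).
  by apply: eq_Rintegral => y _; rewrite /vflux; ring.
rewrite RintegralD//; first ring.
- by apply: ivflux => //; lra.
- by apply: ivflux => //; lra.
Qed.

Let defect_splity a b c n d : a0 <= a -> a <= b -> b <= b0 ->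
  c0 <= c -> c <= n -> n <= d -> d <= d0 ->
  defect a b c d = defect a b c n + defect a b n d.
Proof.
move=> a0a ab bb0 c0c cn nd dd0; have cd := le_trans cn nd.
have [EQ DJ] := @rect_splity a b c n d cn nd; have [EQ' DJ'] := itv_split cn nd.
rewrite /defect [in LHS]EQ Rintegral_setU//; try exact: measurable_rect; last first.
  by rewrite -EQ; exact: iRD.
rewrite [in LHS]EQ' Rintegral_setU//; last by rewrite -EQ'; apply: ivflux.
have -> : \int[leb]_(x in `]a, b]) hflux c d x =
    \int[leb]_(x in `]a, b]) (hflux c n x + hflux n d x).
  by apply: eq_Rintegral => y _; rewrite /hflux; ring.
rewrite RintegralD//; first ring.
- by apply: ihflux => //; lra.
- by apply: ihflux => //; lra.
Qed.

(** Goursat's estimate: for the affine part [F z + A * (w - z) + D z * cj (w - z)] the three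
    integrals cancel exactly, and each remainder is at most [e / 2] times a product of two
    lengths. *)
Let defect_local z A (e : R) : 0 < e -> wirtinger F z A (D z) -> ccont D z ->
  exists2 r : R, 0 < r & forall a b c d, a0 <= a -> a <= Re z -> Re z <= b -> b <= b0 ->
    c0 <= c -> c <= Im z -> Im z <= d -> d <= d0 -> (b - a) + (d - c) < r ->
    `|defect a b c d| <= e * ((b - a) + (d - c)) ^+ 2.
Proof.
move=> e0 /wirtinger_littleo dF cD; have e4 : 0 < e / 4 by apply: divr_gt0.
have [r1 r10 H1] := dF _ e4; have [r2 r20 H2] := cD _ e4.
exists (Num.min r1 r2); first by rewrite lt_min r10.
move=> a b c d a0a az zb bb0 c0c cz zd dd0; rewrite lt_min => /andP[s1 s2].
have ab := le_trans az zb; have cd := le_trans cz zd.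
set s := b - a + (d - c) in s1 s2 *.
have dist w : a <= Re w -> Re w <= b -> c <= Im w -> Im w <= d -> cabs (w - z) <= s.
  move=> *; rewrite (le_trans (cabs_le _))// ReB ImB /s lerD//.
  - by rewrite ler_norml; apply/andP; split; lra.
  - by rewrite ler_norml; apply/andP; split; lra.
have lin w : a <= Re w -> Re w <= b -> c <= Im w -> Im w <= d ->
    cabs (F w - F z - A * (w - z) - D z * cj (w - z)) <= e / 4 * s.
  move=> h1 h2 h3 h4; have := dist w h1 h2 h3 h4 => ws.
  by rewrite (le_trans (H1 w _)) ?(le_lt_trans ws)// ler_wpM2l// ltW.
have s0 : 0 <= s by rewrite /s; lra.
have K1 : `|\int[plane]_(p in rect a b c d) (2 * Re (D (pl p))) -
    (2 * Re (D z)) * ((b - a) * (d - c))| <= (e / 2) * ((b - a) * (d - c)).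
  have -> : (b - a) * (d - c) = fine (plane (rect a b c d)) by rewrite plane_rect.
  apply: Rintegral_near_cst => //; first exact: measurable_rect.
    exact: rect_lty.
  move=> [y x] [/=]; rewrite !in_itv/= => /andP[? ?] /andP[? ?].
  rewrite -mulrBr normrM ger0_norm// -ReB.
  have := absRe_le (D (pl (y, x)) - D z).
  have /ltW : cabs (D (pl (y, x)) - D z) < e / 4.
    by apply: H2; apply: le_lt_trans s2; apply: dist => /=; lra.
  by move=> h1 h2; have := le_trans h2 h1; lra.
have K2 : `|\int[leb]_(y in `]c, d]) vflux a b y -
    ((Re A + Re (D z)) * (b - a)) * (d - c)| <= (e / 2 * s) * (d - c).
  have -> : d - c = fine (leb `]c, d]%classic) by rewrite leb_itv.
  apply: Rintegral_near_cst => //; first exact: itv_lty.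
  move=> y /=; rewrite in_itv/= => /andP[? ?].
  have l1 := le_trans (absRe_le _) (lin (b +i* y) ab (lexx _) (ltW _) _).
  have l2 := le_trans (absRe_le _) (lin (a +i* y) (lexx _) ab (ltW _) _).
  rewrite /vflux [X in `|X|](_ : _ =
    Re (F (b +i* y) - F z - A * (b +i* y - z) - D z * cj (b +i* y - z)) -
    Re (F (a +i* y) - F z - A * (a +i* y - z) - D z * cj (a +i* y - z))).
    rewrite (le_trans (ler_normB _ _))// (_ : e / 2 * s = e / 4 * s + e / 4 * s); last by field.
    by rewrite lerD// ?l1 ?l2.
  by rewrite !(ReB, ReM, ReJ, ImB, ImJ)/=; ring.
have K3 : `|\int[leb]_(x in `]a, b]) hflux c d x -
    ((Re A - Re (D z)) * (d - c)) * (b - a)| <= (e / 2 * s) * (b - a).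
  have -> : b - a = fine (leb `]a, b]%classic) by rewrite leb_itv.
  apply: Rintegral_near_cst => //; first exact: itv_lty.
  move=> x /=; rewrite in_itv/= => /andP[? ?].
  have l1 := le_trans (absIm_le _) (lin (x +i* d) (ltW _) _ cd (lexx _)).
  have l2 := le_trans (absIm_le _) (lin (x +i* c) (ltW _) _ (lexx _) cd).
  rewrite /hflux [X in `|X|](_ : _ =
    Im (F (x +i* d) - F z - A * (x +i* d - z) - D z * cj (x +i* d - z)) -
    Im (F (x +i* c) - F z - A * (x +i* c - z) - D z * cj (x +i* c - z))).
    rewrite (le_trans (ler_normB _ _))// (_ : e / 2 * s = e / 4 * s + e / 4 * s); last by field.
    by rewrite lerD// ?l1 ?l2.
  by rewrite !(ImB, ImM, ReJ, ReB, ImJ)/=; ring.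
rewrite /defect; set X := \int[plane]_(p in _) _ in K1 *.
set Y := \int[leb]_(y in `]c, d]) _ in K2 *; set Z := \int[leb]_(x in `]a, b]) _ in K3 *.
have -> : X - Y + Z = (X - (2 * Re (D z)) * ((b - a) * (d - c))) -
  (Y - ((Re A + Re (D z)) * (b - a)) * (d - c)) +
  (Z - ((Re A - Re (D z)) * (d - c)) * (b - a)) by ring.
rewrite (le_trans (ler_normD _ _))// (le_trans (lerD (ler_normB _ _) (lexx _)))//.
rewrite (le_trans (lerD (lerD K1 K2) K3))//.
have p0 : 0 <= b - a by lra.
have q0 : 0 <= d - c by lra.
rewrite -subr_ge0 (_ : _ - _ =
  e / 2 * ((b - a) ^+ 2 + (b - a) * (d - c) + (d - c) ^+ 2)); last by rewrite /s; field.
apply: mulr_ge0; first lra.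
by rewrite !addr_ge0 ?sqr_ge0// mulr_ge0.
Qed.

Let defect0 a b c d : a0 <= a -> a <= b -> b <= b0 -> c0 <= c -> c <= d -> d <= d0 ->
  (forall z, a <= Re z <= b -> c <= Im z <= d ->
    ccont D z /\ exists A, wirtinger F z A (D z)) ->
  defect a b c d = 0.
Proof.
move=> a0a ab bb0 c0c cd dd0 H; apply/eqP; rewrite -normr_le0.
pose s0 := b - a + (d - c).
have s0_ge0 : 0 <= s0 by rewrite /s0; lra.
suff K e : 0 < e -> `|defect a b c d| <= e * s0 ^+ 2.
  apply/ler_addgt0Pr => e e0; rewrite add0r.
  have q0 : 0 < s0 ^+ 2 + 1 by rewrite ltr_wpDl// sqr_ge0.
  apply: le_trans (K (e / (s0 ^+ 2 + 1)) (divr_gt0 e0 q0)) _.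
  rewrite mulrAC ler_pdivrMr// ler_pM2l//; lra.
(* Quartering halves the half-perimeter, so four bounds of this shape add up to the bound for the
   whole rectangle. *)
move=> e0; apply: (@rectangle_bisection _ (fun a b c d =>
    `|defect a b c d| <= e * ((b - a) + (d - c)) ^+ 2) a b c d ab cd).
- move=> a' b' c' d' ab' cd' h1 h2 h3 h4 aa bb cc dd.
  have [/(le_trans a0a){}aa /le_trans/(_ bb0){}bb] := (aa, bb).
  have [/(le_trans c0c){}cc /le_trans/(_ dd0){}dd] := (cc, dd).
  have [x1 x2] := midf_le ab'; have [y1 y2] := midf_le cd'.
  rewrite (defect_splity aa ab' bb cc y1 y2 dd).
  rewrite (defect_splitx aa x1 x2 bb cc y1 (le_trans y2 dd)).
  rewrite (defect_splitx aa x1 x2 bb (le_trans cc y1) y2 dd).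
  rewrite (le_trans (ler_normD _ _))//.
  rewrite (le_trans (lerD (ler_normD _ _) (ler_normD _ _)))//.
  rewrite (le_trans (lerD (lerD h1 h2) (lerD h3 h4)))// le_eqVlt.
  by apply/orP; left; apply/eqP; field.
- move=> x y /andP[? ?] /andP[? ?].
  have [||cD [A dF]] := H (x +i* y); try by apply/andP; split.
  have [r r0 Hr] := @defect_local (x +i* y) A e e0 dF cD.
  by exists r => // a' b' c' d' *; apply: Hr => //=; lra.
Qed.

(** The exceptional point is enclosed in a square of half-side [r]. On the four rectangles around
    the square the defect is zero, and on the square it is [O(M r)] because [F] and [D] are
    bounded. *)
Lemma green_defect (u v : R) : a0 < u -> u < b0 -> c0 < v -> v < d0 ->
  (forall z, inQ z -> z <> u +i* v -> ccont D z /\ exists A, wirtinger F z A (D z)) ->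
  defect a0 b0 c0 d0 = 0.
Proof.
move=> au ub cv vd H; apply/eqP; rewrite -normr_le0.
have M0 : 0 <= M.
  apply: le_trans (cabs_ge0 _) (FM (z := u +i* v) _).
  by apply/and4P; split=> /=; lra.
pose m := Num.min (Num.min (u - a0) (b0 - u)) (Num.min (v - c0) (d0 - v)).
(* On the square the planar integral is at most [8 * M * r ^+ 2] and each of the two fluxes at most
   [4 * M * r]; [r < 1] brings the sum below [16 * M * r]. *)
suff K r : 0 < r -> r < 1 -> r < m -> `|defect a0 b0 c0 d0| <= 16 * M * r.
  apply/ler_addgt0Pr => e e0; rewrite add0r.
  have m0 : 0 < m by rewrite !lt_min !subr_gt0 au ub cv vd.
  clearbody m; have q0 : 0 < 16 * M + 1 by rewrite ltr_wpDl// mulr_ge0.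
  pose r := Num.min (Num.min 1 m) (e / (16 * M + 1)) / 2.
  have h : 0 < Num.min (Num.min 1 m) (e / (16 * M + 1)).
    by rewrite !lt_min ltr01 m0 divr_gt0.
  have r0 : 0 < r by rewrite divr_gt0.
  have : r < Num.min (Num.min 1 m) (e / (16 * M + 1)) by rewrite /r; lra.
  rewrite !lt_min => /andP[/andP[r1 rm] re].
  apply: le_trans (K r r0 r1 rm) _.
  move: re; rewrite ltr_pdivlMr// => re; nra.
move=> r0 r1; rewrite !lt_min => /andP[/andP[h1 h2] /andP[h3 h4]].
have reg a b c d : a0 <= a -> a <= b -> b <= b0 -> c0 <= c -> c <= d -> d <= d0 ->
    [|| b < u, u < a, d < v | v < c] -> defect a b c d = 0.
  move=> ? ? ? ? ? ? out; apply: defect0 => // z /andP[? ?] /andP[? ?].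
  apply: H; first by apply/and4P; split; lra.
  by move=> zE; move: out; rewrite -[u]/(Re (u +i* v)) -[v]/(Im (u +i* v)) -zE;
    case/or4P; lra.
have cd0 : c0 <= d0 by exact/ltW/(lt_trans cv).
have [lu gu] : u - r < u /\ u < u + r by rewrite gtrBl ltrDl.
have [lv gv] : v - r < v /\ v < v + r by rewrite gtrBl ltrDl.
have ur := ltW (lt_trans lu gu); have vr := ltW (lt_trans lv gv).
have [x1 x3] : a0 <= u - r /\ u + r <= b0 by split; lra.
have [y1 y3] : c0 <= v - r /\ v + r <= d0 by split; lra.
have x2 := le_trans ur x3; have y2 := le_trans vr y3.
have x4 := le_trans x1 ur; have y4 := le_trans y1 vr.
rewrite (defect_splitx (lexx a0) x1 x2 (lexx b0) (lexx c0) cd0 (lexx d0)).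
rewrite (defect_splitx x1 ur x3 (lexx b0) (lexx c0) cd0 (lexx d0)).
rewrite (defect_splity x1 ur x3 (lexx c0) y1 y2 (lexx d0)).
rewrite (defect_splity x1 ur x3 y1 vr y3 (lexx d0)).
rewrite (reg a0 (u - r) c0 d0 (lexx a0) x1 x2 (lexx c0) cd0 (lexx d0)) ?lu//.
rewrite (reg (u + r) b0 c0 d0 x4 x3 (lexx b0) (lexx c0) cd0 (lexx d0)) ?gu ?orbT//.
rewrite (reg (u - r) (u + r) c0 (v - r) x1 ur x3 (lexx c0) y1 y2) ?lv ?orbT//.
rewrite (reg (u - r) (u + r) (v + r) d0 x1 ur x3 y4 y3 (lexx d0)) ?gv ?orbT//.
rewrite !addr0 !add0r.
have K1 : `|\int[plane]_(p in rect (u - r) (u + r) (v - r) (v + r))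
    (2 * Re (D (pl p)))| <= 2 * M * (2 * r * (2 * r)).
  have -> : 2 * r * (2 * r) = fine (plane (rect (u - r) (u + r) (v - r) (v + r))).
    by rewrite plane_rect//=; ring.
  rewrite -[X in `|X|]subr0 -[X in _ - X](mul0r
    (fine (plane (rect (u - r) (u + r) (v - r) (v + r))))).
  apply: Rintegral_near_cst => //; [exact: measurable_rect|exact: rect_lty|].
  move=> [y x] [/=]; rewrite !in_itv/= => /andP[? ?] /andP[? ?].
  rewrite subr0 normrM ger0_norm// ler_pM2l// (le_trans (absRe_le _))// DM//.
  by apply/and4P; split => /=; lra.
have K2 : `|\int[leb]_(y in `](v - r), (v + r)]) vflux (u - r) (u + r) y| <=
    2 * M * (2 * r).
  have -> : 2 * r = fine (leb `](v - r), (v + r)]%classic).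
    by rewrite leb_itv//=; ring.
  rewrite -[X in `|X|]subr0 -[X in _ - X](mul0r (fine (leb `](v - r), (v + r)]%classic))).
  apply: Rintegral_near_cst => //; first exact: itv_lty.
  move=> y /=; rewrite in_itv/= => /andP[vy yv]; rewrite subr0 mulr_natl mulr2n.
  exact: vflux_bound x1 ur x3 (le_trans y1 (ltW vy)) (le_trans yv y3).
have K3 : `|\int[leb]_(x in `](u - r), (u + r)]) hflux (v - r) (v + r) x| <=
    2 * M * (2 * r).
  have -> : 2 * r = fine (leb `](u - r), (u + r)]%classic).
    by rewrite leb_itv//=; ring.
  rewrite -[X in `|X|]subr0 -[X in _ - X](mul0r (fine (leb `](u - r), (u + r)]%classic))).
  apply: Rintegral_near_cst => //; first exact: itv_lty.
  move=> x /=; rewrite in_itv/= => /andP[ux xu]; rewrite subr0 mulr_natl mulr2n.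
  exact: hflux_bound y1 vr y3 (le_trans x1 (ltW ux)) (le_trans xu x3).
rewrite /defect (le_trans (ler_normD _ _))// (le_trans (lerD (ler_normB _ _) (lexx _)))//.
rewrite (le_trans (lerD (lerD K1 K2) K3))//.
have := mulr_ge0 M0 (ltW r0); have : r * r <= r by rewrite ger_pMl// ltW.
by move=> rr; have := ler_wpM2l M0 rr; lra.
Qed.

Let inO z := [&& a0 < Re z, Re z < b0, c0 < Im z & Im z < d0].

(** Both fluxes vanish since [F] is zero on the boundary, and [D] is zero off the rectangle, so its
    integral there is the one over the plane. *)
Lemma green_Re (u v : R) : a0 < u -> u < b0 -> c0 < v -> v < d0 ->
  (forall z, inQ z -> z <> u +i* v -> ccont D z /\ exists A, wirtinger F z A (D z)) ->
  (forall z, ~~ inO z -> F z = 0) -> (forall z, ~~ inO z -> D z = 0) ->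
  \int[plane]_p Re (D (pl p)) = 0.
Proof.
move=> au ub cv vd H F0 D0.
have a0b0 : a0 <= b0 by lra.
have c0d0 : c0 <= d0 by lra.
have := @green_defect u v au ub cv vd H; rewrite /defect.
have -> : \int[leb]_(y in `]c0, d0]) vflux a0 b0 y = 0.
  rewrite -[RHS](mul0r (fine (leb `]c0, d0]%classic))) -Rintegral_cst//.
  apply: eq_Rintegral => y _; rewrite /vflux !F0 ?subrr// /inO /= ltxx ?andbF//.
have -> : \int[leb]_(x in `]a0, b0]) hflux c0 d0 x = 0.
  rewrite -[RHS](mul0r (fine (leb `]a0, b0]%classic))) -Rintegral_cst//.
  by apply: eq_Rintegral => y _; rewrite /hflux !F0 ?subrr// /inO /= ltxx ?andbF.
have supp : (fun p => 2 * Re (D (pl p))) \_ (rect a0 b0 c0 d0) =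
    (fun p => 2 * Re (D (pl p))).
  apply/funext => -[y x]; rewrite patchE; case: ifPn => //.
  rewrite notin_setE /rect /= !in_itv/= => nQ.
  rewrite D0 ?mulr0//; apply/and4P => /= -[/= ? ? ? ?]; apply: nQ.
  by split; apply/andP; split=> //; exact: ltW.
rewrite subr0 addr0 Rintegral_mkcond supp => I0.
have i2 : rintegrable plane (fun p => 2 * Re (D (pl p))).
  have := iRD (lexx a0) a0b0 (lexx b0) (lexx c0) c0d0 (lexx d0).
  rewrite integrable_mkcond; last exact: measurable_rect.
  by rewrite restrict_EFin supp.
rewrite -[RHS](mulr0 2^-1) -I0 -rintZ//.
by apply: eq_Rintegral => p _; rewrite mulrA mulVf// mul1r.
Qed.

End Green.

Section GreenComplex.
Variables (R : realType) (F D : R[i] -> R[i]) (a b c d M u v : R).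

(* The rectangle may contain one exceptional point [u + i v], at which [F] and
   [D] are only bounded. *)
Lemma green : cmeas (F \o @pl R) -> cmeas (D \o @pl R) ->
  (forall z, [&& a <= Re z, Re z <= b, c <= Im z & Im z <= d] -> cabs (F z) <= M) ->
  (forall z, [&& a <= Re z, Re z <= b, c <= Im z & Im z <= d] -> cabs (D z) <= M) ->
  a < u -> u < b -> c < v -> v < d ->
  (forall z, [&& a <= Re z, Re z <= b, c <= Im z & Im z <= d] -> z <> u +i* v ->
    ccont D z /\ exists A, wirtinger F z A (D z)) ->
  (forall z, ~~ [&& a < Re z, Re z < b, c < Im z & Im z < d] -> F z = 0) ->
  (forall z, ~~ [&& a < Re z, Re z < b, c < Im z & Im z < d] -> D z = 0) ->
  cint (plane R) (D \o @pl R) = 0.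
Proof.
(* Multiplication by [k = -i] turns imaginary parts into real parts, so [green_Re] applies twice. *)
move=> mF mD FM DM au ub cv vd H F0 D0; pose k : R[i] := 0 +i* (-1).
have k1 : cabs k = 1 by rewrite /cabs/= expr0n/= add0r sqrrN expr1n sqrtr1.
apply: complexP => /=; first exact: (green_Re mF mD FM DM au ub cv vd).
rewrite -[RHS](_ : \int[plane R]_p Re (k * D (pl p)) = 0).
  by apply: eq_Rintegral => p _; rewrite ReM /= mul0r mulN1r opprK add0r.
apply: (@green_Re R (fun z => k * F z) (fun z => k * D z) a b c d M _ _ _ _ u v) => //.
- by apply: cmeasM => //; exact: cmeas_cst.
- by apply: cmeasM => //; exact: cmeas_cst.
- by move=> z /FM; rewrite cabsM k1 mul1r.
- by move=> z /DM; rewrite cabsM k1 mul1r.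
- move=> z zQ zw; have [cD [A dF]] := H z zQ zw; split.
    by apply: ccontM => //; exact: ccont_cst.
  by exists (k * A); exact: wirtingerZ.
- by move=> z /F0 ->; rewrite mulr0.
- by move=> z /D0 ->; rewrite mulr0.
Qed.

End GreenComplex.

(** * Integration on the half-plane *)

Section AffineSubstitution.
Variable R : realType.
Local Notation leb := (leb R).
Local Open Scope ereal_scope.

(** The rescaled image measure gives half-open intervals their length, and Lebesgue measure is
    determined by these values. *)
Lemma leb_affine (c d : R) (f : R -> \bar R) : (c != 0)%R ->
  measurable_fun [set: mR R] f -> (forall x, 0 <= f x) ->
  \int[leb]_x f x = `|c|%:E * \int[leb]_x f (c * x + d)%R.
Proof.
move=> c0 mf f0; pose phi : mR R -> mR R := fun x => (c * x + d)%R.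
have c0' : (0 < `|c|)%R by rewrite normr_gt0.
have mphi : measurable_fun setT phi.
  by apply: measurable_realfun.measurable_funD => //; exact: measurable_cst.
pose k : {nonneg R} := NngNum (ltW c0').
have H (A : set (mR R)) : measurable A -> leb A = mscale k (pushforward leb phi) A.
  apply: lebesgue_measure_unique => _ [[a b] _ <-] /=.
  have [ba|ab] := leP b a.
    rewrite set_itv_ge ?measure0// bnd_simp -leNgt//.
  rewrite /mscale /= /pushforward.
  (* A negative slope reverses the interval, so the closed end point changes side. *)
  have -> : phi @^-1` `]a, b] = if (0 < c)%R then `]((a - d) / c)%R, ((b - d) / c)%R]%classic
      else `[((b - d) / c)%R, ((a - d) / c)%R[%classic.
    apply/seteqP; split => x; rewrite /phi /=; case: ifPn => cp; rewrite /= ?in_itv/=.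
    - by rewrite ltr_pdivrMr// ler_pdivlMr// mulrC ltrBlDr lerBrDr.
    - have cn : (c < 0)%R by rewrite lt_neqAle c0 leNgt.
      by rewrite ltr_ndivlMr// ler_ndivrMr// mulrC ltrBlDr lerBrDr andbC.
    - by rewrite ltr_pdivrMr// ler_pdivlMr// mulrC ltrBlDr lerBrDr.
    - have cn : (c < 0)%R by rewrite lt_neqAle c0 leNgt.
      by rewrite ltr_ndivlMr// ler_ndivrMr// mulrC ltrBlDr lerBrDr andbC.
  case: ifPn => cp.
    rewrite !lebesgue_measure_itv/= !lte_fin ab ltr_pM2r ?invr_gt0// ltrD2r ab.
    rewrite -!EFinB -EFinM gtr0_norm//; congr EFin; field; exact: c0.
  have cn : (c < 0)%R by rewrite lt_neqAle c0 leNgt.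
  rewrite !lebesgue_measure_itv/= !lte_fin ab ltr_nM2r ?invr_lt0// ltrD2r ab.
  by rewrite -!EFinB -EFinM ltr0_norm//; congr EFin; field; exact: c0.
rewrite (eq_measure_integral (mscale k (pushforward leb phi))); last first.
  by move=> A mA _; exact: H.
rewrite ge0_integral_mscale//=; congr (_ * _).
by rewrite ge0_integral_pushforward// => y _; exact: f0.
Qed.

End AffineSubstitution.

Section Inversion.
Variable R : realType.
Local Notation leb := (leb R).

Let div_derive (A x : R) : x != 0 -> is_derive x 1 (fun x : R => A / x) (- (A / x ^+ 2)).
Proof.
move=> x0; apply: is_derive_eq.
  by apply: is_deriveM; apply: is_deriveV => //; exact: is_derive_id.
by rewrite /GRing.scale /= mulr0 addr0 mulr1 mulrN -exprVn.
Qed.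

Let div_derive1 (A x : R) : x != 0 -> derive1 (fun x : R => A / x) x = - (A / x ^+ 2).
Proof. by move=> x0; rewrite derive1E; have /@derive_val -> := div_derive A x0. Qed.

Let div_derive1_cont (A x : R) : 0 < x ->
  derive1 (fun x : R => A / x) y @[y --> x] --> derive1 (fun x : R => A / x) x.
Proof.
move=> x0; rewrite div_derive1 ?gt_eqF//.
have nz : {near x, (fun y => - (A / y ^+ 2)) =1 derive1 (fun x : R => A / x)}.
  have : \forall y \near x, 0 < y by exact: lt_nbhsr.
  by apply: filterS => y y0; rewrite div_derive1// gt_eqF.
apply: cvg_trans (near_eq_cvg nz) _.
apply: cvgN; apply: cvgM; first exact: cvg_cst.
by apply: cvgV; [rewrite expf_neq0// gt_eqF|exact: exprn_continuous].
Qed.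

(** The map [x |-> A / x] carries the interval for [c = A] onto the one for [c = 1] with the same
    [n]; substitution is done on these compact intervals before passing to the limit. *)
Let itv_exhaust (c : R) : 0 < c ->
  \bigcup_n `[c / n.+1%:R, c * n.+1%:R]%classic = `]0, +oo[%classic :> set R.
Proof.
move=> c0; apply/seteqP; split=> x /=; rewrite in_itv/= ?andbT.
  move=> [n _]; rewrite /= in_itv/= => /andP[h _].
  by apply: lt_le_trans h; rewrite divr_gt0.
move=> x0; pose n := Num.bound (Num.max (x / c) (c / x)).
have : Num.max (x / c) (c / x) < n%:R.
  by apply: archi_boundP; rewrite le_max (divr_ge0 (ltW x0) (ltW c0)).
rewrite gt_max => /andP[h1 h2]; exists n => //=; rewrite in_itv/=.
have nn : n%:R <= n.+1%:R :> R by rewrite ler_nat.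
apply/andP; split.
  by rewrite ler_pdivrMr// mulrC -ler_pdivrMr// (le_trans (ltW h2)).
by rewrite mulrC -ler_pdivrMr// (le_trans (ltW h1)).
Qed.

Let integral_itv_exhaust (c : R) (f : R -> R) : 0 < c ->
  {in `]0, +oo[, continuous f} -> (forall x, 0 < x -> 0 <= f x) ->
  (\int[leb]_(x in `[(c / n.+1%:R)%R, (c * n.+1%:R)%R]) (f x)%:E @[n --> \oo] -->
   \int[leb]_(x in `]0%R, +oo[) (f x)%:E)%E.
Proof.
move=> c0 cf f0; rewrite -(itv_exhaust c0).
have sub n : `[c / n.+1%:R, c * n.+1%:R] `<=` [set x | 0 < x].
  move=> x /=; rewrite in_itv/= => /andP[h _].
  by apply: lt_le_trans h; rewrite divr_gt0.
have H := @ge0_nondecreasing_set_cvg_integral _ (mR R) R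
  (fun n => `[(c / n.+1%:R)%R, (c * n.+1%:R)%R]%classic) (fun x => (f x)%:E) leb.
apply: H.
- move=> m n mn; rewrite subsetEset => x /=; rewrite !in_itv/= => /andP[h1 h2].
  have mn' : m.+1%:R <= n.+1%:R :> R by rewrite ler_nat.
  apply/andP; split.
    by apply: le_trans h1; rewrite ler_pM2l// lef_pV2// posrE.
  by apply: le_trans h2 _; rewrite ler_pM2l.
- by move=> n; exact: measurable_itv.
- have mf : measurable_fun (`]0%R, +oo[%classic : set (mR R)) f.
    apply: open_continuous_measurable_fun; first exact: interval_open.
    by move=> x; rewrite inE => /cf.
  move=> n; apply/measurable_EFinP; apply: measurable_funS mf.
    exact: measurable_itv.
  by move=> x /sub; rewrite /= in_itv/= andbT.
- by move=> n x /sub /f0; rewrite lee_fin.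
Qed.

Lemma leb_inversion (A : R) (f : R -> R) : 0 < A ->
  {in `]0, +oo[, continuous f} -> (forall x, 0 < x -> 0 <= f x) ->
  (\int[leb]_(x in `]0%R, +oo[) (f x)%:E =
   \int[leb]_(x in `]0%R, +oo[) (f (A / x) * (A / x ^+ 2))%:E)%E.
Proof.
move=> A0 cf f0; pose F x := A / x.
have cF x : 0 < x -> {for x, continuous F}.
  move=> x0; apply: cvgM; first exact: cvg_cst.
  by apply: cvgV; [rewrite gt_eqF|exact: cvg_id].
pose G x := f (A / x) * (A / x ^+ 2).
have cG : {in `]0, +oo[, continuous G}.
  move=> x; rewrite in_itv/= andbT => x0; apply: cvgM.
    apply: (@continuous_comp _ _ _ F f); first exact: cF.
    by apply: cf; rewrite in_itv/= andbT divr_gt0.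
  apply: cvgM; first exact: cvg_cst.
  by apply: cvgV; [rewrite expf_neq0// gt_eqF|exact: exprn_continuous].
have G0 x : 0 < x -> 0 <= G x.
  by move=> x0; apply: mulr_ge0; [exact/f0/divr_gt0|apply: divr_ge0; [exact: ltW|exact: sqr_ge0]].
have L := integral_itv_exhaust ltr01 cf f0.
have L' := integral_itv_exhaust A0 cG G0.
suff E n : (\int[leb]_(x in `[(1 / n.+1%:R)%R, (1 * n.+1%:R)%R]) (f x)%:E =
    \int[leb]_(x in `[(A / n.+1%:R)%R, (A * n.+1%:R)%R]) (G x)%:E)%E.
  have /funext E' := E; rewrite E' in L.
  by apply: (cvg_unique _ L L'); exact: ereal_hausdorff.
set N : R := n.+1%:R.
have N0 : 0 < N by rewrite /N.
have N1 : 1 <= N by rewrite /N ler1n.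
have E1 : 1 / N = F (A * N) by rewrite /F; field; rewrite !gt_eqF.
have E2 : 1 * N = F (A / N) by rewrite /F; field; rewrite !gt_eqF.
have AN0 : 0 < A / N by rewrite divr_gt0.
have ANN0 : 0 < A * N by rewrite mulr_gt0.
have AN : A / N <= A * N.
  by rewrite ler_pM2l// (le_trans _ N1)// invf_le1.
rewrite E1 E2 integration_by_substitution_decreasing//.
- apply: eq_integral => x; rewrite inE/= in_itv/= => /andP[h _].
  have x0 : x != 0 by rewrite gt_eqF// (lt_le_trans AN0).
  by rewrite !fctE /F div_derive1// opprK.
- move=> x y; rewrite !in_itv/= => /andP[hx _] /andP[hy _] xy; rewrite /F.
  have x0 := lt_le_trans AN0 hx; have y0 := lt_le_trans AN0 hy.
  by rewrite ltr_pM2l// ltf_pV2.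
- move=> x; rewrite in_itv/= => /andP[hx _].
  by apply: div_derive1_cont; exact: lt_trans hx.
- by apply: cvgP; apply: cvg_at_right_filter; exact: div_derive1_cont.
- by apply: cvgP; apply: cvg_at_left_filter; exact: div_derive1_cont.
- split.
  + move=> x; rewrite in_itv/= => /andP[hx _].
    have x0 : x != 0 by rewrite gt_eqF// (lt_trans AN0).
    exact: (@ex_derive _ _ _ _ _ _ _ (div_derive A x0)).
  + by apply: cvg_at_right_filter; exact: cF.
  + by apply: cvg_at_left_filter; exact: cF.
- rewrite -E1 -E2; apply: continuous_in_subspaceT => x; rewrite inE/= in_itv/= => /andP[h _].
  by apply: cf; rewrite in_itv/= andbT; apply: lt_le_trans h; rewrite divr_gt0.
Qed.
End Inversion.

Section Decay.
Variable R : realType.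
Local Notation leb := (leb R).
Local Notation plane := (plane R).

(** An explicit integrable majorant; products of two values, one per coordinate, dominate the
    squared kernels and the damped double integral. *)
Definition decay (x : R) : R := ((1 + `|x|) * (1 + `|x|))^-1.

Lemma decay_gt0 x : 0 < decay x.
Proof. by rewrite invr_gt0 mulr_gt0// ltr_pwDl. Qed.

Lemma measurable_decay : measurable_fun [set: mR R] decay.
Proof.
have m1 : measurable_fun [set: mR R] (fun x : R => 1 + `|x|).
  apply: measurable_realfun.measurable_funD; first exact: measurable_cst.
  exact: (@normr_measurable R setT).
by apply: measurable_funV; exact: measurable_realfun.measurable_funM.
Qed.

Let decay_cont : continuous decay.
Proof.
move=> x; have cx : 1 + `|y| @[y --> x] --> 1 + `|x|.
  by apply: cvgD; [exact: cvg_cst|exact: norm_continuous].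
apply: cvgV; last exact: cvgM.
by rewrite gt_eqF// mulr_gt0// ltr_pwDl.
Qed.

Lemma decay_integrable : rintegrable leb decay.
Proof.
apply/integrableP; split.
  by apply/measurable_EFinP; exact: measurable_decay.
under eq_integral do rewrite /= ger0_norm ?(ltW (decay_gt0 _))//.
rewrite ge0_symfun_integralT//; [|by move=> x; exact/ltW/decay_gt0|].
  rewrite -set_itvcy.
  have -> : (\int[leb]_(x in `[0%R, +oo[) (decay x)%:E =
      \int[leb]_(x in `[0%R, +oo[) (((1 + x) * (1 + x))^-1)%:E)%E.
    apply: eq_integral => x; rewrite inE/= in_itv/= andbT => x0.
    by rewrite /decay ger0_norm.
  rewrite (@ge0_continuous_FTC2y _ _ (fun x => - (1 + x)^-1) 0 0).
  - by rewrite -EFinB -EFinM ltry.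
  - by move=> x _; rewrite invr_ge0 -expr2 sqr_ge0.
  - apply: continuous_in_subspaceT => x; rewrite inE/= in_itv/= andbT => x0.
    have x1 : 1 + x != 0 by rewrite gt_eqF// ltr_pwDl.
    have cx : 1 + y @[y --> x] --> 1 + x.
      by apply: cvgD; [exact: cvg_cst|exact: cvg_id].
    by apply: cvgV; [rewrite mulf_neq0|exact: cvgM].
  - rewrite -[X in _ --> X]oppr0; apply: cvgN.
    apply: (@gtr0_cvgV0 R R (pinfty_nbhs R) _ (fun x => 1 + x) _).2.
      by near=> x; rewrite ltr_pwDl//; near: x; exact: nbhs_pinfty_ge.
    apply/cvgryPge => A; near=> x.
    apply: (@le_trans _ _ x); last by rewrite lerDr.
    by near: x; apply: nbhs_pinfty_ge; exact: num_real.
  - move=> x x0; have x1 : 1 + x != 0 by rewrite gt_eqF// ltr_pwDl// ltW.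
    by apply: derivableN; apply: derivableV => //; apply: derivableD.
  - apply: cvg_at_right_filter; apply: cvgN; apply: cvgV; first by rewrite addr0 oner_neq0.
    by apply: cvgD; [exact: cvg_cst|exact: cvg_id].
  - move=> x; rewrite in_itv/= andbT => x0.
    have x1 : 1 + x != 0 by rewrite gt_eqF// ltr_pwDl// ltW.
    rewrite derive1E.
    have : is_derive x 1 (fun x : R => - (1 + x)^-1) ((1 + x) * (1 + x))^-1.
      apply: is_derive_eq.
      by rewrite /GRing.scale /= add0r mulr1 opprK expr2.
    by move=> /@derive_val ->.
by move=> x /=; rewrite /decay normrN.
Unshelve. all: by end_near. Qed.

Lemma decay2_integrable : rintegrable plane (fun p => decay p.1 * decay p.2).
Proof.
have m1 : measurable_fun [set: (mR R * mR R)%type] (fun p => decay p.1).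
  by apply: (measurableT_comp measurable_decay); exact: measurable_fst.
have m2 : measurable_fun [set: (mR R * mR R)%type] (fun p => decay p.2).
  by apply: (measurableT_comp measurable_decay); exact: measurable_snd.
have m12 : measurable_fun [set: (mR R * mR R)%type]
    (fun p => (decay p.1 * decay p.2)%:E).
  by apply/measurable_EFinP; exact: measurable_realfun.measurable_funM.
suff : (leb \x leb)%E.-integrable setT (fun p => (decay p.1 * decay p.2)%:E) by [].
apply/(integrable12ltyP _ _ m12).
pose I := (\int[leb]_x (decay x)%:E)%E.
have Ioo : (I < +oo)%E.
  have := decay_integrable => /integrableP[_].
  by under eq_integral do rewrite /= ger0_norm ?(ltW (decay_gt0 _))//.
have I0 : (0 <= I)%E by apply: integral_ge0 => x _; rewrite lee_fin ltW// decay_gt0.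
have -> : (\int[leb]_x \int[leb]_y `|(decay x * decay y)%:E| =
    \int[leb]_x ((decay x)%:E * I))%E.
  apply: eq_integral => x _; rewrite /I -ge0_integralZl//; first last.
  - by rewrite lee_fin ltW// decay_gt0.
  - by move=> y _; rewrite lee_fin ltW// decay_gt0.
  - by apply/measurable_EFinP; exact: measurable_decay.
  apply: eq_integral => y _; rewrite /= ger0_norm ?EFinM//.
  by rewrite mulr_ge0 ?ltW ?decay_gt0.
rewrite ge0_integralZr//; first by rewrite lte_mul_pinfty// ge0_fin_numE.
- by apply/measurable_EFinP; exact: measurable_decay.
- by move=> y _; rewrite lee_fin ltW// decay_gt0.
Qed.

End Decay.

(** * The Bergman space and its kernels *)

Section HalfPlaneFunctions.
Variable R : realType.
Implicit Types (h k : Cplus R -> R[i]) (z : R[i]).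
Local Notation leb := (leb R).
Local Notation plane := (plane R).

Lemma Cplus_gt0 (w : Cplus R) : 0 < Re (val w).
Proof. by case: w. Qed.

Lemma zext_val h (w : Cplus R) : zext h (val w) = h w.
Proof. by rewrite /zext valK. Qed.

Lemma zextE h z (hz : 0 < Re z) : zext h z = h (exist _ z hz).
Proof. by rewrite -[z in LHS]/(val (exist (fun z => is_true (0 < Re z)) z hz)) zext_val. Qed.

Lemma zext_out h z : ~~ (0 < Re z) -> zext h z = 0.
Proof. by move=> hz; rewrite /zext insubN. Qed.

Lemma zext_map2 (op : R[i] -> R[i] -> R[i]) h k z : op 0 0 = 0 ->
  zext (fun w => op (h w) (k w)) z = op (zext h z) (zext k z).
Proof.
move=> op0; have [hz|hz] := boolP (0 < Re z); first by rewrite !zextE.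
by rewrite !zext_out.
Qed.

Lemma zextD h k z : zext (fun w => h w + k w) z = zext h z + zext k z.
Proof. by rewrite (@zext_map2 (fun a b => a + b))// addr0. Qed.

Lemma zextZ (a : R[i]) h z : zext (fun w => a * h w) z = a * zext h z.
Proof. by rewrite (@zext_map2 (fun b _ => a * b) h h)// mulr0. Qed.

Lemma Re_near z w : cabs (w - z) < Re z -> 0 < Re w.
Proof.
move=> wz; have := le_lt_trans (absRe_le _) wz; rewrite ReB ltr_norml => /andP[+ _]; lra.
Qed.

Lemma analyticP h : analytic h <->
  forall z, 0 < Re z -> exists A, wirtinger (zext h) z A 0.
Proof.
split=> H.
  by move=> z hz; apply/derivable_wirtinger; exact: (H (exist _ z hz)).
by move=> w; apply/derivable_wirtinger; apply: H; exact: Cplus_gt0.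
Qed.

Lemma analytic_ext h (F : R[i] -> R[i]) : (forall w, h w = F (val w)) ->
  (forall z, 0 < Re z -> exists A, wirtinger F z A 0) -> analytic h.
Proof.
move=> hF HF; apply/analyticP => z hz; have [A dF] := HF z hz; exists A.
apply: wirtinger_near dF; first exact: hz.
by move=> w /Re_near hw; rewrite zextE hF.
Qed.

Lemma analytic_deriv h (w : Cplus R) : analytic h ->
  exists A, wirtinger (zext h) (val w) A 0.
Proof. by move=> /analyticP; apply; exact: Cplus_gt0. Qed.

Lemma analytic_ccont h z : analytic h -> 0 < Re z -> ccont (zext h) z.
Proof. by move=> /analyticP H /H[A]; exact: wirtinger_cont. Qed.

Lemma analyticD h k : analytic h -> analytic k -> analytic (fun w => h w + k w).
Proof.
move=> /analyticP ah /analyticP ak; apply/analyticP => z hz.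
have [A dh] := ah z hz; have [B dk] := ak z hz; exists (A + B).
by rewrite (funext (zextD h k)); have := wirtingerD dh dk; rewrite addr0.
Qed.

Lemma analyticZ (a : R[i]) h : analytic h -> analytic (fun w => a * h w).
Proof.
move=> /analyticP ah; apply/analyticP => z hz.
have [A dh] := ah z hz; exists (a * A).
by rewrite (funext (zextZ a h)); have := wirtingerZ a dh; rewrite mulr0.
Qed.

Lemma cabs_pl_dist (p q : mR R * mR R) : cabs (pl q - pl p) <= `|q.2 - p.2| + `|q.1 - p.1|.
Proof. by rewrite (le_trans (cabs_le _))// !ReB !ImB. Qed.

Lemma cmeas_ccont (F : R[i] -> R[i]) : (forall z, 0 < Re z -> ccont F z) ->
  (forall z, ~~ (0 < Re z) -> F z = 0) -> cmeas (F \o @pl R).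
Proof.
move=> cF F0; pose D : set (mR R * mR R) := [set p | 0 < (p.2 : R)].
have K (g : R[i] -> R) : (forall z w, `|g w - g z| <= cabs (w - z)) -> g 0 = 0 ->
    measurable_fun setT (g \o F \o @pl R).
  move=> gl g0.
  have mgD : measurable_fun D (g \o F \o @pl R).
    apply: measurable_fun_box => p Dp e e0; have [d d0 dF] := cF (pl p) Dp _ e0.
    exists (Num.min (d / 2) p.2); first by rewrite lt_min divr_gt0.
    move=> q; rewrite !lt_min => /andP[q1 _] /andP[q2 q2']; split.
      by move: q2'; rewrite /D/= ltr_norml => /andP[+ _]; lra.
    apply: le_lt_trans (gl _ _) (dF _ _).
    by rewrite (le_lt_trans (cabs_pl_dist p q))// (splitr d) ltrD.
  have mD : measurable D.
    apply: measurable_box_open => p Dp; exists (p.2 : R) => // q _.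
    by rewrite ltr_norml /D/= => /andP[+ _]; lra.
  rewrite (_ : g \o F \o @pl R = (g \o F \o @pl R) \_ D).
    exact/(measurable_restrictT _ mD).
  apply/funext => p; rewrite patchE; case: ifPn => //; rewrite notin_setE /D/= => /negP Dp.
  by rewrite F0.
split.
- by apply: (K (@complex.Re R)) => // z w; rewrite -ReB absRe_le.
- by apply: (K (@complex.Im R)) => // z w; rewrite -ImB absIm_le.
Qed.

Lemma cmeas_zext h : analytic h -> cmeas (zext h \o @pl R).
Proof.
by move=> ah; apply: cmeas_ccont => z hz; [exact: analytic_ccont|exact: zext_out].
Qed.

Lemma cmeas_pl : cmeas (@pl R).
Proof. by split; [exact: measurable_snd|exact: measurable_fst]. Qed.

End HalfPlaneFunctions.

Section Weight.
Variables (R : realType) (l : nat).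
Local Notation leb := (leb R).
Local Notation plane := (plane R).

Let H : set (mR R * mR R) := [set p | 0 < (p.2 : R)].

Definition wt (p : mR R * mR R) : R := \1_H p * ((p.2 : R) ^+ l / pi).

Lemma wt_in p : 0 < (p.2 : R) -> wt p = (p.2 : R) ^+ l / pi.
Proof. by move=> hp; rewrite /wt indicE mem_set// mul1r. Qed.

Lemma wt_out p : ~~ (0 < (p.2 : R)) -> wt p = 0.
Proof. by move=> /negP hp; rewrite /wt indicE memNset// mul0r. Qed.

Lemma wt_ge0 p : 0 <= wt p.
Proof.
have [hp|hp] := boolP (0 < (p.2 : R)); last by rewrite wt_out.
by rewrite wt_in// divr_ge0 ?pi_ge0// exprn_ge0// ltW.
Qed.

Let mH : measurable H.
Proof.
apply: measurable_box_open => p Dp; exists (p.2 : R) => // q _.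
by rewrite ltr_norml /H/= => /andP[+ _]; lra.
Qed.

Lemma measurable_wt : measurable_fun setT wt.
Proof.
apply: measurable_realfun.measurable_funM; first exact: measurable_indic.
apply: measurable_realfun.measurable_funM; last exact: measurable_cst.
by apply: measurable_realfun.measurable_funX; exact: measurable_snd.
Qed.

(** The square root of the weight turns the weighted norm into the norm of square-integrable
    functions on the plane. The weight vanishes off the half-plane, so the values of [F] there do
    not matter. *)
Definition lift (F : R[i] -> R[i]) (p : mR R * mR R) : R[i] :=
  (Num.sqrt (wt p))%:C * F (pl p).

Lemma lift_mulJ (F G : R[i] -> R[i]) p :
  lift F p * cj (lift G p) = (wt p)%:C * (F (pl p) * cj (G (pl p))).
Proof.
rewrite /lift conjcM conjcR mulrACA -rmorphM /= -expr2 sqr_sqrtr//; exact: wt_ge0.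
Qed.

Lemma cabs_lift (F : R[i] -> R[i]) p : cabs (lift F p) = Num.sqrt (wt p) * cabs (F (pl p)).
Proof. by rewrite cabsM cabsR ger0_norm// sqrtr_ge0. Qed.

Lemma cabs_lift2 (F : R[i] -> R[i]) p :
  cabs (lift F p) ^+ 2 = wt p * cabs (F (pl p)) ^+ 2.
Proof. by rewrite cabs_lift exprMn sqr_sqrtr// wt_ge0. Qed.

Lemma cmeas_lift (F : R[i] -> R[i]) : cmeas (F \o @pl R) -> cmeas (lift F).
Proof.
move=> mF; apply: cmeasM => //; apply: cmeasR.
apply: (@measurableT_comp _ _ _ _ _ _ (@Num.sqrt R)); last exact: measurable_wt.
by apply: continuous_measurable_fun; exact: sqrt_continuous.
Qed.

Lemma eq_lift (F G : R[i] -> R[i]) : (forall z, 0 < Re z -> F z = G z) -> lift F = lift G.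
Proof.
move=> FG; apply/funext => p; rewrite /lift.
have [hp|hp] := boolP (0 < (p.2 : R)); first by rewrite FG.
by rewrite wt_out// sqrtr0 !mul0r.
Qed.

Let inner_integralE (u : R[i] -> R) (y : R) :
  (\int[lebesgue_measure]_(x in `]0%R, +oo[) (x ^+ l * u (x +i* y))%:E =
   \int[leb]_x (pi * (wt (y, x) * u (pl (y, x))))%:E)%E.
Proof.
rewrite integral_mkcond; apply: eq_integral => x _; rewrite patchE.
have -> : (x \in `]0, +oo[%classic) = (0 < x).
  by apply/idP/idP; rewrite inE/= in_itv/= andbT.
case: ifPn => hx; last by rewrite wt_out// mul0r mulr0.
by rewrite wt_in//= mulrA mulrCA divff ?mulr1// gt_eqF// pi_gt0.
Qed.

(** Tonelli's form, for norms whose finiteness is not yet known; [weighted_integral_fin] is Fubini's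
    form, for the parts of the inner product. *)
Lemma weighted_integral_ge0 (u : R[i] -> R) :
  measurable_fun setT (fun p => u (pl p)) -> (forall z, 0 <= u z) ->
  weighted_integral l u = (\int[plane]_p (wt p * u (pl p))%:E)%E.
Proof.
move=> mu u0; rewrite /weighted_integral.
under eq_integral do rewrite inner_integralE.
have m1 : measurable_fun setT (fun p => wt p * u (pl p)).
  by apply: measurable_realfun.measurable_funM => //; exact: measurable_wt.
have m2 : measurable_fun setT (fun p => (pi * (wt p * u (pl p)))%:E).
  by apply/measurable_EFinP; apply: measurable_realfun.measurable_funM => //; exact: measurable_cst.
rewrite -(fubini_tonelli1 (fun p => (pi * (wt p * u (pl p)))%:E))//; last first.
  by move=> p; rewrite lee_fin mulr_ge0 ?pi_ge0// mulr_ge0 ?wt_ge0.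
under eq_integral do rewrite EFinM.
rewrite ge0_integralZl//; last 3 first.
- exact/measurable_EFinP.
- by move=> p _; rewrite lee_fin mulr_ge0 ?wt_ge0.
- by rewrite lee_fin pi_ge0.
by rewrite muleA -EFinM mulVf ?mul1e// gt_eqF// pi_gt0.
Qed.

Lemma weighted_integral_fin (u : R[i] -> R) :
  rintegrable plane (fun p => wt p * u (pl p)) ->
  weighted_integral l u = (\int[plane]_p (wt p * u (pl p)))%:E.
Proof.
move=> iu; rewrite /weighted_integral.
under eq_integral do rewrite inner_integralE.
have i2 := rintegrableZ pi iu.
have -> : (\int[lebesgue_measure]_y \int[leb]_x (pi * (wt (y, x) * u (pl (y, x))))%:E =
    \int[plane]_p (pi * (wt p * u (pl p)))%:E)%E.
  by rewrite (integral12_prod_meas1 i2).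
by rewrite -rintE// rintZ// -EFinM mulrA mulVf ?mul1r// gt_eqF// pi_gt0.
Qed.

End Weight.

Section Bergman.
Variables (R : realType) (l : nat).
Implicit Types (h k : Cplus R -> R[i]) (w : Cplus R).
Local Notation leb := (leb R).
Local Notation plane := (plane R).
Local Notation L h := (lift l (zext h)).

Lemma liftD h k : L (fun w => h w + k w) = (fun p => L h p + L k p).
Proof. by apply/funext => p; rewrite /lift zextD; ring. Qed.

Lemma liftZ (a : R[i]) h : L (fun w => a * h w) = (fun p => a * L h p).
Proof. by apply/funext => p; rewrite /lift zextZ; ring. Qed.

Lemma sqnorm_lift h : analytic h ->
  bergman_sqnorm l h = (\int[plane]_p (cabs (L h p) ^+ 2)%:E)%E.
Proof.
move=> ah; have E z : Re (`|zext h z| ^+ 2) = cabs (zext h z) ^+ 2.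
  by rewrite normcabs -rmorphXn.
rewrite /bergman_sqnorm (_ : (fun z => _) = (fun z => cabs (zext h z) ^+ 2)); last first.
  by apply/funext => z; exact: E.
rewrite weighted_integral_ge0.
- by apply: eq_integral => p _; rewrite cabs_lift2.
- exact/measurable_cabs2/cmeas_zext.
- by move=> z; exact: sqr_ge0.
Qed.

Lemma bergmanP h : bergman l h <-> analytic h /\ sqint plane (L h).
Proof.
rewrite /bergman/=; split=> -[ah H]; split=> //; last first.
  have [_ iH] := H; rewrite sqnorm_lift//.
  have /integrableP[_] := iH.
  by under eq_integral do rewrite /= ger0_norm ?sqr_ge0//.
have mL := cmeas_lift l (cmeas_zext ah).
split=> //; apply/integrableP; split.
  by apply/measurable_EFinP; exact: measurable_cabs2.
move: H; rewrite sqnorm_lift//; congr (_ < _)%E.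
by apply: eq_integral => p _; rewrite /= ger0_norm ?sqr_ge0.
Qed.

Lemma bergman_analytic h : bergman l h -> analytic h.
Proof. by case. Qed.

Lemma bergman_sqint h : bergman l h -> sqint plane (L h).
Proof. by move=> /bergmanP[]. Qed.

Lemma bergman_sqnormE h : bergman l h -> bergman_sqnorm l h = (nsq plane (L h))%:E.
Proof. by move=> /bergmanP[ah [_ iL]]; rewrite sqnorm_lift// /nsq rintE. Qed.

Lemma bergman_normE h : bergman l h -> bergman_norm l h = Num.sqrt (nsq plane (L h)).
Proof. by move=> bh; rewrite /bergman_norm bergman_sqnormE. Qed.

Lemma bergman_innerE h k : bergman l h -> bergman l k ->
  bergman_inner l h k = inner plane (L h) (L k).
Proof.
move=> bh bk; have [i1 i2] := sqint_mulJ (bergman_sqint bh) (bergman_sqint bk).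
have E1 p : Re (L h p * cj (L k p)) = wt l p * Re (zext h (pl p) * cj (zext k (pl p))).
  by rewrite lift_mulJ ReM /= mul0r subr0.
have E2 p : Im (L h p * cj (L k p)) = wt l p * Im (zext h (pl p) * cj (zext k (pl p))).
  by rewrite lift_mulJ ImM /= mul0r addr0.
have -> : bergman_inner l h k =
    fine (weighted_integral l (fun z => Re (zext h z * cj (zext k z)))) +i*
    fine (weighted_integral l (fun z => Im (zext h z * cj (zext k z)))) by [].
rewrite !weighted_integral_fin/=; first last.
- exact: eq_rintegrable E1 i1.
- exact: eq_rintegrable E2 i2.
by apply: complexP => /=; apply: eq_Rintegral => p _; rewrite ?E1 ?E2.
Qed.

Lemma bergmanD h k : bergman l h -> bergman l k -> bergman l (fun w => h w + k w).
Proof.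
move=> /bergmanP[ah sh] /bergmanP[ak sk]; apply/bergmanP.
by rewrite liftD; split; [exact: analyticD|exact: sqintD].
Qed.

Lemma bergmanZ (a : R[i]) h : bergman l h -> bergman l (fun w => a * h w).
Proof.
move=> /bergmanP[ah sh]; apply/bergmanP.
by rewrite liftZ; split; [exact: analyticZ|exact: sqintZ].
Qed.

Lemma bergmanB h k : bergman l h -> bergman l k -> bergman l (fun w => h w - k w).
Proof.
move=> bh bk; have := bergmanD bh (bergmanZ (-1) bk).
by under eq_fun do rewrite mulN1r.
Qed.

Definition kfun (w z : R[i]) : R[i] := ((z + cj w) ^+ l.+2)^-1.

Definition ker w : Cplus R -> R[i] := fun z => kfun (val w) (val z).

Lemma Re_addJ_gt0 (z w : R[i]) : 0 < Re z -> 0 < Re w -> 0 < Re (z + cj w).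
Proof. by move=> z0 w0; rewrite ReD ReJ addr_gt0. Qed.

Lemma Re_neq0 (z : R[i]) : 0 < Re z -> z != 0.
Proof. by move=> z0; apply: contraTneq z0 => ->; rewrite ltxx. Qed.

Lemma lift_ker w : L (ker w) = lift l (kfun (val w)).
Proof. by apply: eq_lift => z hz; rewrite zextE. Qed.

Lemma cmeas_kfun w : cmeas (kfun (val w) \o @pl R).
Proof.
by apply/cmeasV/cmeasX/cmeasD; [exact: cmeas_pl|exact: cmeas_cst].
Qed.

Lemma analytic_ker w : analytic (ker w).
Proof.
apply: (@analytic_ext _ _ (kfun (val w))) => // z hz.
have dz : wirtinger (fun z => z + cj (val w)) z 1 0.
  by have := wirtingerD (wirtinger_id z) (wirtinger_cst (cj (val w)) z); rewrite !addr0.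
have := wirtingerX l.+1 dz; rewrite mulr0 => /wirtingerV; rewrite mulr0 => H.
eexists; apply: H; rewrite expf_neq0//; apply: Re_neq0; apply: Re_addJ_gt0 => //.
exact: Cplus_gt0.
Qed.

(** With [m = |z + cj w|], the quotient [x ^ l / m ^ (2 l + 4)] is [(x / m ^ 2) ^ l / m ^ 4]. The
    first factor is bounded since [x * u <= m ^ 2]; the second is controlled by [decay] since
    [1 + |x| <= C1 * m] and [1 + |y| <= C2 * m]. *)
Lemma kfun_bound w : exists C : R, forall p,
  wt l p * cabs (kfun (val w) (pl p)) ^+ 2 <= C * (decay (p.1 : R) * decay (p.2 : R)).
Proof.
set u := Re (val w); set v := Im (val w).
have u0 : 0 < u by exact: Cplus_gt0.
pose C1 := 1 + u^-1; pose C2 := (1 + `|v|) / u + 1.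
have C10 : 0 <= C1 by rewrite addr_ge0// invr_ge0 ltW.
have C20 : 0 <= C2 by rewrite addr_ge0// divr_ge0 ?ltW// ltr_pwDl.
exists (u^-1 ^+ l / pi * (C1 ^+ 2 * C2 ^+ 2)) => -[y x] /=.
have d0 := ltW (mulr_gt0 (decay_gt0 (y : R)) (decay_gt0 (x : R))).
have K0 : 0 <= u^-1 ^+ l / pi * (C1 ^+ 2 * C2 ^+ 2).
  by rewrite !mulr_ge0 ?exprn_ge0 ?invr_ge0 ?pi_ge0// ltW.
have [hx|hx] := boolP (0 < (x : R)); last first.
  by rewrite wt_out//= mul0r mulr_ge0.
rewrite wt_in//=; set m := cabs ((x +i* y) + cj (val w)).
have mE : cabs (kfun (val w) (pl (y, x))) ^+ 2 = (m ^+ 2)^-1 ^+ l * (m ^+ 4)^-1.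
  rewrite /kfun cabsV cabsX -/m -!exprVn -!exprM -exprD.
  by congr (_ ^+ _); rewrite !mulSn addnA addnC mulnC.
have mu : x + u <= m.
  by have := absRe_le ((x +i* y) + cj (val w)); rewrite ReD ReJ /= => /(le_trans (ler_norm _)).
have mv : `|(y : R) - v| <= m.
  by have := absIm_le ((x +i* y) + cj (val w)); rewrite ImD ImJ.
have m0 : 0 < m by rewrite (lt_le_trans _ mu)// addr_gt0.
have b1 : 1 + `|(x : R)| <= C1 * m.
  rewrite (gtr0_norm hx) (@le_trans _ _ (C1 * (x + u)))// ?ler_wpM2l//.
  rewrite /C1 mulrDl mul1r mulrDr mulVf ?gt_eqF//.
  have : 0 <= u^-1 * x by apply: mulr_ge0; rewrite ?invr_ge0 ltW.
  by move: hx u0; lra.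
have b2 : 1 + `|(y : R)| <= C2 * m.
  rewrite /C2 mulrDl mul1r.
  have h1 : 1 + `|v| <= (1 + `|v|) / u * m.
    rewrite -mulrA ler_peMr ?addr_ge0//.
    by rewrite mulrC ler_pdivlMr// mul1r (le_trans _ mu)// lerDr ltW.
  have h2 : `|(y : R)| <= `|v| + `|(y : R) - v|.
    by rewrite -{1}(subrKC v (y : R)) ler_normD.
  lra.
rewrite mE.
have s1 : x ^+ l * (m ^+ 2)^-1 ^+ l <= u^-1 ^+ l.
  rewrite -exprMn; apply: lerXn2r; rewrite ?nnegrE ?invr_ge0 ?(ltW u0)//.
    by rewrite mulr_ge0 ?ltW// invr_gt0 exprn_gt0.
  rewrite ler_pdivrMr ?exprn_gt0// mulrC ler_pdivlMr//.
  apply: (@le_trans _ _ ((x + u) ^+ 2)).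
    by have := mulr_gt0 hx u0; have := sqr_ge0 (x : R); have := sqr_ge0 u; nra.
  by rewrite ler_pXn2r// ?nnegrE ?addr_ge0 ?ltW.
have s2 : (m ^+ 4)^-1 <= C1 ^+ 2 * C2 ^+ 2 * (decay (y : R) * decay (x : R)).
  rewrite /decay -invfM ler_pdivlMr; last by rewrite !mulr_gt0// ltr_pwDl.
  rewrite mulrC ler_pdivrMr ?exprn_gt0//.
  have c1 : (1 + `|(x : R)|) * (1 + `|(x : R)|) <= (C1 * m) * (C1 * m).
    by apply: ler_pM => //; rewrite addr_ge0.
  have c2 : (1 + `|(y : R)|) * (1 + `|(y : R)|) <= (C2 * m) * (C2 * m).
    by apply: ler_pM => //; rewrite addr_ge0.
  rewrite (le_trans (ler_pM _ _ c2 c1))//; try by rewrite mulr_ge0// addr_ge0.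
  by rewrite le_eqVlt; apply/orP; left; apply/eqP; ring.
rewrite (_ : _ * _ = (x ^+ l * (m ^+ 2)^-1 ^+ l) / pi * (m ^+ 4)^-1); last by ring.
rewrite (_ : (u^-1 ^+ l / pi * _) * _ =
  u^-1 ^+ l / pi * (C1 ^+ 2 * C2 ^+ 2 * (decay (y : R) * decay (x : R)))); last by ring.
apply: ler_pM => //.
- by rewrite !mulr_ge0 ?invr_ge0 ?pi_ge0 ?exprn_ge0 ?invr_ge0 ?sqr_ge0// ltW.
- by rewrite invr_ge0 exprn_ge0// ltW.
- by rewrite ler_wpM2r// invr_ge0 pi_ge0.
Qed.

Lemma sqint_kfun w : sqint plane (lift l (kfun (val w))).
Proof.
have mk := cmeas_lift l (cmeas_kfun w).
split=> //; have [C HC] := kfun_bound w.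
apply: rintegrable_le (rintegrableZ C (decay2_integrable R)) _.
  exact: measurable_cabs2.
by move=> p; rewrite ger0_norm ?sqr_ge0// cabs_lift2.
Qed.

Lemma bergman_ker w : bergman l (ker w).
Proof.
by apply/bergmanP; split; [exact: analytic_ker|rewrite lift_ker; exact: sqint_kfun].
Qed.

End Bergman.

(** * The reproducing property *)

Section Cutoff.
Variable R : realType.
Implicit Types (F : R[i] -> R[i]) (z w : R[i]) (m : R).

Definition pos (t : R) : R := Num.max 0 t.

Lemma pos_ge0 t : 0 <= pos t. Proof. by rewrite le_max lexx. Qed.

Lemma pos_lip s t : `|pos s - pos t| <= `|s - t|.
Proof.
rewrite /pos; have [s0|s0] := leP 0 s; have [t0|t0] := leP 0 t; rewrite ?subrr ?normr0//.
- by rewrite subr0 !ger0_norm; lra.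
- by rewrite sub0r normrN (ger0_norm t0) ler0_norm; lra.
Qed.

(** The square of the positive part is continuously differentiable, while the positive part has a
    corner; Green's formula asks for a continuous conjugate derivative, hence the squared
    cut-offs. *)
Lemma pos_sqr_lip s t : `|pos s ^+ 2 - pos t ^+ 2 - 2 * pos t * (s - t)| <= (s - t) ^+ 2.
Proof.
have h1 := sqr_ge0 (s - t); have h2 := sqr_ge0 s; have h3 := sqr_ge0 t.
rewrite /pos ler_norml; have [s0|s0] := leP 0 s; have [t0|t0] := leP 0 t.
- by apply/andP; split; nra.
- have := mulr_ge0 s0 (ltW (eqbRL (oppr_gt0 t) t0)) => h4.
  by apply/andP; split; nra.
- have := mulr_ge0 t0 (ltW (eqbRL (oppr_gt0 s) s0)) => h4.
  by apply/andP; split; nra.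
- by apply/andP; split; nra.
Qed.

Lemma ccont_pos F z : ccont F z -> ccont (fun w => (pos (Re (F w)))%:C) z.
Proof.
move=> cF e /cF[d d0 dF]; exists d => // w /dF; apply: le_lt_trans.
by rewrite -rmorphB cabsR (le_trans (pos_lip _ _))// -ReB absRe_le.
Qed.

Lemma wirtinger_pos2 F z A B : (forall w, F w = (Re (F w))%:C) -> wirtinger F z A B ->
  wirtinger (fun w => (pos (Re (F w)))%:C ^+ 2) z
    ((2 * pos (Re (F z)))%:C * A) ((2 * pos (Re (F z)))%:C * B).
Proof.
move=> FR dF; have cF := wirtinger_cont dF; case: dF => [a [b [<- <- ca cb FE]]].
set t := Re (F z).
pose q s : R := if s == t then 2 * pos t else (pos s ^+ 2 - pos t ^+ 2) / (s - t).
have qE s : pos s ^+ 2 - pos t ^+ 2 = q s * (s - t).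
  rewrite /q; case: eqVneq => [->|st]; first by rewrite !subrr mulr0.
  by rewrite mulfVK// subr_eq0.
have ql s : `|q s - q t| <= `|s - t|.
  have [->|st] := eqVneq s t; first by rewrite !subrr.
  rewrite {2}/q eqxx -(@ler_pM2r _ `|s - t|) ?normr_gt0 ?subr_eq0//.
  rewrite -normrM mulrBl -qE -normrM -expr2 [leRHS]ger0_norm ?sqr_ge0//.
  exact: pos_sqr_lip.
have cq : ccont (fun w => (q (Re (F w)))%:C) z.
  move=> e /cF[d d0 dF]; exists d => // w /dF; apply: le_lt_trans.
  by rewrite -rmorphB cabsR (le_trans (ql _))// -ReB absRe_le.
have qt : q t = 2 * pos t by rewrite /q eqxx.
exists (fun w => (q (Re (F w)))%:C * a w), (fun w => (q (Re (F w)))%:C * b w).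
rewrite -/t qt; split=> //; try exact: ccontM.
move=> w; rewrite -!mulrA -addrA -mulrDr.
have -> : a w * (w - z) + b w * cj (w - z) = (Re (F w) - t)%:C.
  have -> : (Re (F w) - t)%:C = F w - F z by rewrite rmorphB /t [in RHS]FR [in X in _ = _ - X]FR.
  by rewrite FE; ring.
by rewrite -rmorphM -qE -!rmorphXn -rmorphD /= addrC subrK.
Qed.

Definition xr z : R[i] := (Re z)%:C.

Lemma xrE z : xr z = 2^-1 * z + 2^-1 * cj z.
Proof. by rewrite -mulrDr addcJ mulrA mulVf ?mul1r// pnatr_eq0. Qed.

Lemma wirtinger_xr z : wirtinger xr z 2^-1 2^-1.
Proof.
have -> : xr = fun w => 2^-1 * w + 2^-1 * cj w by apply/funext => w; exact: xrE.
have := wirtingerD (wirtingerZ 2^-1 (wirtinger_id z)) (wirtingerZ 2^-1 (wirtinger_conj z)).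
by rewrite !mulr0 !mulr1 addr0 add0r.
Qed.

(* An exhaustion of the half-plane by the discs [exhaust < m]. *)
Definition exhaust z : R[i] := (z * cj z + 1) * (xr z)^-1.

(** Twice the hyperbolic cosine of the hyperbolic distance from [z] to 1. *)
Definition gauge z : R := (cabs z ^+ 2 + 1) / Re z.

Lemma exhaustE z : exhaust z = (gauge z)%:C.
Proof.
rewrite /exhaust mulCJ /xr /gauge [RHS]rmorphM [in RHS]fmorphV.
by rewrite [in RHS]rmorphD rmorph1.
Qed.

Lemma gauge_gt0 z : 0 < Re z -> 0 < gauge z.
Proof. by move=> z0; rewrite divr_gt0// ltr_wpDl// sqr_ge0. Qed.

Lemma wirtinger_exhaust z : 0 < Re z ->
  exists A, wirtinger exhaust z A ((z ^+ 2 - 1) / (2 * xr z ^+ 2)).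
Proof.
move=> z0; have x0 : xr z != 0 by rewrite /xr eq_complex/= eqxx andbT gt_eqF.
have d1 := wirtingerD (wirtingerM (wirtinger_id z) (wirtinger_conj z)) (wirtinger_cst 1 z).
have d2 := wirtingerV x0 (wirtinger_xr z).
have d := wirtingerM d1 d2; eexists.
rewrite (_ : _ / _ = (0 * cj z + z * 1 + 0) * (xr z)^-1 +
  (z * cj z + 1) * (- (xr z)^-1 ^+ 2 / 2)); first exact: d.
(* Because [2 x = z + cj z], the numerator [2 x z - |z| ^ 2 - 1] is [z ^ 2 - 1]. *)
have -> : z ^+ 2 = 2 * xr z * z - z * cj z by rewrite xrE; field.
by field.
Qed.

Definition cutarg m z : R[i] := 1 - (m^-1)%:C * exhaust z.

Definition cut m z : R[i] := (pos (Re (cutarg m z)))%:C ^+ 2.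

Definition dcut m z : R[i] :=
  - ((pos (Re (cutarg m z)))%:C * (m^-1)%:C * (z ^+ 2 - 1) * (xr z)^-1 ^+ 2).

Lemma cutargE m z : cutarg m z = (1 - gauge z / m)%:C.
Proof.
by rewrite /cutarg exhaustE -rmorphM -(rmorph1 (real_complex R)) -rmorphB (mulrC (gauge z)).
Qed.

Lemma wirtinger_cut m z : 0 < Re z -> exists A, wirtinger (cut m) z A (dcut m z).
Proof.
move=> z0; have [A dE] := wirtinger_exhaust z0.
have x0 : xr z != 0 by rewrite /xr eq_complex/= eqxx andbT gt_eqF.
have d1 := wirtingerD (wirtinger_cst 1 z) (wirtingerZ (- (m^-1)%:C) dE).
have {}d1 : wirtinger (cutarg m) z (- (m^-1)%:C * A)
    (- (m^-1)%:C * ((z ^+ 2 - 1) / (2 * xr z ^+ 2))).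
  rewrite !add0r in d1; apply: wirtinger_near d1; first exact: ltr01.
  by move=> w _; rewrite mulNr.
have dF := wirtinger_pos2 (fun w => etrans (cutargE m w) (congr1 _ (esym
  (congr1 (@complex.Re R) (cutargE m w))))) d1.
eexists; rewrite /dcut; move: dF; congr wirtinger.
have -> : (2 * pos (Re (cutarg m z)))%:C = 2 * (pos (Re (cutarg m z)))%:C.
  by rewrite rmorphM rmorph_nat.
set P := (pos _)%:C.
by move: (xr z) x0 P (m^-1)%:C => x x0 P k; field.
Qed.

Lemma cut_Re m z : cut m z = (pos (1 - gauge z / m) ^+ 2)%:C.
Proof. by rewrite /cut cutargE rmorphXn. Qed.

Lemma cabs_cut_le1 m z : 0 < m -> 0 < Re z -> cabs (cut m z) <= 1.
Proof.
move=> m0 z0; rewrite cut_Re cabsR ger0_norm ?sqr_ge0// expr_le1 ?pos_ge0//.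
have : 0 < gauge z / m by rewrite divr_gt0// gauge_gt0.
by rewrite /pos ge_max ler01 /=; lra.
Qed.

Lemma cabs_cut1 m z : 0 < m -> 0 < Re z -> cabs (1 - cut m z) <= 2 * (gauge z / m).
Proof.
move=> m0 z0; have t0 : 0 < gauge z / m by rewrite divr_gt0// gauge_gt0.
rewrite cut_Re -(rmorph1 (real_complex R)) -rmorphB cabsR /pos.
by have [h|h] := leP 0 (1 - gauge z / m); rewrite ler_norml; apply/andP; split; nra.
Qed.

Lemma cut_out m z : 0 < m -> m <= gauge z -> cut m z = 0 /\ dcut m z = 0.
Proof.
move=> m0 mz; rewrite /dcut /cut cutargE /=.
have -> : pos (1 - gauge z / m) = 0.
  by apply/max_idPl; rewrite subr_le0 ler_pdivlMr// mul1r.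
by rewrite rmorph0 expr0n/= !mul0r oppr0.
Qed.

(** Since [|z ^ 2 - 1| <= |z| ^ 2 + 1], the numerator of [gauge], differentiating the cut-off costs
    no more than a factor [1 / Re z], which [Pq_bound] repays. *)
Lemma cabs_dcut m z : 0 < m -> 0 < Re z ->
  cabs (dcut m z) * Re z <= pos (1 - gauge z / m) * (gauge z / m).
Proof.
move=> m0 z0; have x0 : Re z != 0 by rewrite gt_eqF.
have m0' : m != 0 by rewrite gt_eqF.
have E : cabs (dcut m z) * Re z =
    pos (1 - gauge z / m) * (cabs (z ^+ 2 - 1) / Re z / m).
  rewrite /dcut cutargE /= cabsN 3!cabsM !cabsR cabsX cabsV /xr cabsR.
  rewrite (ger0_norm (pos_ge0 _)) !gtr0_norm ?invr_gt0//.
  by field; rewrite x0 m0'.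
rewrite E ler_wpM2l ?pos_ge0// ler_pM2r ?invr_gt0// /gauge ler_pM2r ?invr_gt0//.
by rewrite (le_trans (cabsB _ _))// cabsX cabs1.
Qed.

(** This bound gives convergence to 0 at each point; [cabs_dcut_le1] gives domination uniform in
    [m], from [(1 - t) * t <= 1]. *)
Lemma cabs_dcut_le m z : 0 < m -> 0 < Re z -> cabs (dcut m z) * Re z <= gauge z / m.
Proof.
move=> m0 z0; have t0 : 0 < gauge z / m by rewrite divr_gt0// gauge_gt0.
apply: le_trans (cabs_dcut m0 z0) _; rewrite ger_pMl// /pos ge_max ler01 /=; lra.
Qed.

Lemma cabs_dcut_le1 m z : 0 < m -> 0 < Re z -> cabs (dcut m z) * Re z <= 1.
Proof.
move=> m0 z0; have t0 : 0 < gauge z / m by rewrite divr_gt0// gauge_gt0.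
apply: le_trans (cabs_dcut m0 z0) _; rewrite /pos.
by have [h|h] := leP 0 (1 - gauge z / m); nra.
Qed.

Lemma ccont_xr z : ccont xr z.
Proof. exact: wirtinger_cont (wirtinger_xr z). Qed.

Lemma ccont_cut m z : 0 < Re z -> ccont (cut m) z.
Proof. by move=> /(wirtinger_cut m)[A]; exact: wirtinger_cont. Qed.

Lemma ccont_dcut m z : 0 < Re z -> ccont (dcut m) z.
Proof.
move=> z0; have [A /wirtinger_cont cE] := wirtinger_exhaust z0.
have x0 : xr z != 0 by rewrite /xr eq_complex/= eqxx andbT gt_eqF.
apply/ccontN/ccontM; last by apply/ccontX/ccontV => //; exact: ccont_xr.
apply: ccontM; last first.
  by apply: ccontD; [apply: ccontX; exact: ccont_id|exact: ccont_cst].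
apply: ccontM; last exact: ccont_cst.
by apply/ccont_pos/ccontD; [exact: ccont_cst|apply/ccontN/ccontM => //; exact: ccont_cst].
Qed.

Lemma cmeas_cut m : cmeas (cut m \o @pl R) /\ cmeas (dcut m \o @pl R).
Proof.
have mx : cmeas (xr \o @pl R) by apply: cmeasR; exact: measurable_snd.
have mE : cmeas (exhaust \o @pl R).
  apply: cmeasM; last exact: cmeasV.
  by apply: cmeasD; [apply: cmeasM; [|apply: cmeasJ]; exact: cmeas_pl|exact: cmeas_cst].
have mP : cmeas (fun p => (pos (Re (cutarg m (pl p))))%:C).
  apply: cmeasR; apply: measurable_realfun.measurable_maxr; first exact: measurable_cst.
  have : cmeas (cutarg m \o @pl R).
    by apply: cmeasB; [|apply: cmeasM => //]; exact: cmeas_cst.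
  by case.
split; first exact: cmeasX.
apply/cmeasN/cmeasM; last exact/cmeasX/cmeasV.
apply: cmeasM; first by apply: cmeasM => //; exact: cmeas_cst.
by apply: cmeasB; [apply: cmeasX; exact: cmeas_pl|exact: cmeas_cst].
Qed.

Lemma gauge_box m z : 0 < Re z -> gauge z < m -> [/\ m^-1 < Re z, Re z < m & `|Im z| < m].
Proof.
move=> z0; rewrite /gauge ltr_pdivrMr// sqr_cabs => h.
have m0 : 0 < m.
  by have := sqr_ge0 (Re z); have := sqr_ge0 (Im z); rewrite -(pmulr_lgt0 _ z0); lra.
have xm : Re z < m.
  by rewrite -(ltr_pM2r z0) -expr2; have := sqr_ge0 (Im z); lra.
split=> //.
  rewrite -(ltr_pM2l m0) divff ?gt_eqF//.
  by have := sqr_ge0 (Re z); have := sqr_ge0 (Im z); lra.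
rewrite -(@ltr_pXn2r _ 2) ?nnegrE ?normr_ge0 ?(ltW m0)// real_normK ?num_real//.
have : m * Re z < m ^+ 2 by rewrite expr2 ltr_pM2l.
by have := sqr_ge0 (Re z); lra.
Qed.

End Cutoff.

Section Preliminaries.
Variable R : realType.

(** Continuity bounds [F] near each point, and bounds on four quarters give one on their union. *)
Lemma ccont_bounded_rect (F : R[i] -> R[i]) (a b c d : R) : a <= b -> c <= d ->
  (forall z, a <= Re z <= b -> c <= Im z <= d -> ccont F z) ->
  exists M, forall z, a <= Re z <= b -> c <= Im z <= d -> cabs (F z) <= M.
Proof.
move=> ab cd cF.
apply: (@rectangle_bisection _ (fun a b c d => exists M, forall z,
  a <= Re z <= b -> c <= Im z <= d -> cabs (F z) <= M) a b c d ab cd).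
  move=> a' b' c' d' _ _ [M1 H1] [M2 H2] [M3 H3] [M4 H4] _ _ _ _.
  exists (Num.max (Num.max M1 M2) (Num.max M3 M4)) => z /andP[z1 z2] /andP[z3 z4].
  rewrite !le_max; have [x|x] := leP (Re z) ((a' + b') / 2);
    have [y|y] := leP (Im z) ((c' + d') / 2).
  - by rewrite H1 ?z1 ?x ?z3 ?y.
  - by rewrite H3 ?orbT// ?z1 ?x ?z4 ?(ltW y).
  - by rewrite H2 ?orbT// ?z2 ?(ltW x) ?z3 ?y.
  - by rewrite H4 ?orbT// ?z2 ?(ltW x) ?z4 ?(ltW y).
move=> x y xab ycd; have [r r0 Hr] := cF (x +i* y) xab ycd 1 ltr01.
exists r => // a' b' c' d' _ ax xb _ _ cy yd _ s.
exists (cabs (F (x +i* y)) + 1) => z /andP[z1 z2] /andP[z3 z4].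
rewrite -[F z](subrK (F (x +i* y))) (le_trans (cabsD _ _))// addrC lerD2l ltW//.
apply: Hr; rewrite (le_lt_trans (cabs_le _))// (le_lt_trans _ s)// ReB ImB /=.
by apply: lerD; rewrite ler_norml; apply/andP; split; lra.
Qed.

(** Convergence is asked at the rate [c / (n + 1)], with [c] depending on the point; cut-offs and
    dampings both provide it, and it passes directly to real and imaginary parts. *)
Lemma cint_dominated_eq0 d (T : measurableType d) (mu : {measure set T -> \bar R})
    (F_ : nat -> T -> R[i]) (F : T -> R[i]) (v : T -> R) :
  (forall n, cmeas (F_ n)) -> cmeas F -> rintegrable mu v ->
  (forall n t, cabs (F_ n t) <= v t) ->
  (forall t, exists c : R, forall n, cabs (F_ n t - F t) <= c / n.+1%:R) ->
  (forall n, cint mu (F_ n) = 0) -> cint mu F = 0.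
Proof.
move=> mF_ mF iv Fv FF F0.
have lim (g : R[i] -> R) : (forall z w, `|g z - g w| <= cabs (z - w)) ->
    forall t, g (F_ n t) @[n --> \oo] --> g (F t).
  move=> gl t; have [c Hc] := FF t.
  have c1 : (fun n : nat => g (F t) - c * n.+1%:R^-1) @ \oo --> g (F t).
    rewrite -[X in _ --> X]subr0; apply: cvgB; first exact: cvg_cst.
    rewrite -[X in _ --> X](mulr0 c); apply: cvgM; [exact: cvg_cst|exact: cvg_harmonic].
  have c2 : (fun n : nat => g (F t) + c * n.+1%:R^-1) @ \oo --> g (F t).
    rewrite -[X in _ --> X]addr0; apply: cvgD; first exact: cvg_cst.
    rewrite -[X in _ --> X](mulr0 c); apply: cvgM; [exact: cvg_cst|exact: cvg_harmonic].
  apply: squeeze_cvgr c1 c2; apply: nearW => n.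
  have := le_trans (gl (F_ n t) (F t)) (Hc n).
  by rewrite ler_distl => /andP[-> ->].
have H (g : R[i] -> R) : (forall z w, `|g z - g w| <= cabs (z - w)) ->
    (forall z, `|g z| <= cabs z) ->
    (forall n, measurable_fun setT (fun t => g (F_ n t))) ->
    measurable_fun setT (fun t => g (F t)) ->
    (forall n, \int[mu]_t g (F_ n t) = 0) -> \int[mu]_t g (F t) = 0.
  move=> gl gb m1 m2 g0.
  have [_ L] := rint_dominated m1 m2 iv
    (fun n t => le_trans (gb _) (Fv n t)) (lim g gl).
  apply: (cvg_unique _ L); first exact: Rhausdorff.
  rewrite (_ : (fun n => _) = fun=> 0); last exact/funext.
  exact: cvg_cst.
apply: complexP => /=.
- apply: (H (@complex.Re R)).
  + by move=> z w; rewrite -ReB absRe_le.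
  + exact: absRe_le.
  + by move=> n; case: (mF_ n).
  + by case: mF.
  + by move=> n; have /(congr1 (@complex.Re R)) := F0 n.
- apply: (H (@complex.Im R)).
  + by move=> z w; rewrite -ImB absIm_le.
  + exact: absIm_le.
  + by move=> n; case: (mF_ n).
  + by case: mF.
  + by move=> n; have /(congr1 (@complex.Im R)) := F0 n.
Qed.

End Preliminaries.

Section Orthogonality.
Variables (R : realType) (l : nat) (h : Cplus R -> R[i]) (w : Cplus R).
Hypothesis bh : bergman l h.
Hypothesis hw : h w = 0.
Local Notation plane := (plane R).

Let o : R[i] := val w.
Let u : R := Re o.
Let u0 : 0 < u. Proof. exact: Cplus_gt0. Qed.
Let H := zext h.
Let K := kfun l o.
Let s z : R := cabs (z + cj o).
Let q z : R[i] := H z * (z - o)^-1.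
(** The derivative of [P] with respect to [cj z] is [(o - z) / (2 * (cj z + o) ^+ 2)]; its zero at
    [o] cancels the denominator of [q]. *)
Let P z : R[i] := xr z * (cj z + o)^-1.
(* Up to a factor, [T] is the integrand of the inner product with the kernel at
   [o], and also the derivative of [P ^+ l.+1 * q] with respect to [cj z]: [q]
   is holomorphic away from [o]. *)
Let T z : R[i] := xr z ^+ l * (H z * cj (K z)).
Let Psi m z : R[i] := cut m z * (P z ^+ l.+1 * q z).
Let D m z : R[i] := dcut m z * (P z ^+ l.+1 * q z) - l.+1%:R / 2 * (cut m z * T z).

Let sE z : cabs (cj z + o) = s z.
Proof. by rewrite -cabsJ conjcD conjcK. Qed.

Let s_ge z : 0 < Re z -> Re z + u <= s z.
Proof.
move=> z0; rewrite (le_trans _ (absRe_le _))// (le_trans _ (ler_norm _))//.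
by rewrite ReD ReJ.
Qed.

Let s_gt0 z : 0 < Re z -> 0 < s z.
Proof. by move=> z0; rewrite (lt_le_trans _ (s_ge z0))// addr_gt0. Qed.

Let cabsK z : cabs (K z) = (s z ^+ l.+2)^-1.
Proof. by rewrite cabsV cabsX. Qed.

Let so_neq0 z : 0 < Re z -> cj z + o != 0.
Proof. by move=> z0; rewrite -cabs_gt0 sE s_gt0. Qed.

Let H_out z : ~~ (0 < Re z) -> H z = 0.
Proof. exact: zext_out. Qed.

Let Ho : H o = 0.
Proof. by rewrite /H zext_val. Qed.

Let cH z : 0 < Re z -> ccont H z.
Proof. by apply: analytic_ccont; exact: bergman_analytic bh. Qed.

(* Close to [o] the quotient [q] is bounded since [h] is differentiable there;
   the kernel itself accounts for this bound. *)
Let q_bound : exists2 C : R, 0 <= C & forall z, 0 < Re z ->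
  cabs (q z) * s z <= C * (cabs (H z) + cabs (K z)).
Proof.
have [A /wirtinger_littleo/(_ 1 ltr01)[r r0 Hr]] :=
  analytic_deriv w (bergman_analytic bh).
(* [B] bounds the difference quotient of [h] at [o] within distance [r], and [S] bounds [s] there;
   farther away [s z] is at most [1 + 2 * u / r] times [|z - o|]. *)
pose B := cabs A + 1; pose S := r + 2 * u.
have B0 : 0 <= B by rewrite addr_ge0// cabs_ge0.
have S0 : 0 < S by rewrite addr_gt0// mulr_gt0.
have so z : s z <= cabs (z - o) + 2 * u.
  rewrite /s; have -> : z + cj o = (z - o) + (2 * u)%:C.
    by rewrite /u rmorphM rmorph_nat -addcJ; ring.
  by rewrite (le_trans (cabsD _ _))// cabsR gtr0_norm// mulr_gt0.
have ur0 : 0 <= 1 + 2 * u / r.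
  by apply: addr_ge0 => //; apply: divr_ge0 (ltW r0); apply: mulr_ge0 (ltW u0).
have BS0 : 0 <= B * S ^+ l.+3 by rewrite mulr_ge0// exprn_ge0// ltW.
exists (B * S ^+ l.+3 + (1 + 2 * u / r)); first exact: addr_ge0.
move=> z z0; have sz0 := s_gt0 z0.
have HK0 : 0 <= cabs (H z) + cabs (K z) by rewrite addr_ge0 ?cabs_ge0.
(* At [o] itself [q] is 0 by the convention [0^-1 = 0]. *)
have [zE|zo] := eqVneq z o.
  by rewrite /q zE subrr invr0 mulr0 cabs0 mul0r -zE mulr_ge0// addr_ge0.
have zo0 : 0 < cabs (z - o) by rewrite cabs_gt0 subr_eq0.
have [zr|zr] := ltP (cabs (z - o)) r.
  have qB : cabs (q z) <= B.
    rewrite cabsM cabsV ler_pdivrMr//.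
    have := Hr z zr; rewrite -/H -/o Ho mul0r !subr0 mul1r => h1.
    rewrite -[H z](subrK (A * (z - o))) (le_trans (cabsD _ _))// cabsM /B mulrDl mul1r addrC.
    by rewrite lerD2l.
  have sS : s z <= S by rewrite (le_trans (so z))// lerD2r ltW.
  apply: (@le_trans _ _ (B * S ^+ l.+3 * cabs (K z))).
    rewrite -mulrA; apply: ler_pM => //; [exact: cabs_ge0|exact: ltW|].
    rewrite cabsK ler_pdivlMr ?exprn_gt0// -exprS.
    by apply: lerXn2r => //; rewrite nnegrE ltW.
  by rewrite [leRHS]mulrDl ler_wpDr ?mulr_ge0// ler_wpM2l// lerDr cabs_ge0.
apply: (@le_trans _ _ ((1 + 2 * u / r) * cabs (H z))).
  rewrite cabsM cabsV -mulrA [leRHS]mulrC ler_wpM2l ?cabs_ge0//.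
  rewrite mulrC ler_pdivrMr// (le_trans (so z))// [leRHS]mulrDl mul1r lerD2l.
  by rewrite -[leRHS]mulrA ler_peMr ?mulr_ge0 ?(ltW u0)// mulrC ler_pdivlMr// mul1r.
rewrite [leRHS]mulrDl; apply: ler_wpDl (mulr_ge0 BS0 HK0) _.
by rewrite ler_wpM2l// lerDl cabs_ge0.
Qed.

(** The common majorant of [T] and, up to constants, of all [D m]; it is integrable over the
    half-plane because [h] and the kernel are square-integrable for the weight. *)
Let V z : R := Re z ^+ l * (cabs (K z) * (cabs (H z) + cabs (K z))).

Let V_ge0 z : 0 < Re z -> 0 <= V z.
Proof.
by move=> z0; rewrite mulr_ge0 ?exprn_ge0 ?(ltW z0)// mulr_ge0 ?addr_ge0 ?cabs_ge0.
Qed.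

Let T_le z : 0 < Re z -> cabs (T z) <= V z.
Proof.
move=> z0; rewrite cabsM cabsX cabsR gtr0_norm// /V ler_wpM2l ?exprn_ge0 ?(ltW z0)//.
by rewrite cabsM cabsJ mulrC ler_wpM2l ?cabs_ge0// lerDl cabs_ge0.
Qed.

(** The modulus of [P ^+ l.+1] is [x] times [x ^ l * |K| * s]: the spare [s] is absorbed by
    [q_bound], and the spare [x] is kept to offset the derivative of the cut-off. *)
Let Pq_bound : exists2 C : R, 0 <= C & forall z, 0 < Re z ->
  cabs (P z ^+ l.+1 * q z) <= C * Re z * V z.
Proof.
have [C C0 HC] := q_bound; exists C => // z z0.
have sz0 := s_gt0 z0.
have E : cabs (P z ^+ l.+1 * q z) =
    Re z * (Re z ^+ l * (cabs (K z) * (cabs (q z) * s z))).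
  rewrite cabsM cabsX /P cabsM cabsV sE /xr cabsR gtr0_norm// cabsK.
  rewrite exprMn exprVn exprS [s z ^+ l.+2]exprSr; field.
  by rewrite !gt_eqF// exprn_gt0.
rewrite E /V (_ : C * _ * _ =
  Re z * (Re z ^+ l * (cabs (K z) * (C * (cabs (H z) + cabs (K z)))))); last by ring.
rewrite ler_wpM2l ?(ltW z0)// ler_wpM2l ?exprn_ge0 ?(ltW z0)//.
by rewrite ler_wpM2l ?cabs_ge0// HC.
Qed.

Let Psi_wirtinger m z : 0 < Re z -> z <> o -> exists A, wirtinger (Psi m) z A (D m z).
Proof.
move=> z0 /eqP zo; have so0 := so_neq0 z0.
have zo0 : z - o != 0 by rewrite subr_eq0.
have /analyticP/(_ z z0)[AH dH] := bergman_analytic bh.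
have dq0 := @wirtingerV _ (fun z => z - o) z _ _ zo0
      (wirtingerD (wirtinger_id z) (wirtinger_cst (- o) z)).
have dq := wirtingerM dH dq0.
have dP0 := @wirtingerV _ (fun z => cj z + o) z _ _ so0
      (wirtingerD (wirtinger_conj z) (wirtinger_cst o z)).
have dP := wirtingerX l (wirtingerM (wirtinger_xr z) dP0).
have [AC dC] := wirtinger_cut m z0.
have d := wirtingerM dC (wirtingerM dP dq).
eexists; move: d; rewrite -/(P z) -/(q z); congr wirtinger.
rewrite /D; congr (_ + _); rewrite /T.
have -> : cj (K z) = (cj z + o)^-1 ^+ l * (cj z + o)^-1 ^+ 2.
  by rewrite /K /kfun conjc_inv conjcX conjcD conjcK -exprD addn2 exprVn.
rewrite /P exprMn /q -/H.
have -> : xr z = 2^-1 * z + 2^-1 * cj z by exact: xrE.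
rewrite !(addr0, add0r, mul0r, mulr0, mulr1).
set X := (2^-1 * z + 2^-1 * cj z) ^+ l; set Y := (cj z + o)^-1 ^+ l.
move: X Y => X Y.
by field; apply/andP.
Qed.

Let D_ccont m z : 0 < Re z -> z <> o -> ccont (D m) z.
Proof.
move=> z0 /eqP zo; have so0 := so_neq0 z0.
have zo0 : z - o != 0 by rewrite subr_eq0.
have cPq : ccont (fun z => P z ^+ l.+1 * q z) z.
  apply: ccontM.
    apply/ccontX/ccontM; first exact: ccont_xr.
    apply: ccontV => //; apply: ccontD; last exact: ccont_cst.
    by apply: ccontJ; exact: ccont_id.
  apply: ccontM; first exact: cH.
  by apply: ccontV => //; apply: ccontD; [exact: ccont_id|exact: ccont_cst].
apply: ccontD; first by apply: ccontM => //; exact: ccont_dcut.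
apply/ccontN/ccontM; first exact: ccont_cst.
apply: ccontM; first exact: ccont_cut.
apply: ccontM; first by apply: ccontX; exact: ccont_xr.
apply: ccontM; first exact: cH.
apply/ccontJ/ccontV.
  by rewrite expf_neq0// -cabs_gt0 -/(s z) s_gt0.
by apply/ccontX/ccontD; [exact: ccont_id|exact: ccont_cst].
Qed.

Let mH : cmeas (H \o @pl R). Proof. exact: cmeas_zext (bergman_analytic bh). Qed.

Let mPq : cmeas (fun p => P (pl p) ^+ l.+1 * q (pl p)).
Proof.
have mp := cmeas_pl R; have mx : cmeas (@xr R \o @pl R).
  by apply: cmeasR; exact: measurable_snd.
apply: cmeasM.
  apply/cmeasX/cmeasM => //; apply/cmeasV/cmeasD; last exact: cmeas_cst.
  exact: cmeasJ.
by apply: cmeasM => //; apply/cmeasV/cmeasB => //; exact: cmeas_cst.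
Qed.

Let mT : cmeas (T \o @pl R).
Proof.
have mx : cmeas (@xr R \o @pl R) by apply: cmeasR; exact: measurable_snd.
apply: cmeasM; first exact: cmeasX.
by apply: cmeasM => //; apply: cmeasJ; exact: cmeas_kfun.
Qed.

Let mPsi m : cmeas (Psi m \o @pl R).
Proof. by apply: cmeasM => //; exact: (cmeas_cut m).1. Qed.

Let mD m : cmeas (D m \o @pl R).
Proof.
apply: cmeasB; first by apply: cmeasM => //; exact: (cmeas_cut m).2.
by apply: cmeasM; [exact: cmeas_cst|apply: cmeasM => //; exact: (cmeas_cut m).1].
Qed.

Let Psi_out m z : ~~ (0 < Re z) -> Psi m z = 0.
Proof. by move=> /H_out Hz; rewrite /Psi /q Hz mul0r !mulr0. Qed.

Let T_out z : ~~ (0 < Re z) -> T z = 0.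
Proof. by move=> /H_out Hz; rewrite /T Hz mul0r mulr0. Qed.

Let D_out m z : ~~ (0 < Re z) -> D m z = 0.
Proof.
by move=> z0; rewrite /D T_out// /q H_out// mul0r !mulr0 subrr.
Qed.

Let half : cabs (l.+1%:R / 2 : R[i]) <= l.+1%:R.
Proof.
have -> : (l.+1%:R / 2 : R[i]) = (l.+1%:R / 2)%:C.
  by rewrite rmorphM fmorphV !rmorph_nat.
by rewrite cabsR ger0_norm ?divr_ge0// ler_pdivrMr// ler_peMr// ler1n.
Qed.

(** The constant does not depend on [m]. The first bound is for Green's formula, the second is the
    domination, and the third says that [D m] tends to [- (l + 1) / 2 * T]. *)
Let D_bound : exists2 C : R, 0 <= C & forall m z, 0 < m -> 0 < Re z ->
  [/\ cabs (Psi m z) <= C * Re z * V z, cabs (D m z) <= C * V z &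
      cabs (D m z + l.+1%:R / 2 * T z) <= C * V z * gauge z / m].
Proof.
have [C C0 HC] := Pq_bound; exists (C + 2 * l.+1%:R); first by rewrite addr_ge0// mulr_ge0.
move=> m z m0 z0.
have g0 : 0 <= gauge z / m by rewrite divr_ge0 ?(ltW m0)// ltW// gauge_gt0.
have V0 := V_ge0 z0; have Vz0 : 0 <= Re z * V z by rewrite mulr_ge0// ltW.
have L0 : 0 <= l.+1%:R :> R by [].
have Pq := HC z z0; have Tz := T_le z0.
have dPq (t : R) : cabs (dcut m z) * Re z <= t ->
    cabs (dcut m z * (P z ^+ l.+1 * q z)) <= t * (C * V z).
  move=> ht; rewrite cabsM (@le_trans _ _ (cabs (dcut m z) * (C * Re z * V z)))//.
    by rewrite ler_wpM2l ?cabs_ge0.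
  rewrite (_ : _ * (C * _ * _) = (cabs (dcut m z) * Re z) * (C * V z)); last by ring.
  by rewrite ler_wpM2r// mulr_ge0.
have cT (a : R[i]) (t : R) : cabs a <= t ->
    cabs (l.+1%:R / 2 * (a * T z)) <= l.+1%:R * (t * V z).
  move=> ha; rewrite cabsM; apply: ler_pM; rewrite ?cabs_ge0//.
  by rewrite cabsM; apply: ler_pM; rewrite ?cabs_ge0.
split.
- rewrite cabsM (@le_trans _ _ (C * Re z * V z))//.
    by rewrite -[leRHS]mul1r; apply: ler_pM; rewrite ?cabs_ge0// cabs_cut_le1.
  rewrite -!mulrA ler_wpM2r// lerDl mulr_ge0//.
- rewrite /D (le_trans (cabsB _ _))//.
  rewrite (le_trans (lerD (dPq 1 (cabs_dcut_le1 m0 z0)) (cT _ 1 (cabs_cut_le1 m0 z0))))//.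
  rewrite -subr_ge0 (_ : _ - _ = l.+1%:R * V z); last by ring.
  by rewrite mulr_ge0.
- rewrite (_ : D m z + _ = dcut m z * (P z ^+ l.+1 * q z) +
    l.+1%:R / 2 * ((1 - cut m z) * T z)); last by rewrite /D; ring.
  rewrite (le_trans (cabsD _ _))//.
  rewrite (le_trans (lerD (dPq _ (cabs_dcut_le m0 z0)) (cT _ _ (cabs_cut1 m0 z0))))//.
  by rewrite le_eqVlt; apply/orP; left; apply/eqP; ring.
Qed.

Let cintD0 m : 0 < m -> cint plane (D m \o @pl R) = 0.
Proof.
move=> m0; have [C C0 HC] := D_bound.
pose v := Im o.
(* The rectangle is large enough to contain the disc [gauge < m] and to have [o] in its interior. *)
pose a := Num.min m^-1 u / 2; pose b := m + u; pose d := m + `|v| + 1.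
have a0 : 0 < a by rewrite divr_gt0// lt_min invr_gt0 m0.
have am : a < m^-1.
  have h1 : Num.min m^-1 u <= m^-1 by rewrite ge_min lexx.
  have h2 : 0 < m^-1 by rewrite invr_gt0.
  by rewrite /a; lra.
have au : a < u.
  have h1 : Num.min m^-1 u <= u by rewrite ge_min lexx orbT.
  by have := u0; rewrite /a; lra.
have uu := u0.
have bm : m < b by rewrite /b; lra.
have ub : u < b by rewrite /b; lra.
have vn : `|v| < d by rewrite /d; lra.
have dm : m < d by have := normr_ge0 v; rewrite /d; lra.
have ab : a <= b by lra.
have cd : - d <= d by lra.
have [MH HMH] : exists M, forall z, a <= Re z <= b -> - d <= Im z <= d -> cabs (H z) <= M.
  apply: ccont_bounded_rect => // z /andP[az _] _.
  by apply: cH; exact: lt_le_trans az.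
have [MK HMK] : exists M, forall z, a <= Re z <= b -> - d <= Im z <= d -> cabs (K z) <= M.
  apply: ccont_bounded_rect => // z /andP[az _] _.
  have z0 := lt_le_trans a0 az; apply: ccontV.
    by rewrite expf_neq0// -cabs_gt0 -/(s z) s_gt0.
  by apply/ccontX/ccontD; [exact: ccont_id|exact: ccont_cst].
have b0 : 0 <= b by lra.
pose MV := b ^+ l * (MK * (MH + MK)).
have VM z : a <= Re z <= b -> - d <= Im z <= d -> 0 <= V z <= MV.
  move=> zx zy; have z0 : 0 < Re z by case/andP: zx => + _; exact: lt_le_trans.
  rewrite V_ge0//=; apply: ler_pM.
  - by rewrite exprn_ge0// ltW.
  - by rewrite mulr_ge0 ?addr_ge0 ?cabs_ge0.
  - by apply: lerXn2r; rewrite ?nnegrE ?(ltW z0)//; case/andP: zx.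
  - by apply: ler_pM; rewrite ?addr_ge0 ?cabs_ge0// ?HMK// lerD ?HMH ?HMK.
have rectP z : [&& a <= Re z, Re z <= b, - d <= Im z & Im z <= d] ->
    [/\ 0 < Re z, Re z <= b, a <= Re z <= b & - d <= Im z <= d].
  case/and4P => h1 h2 h3 h4; rewrite h1 h2 h3 h4; split=> //.
  exact: lt_le_trans h1.
pose M := C * b * MV + C * MV.
have out z : ~~ [&& a < Re z, Re z < b, - d < Im z & Im z < d] -> 0 < Re z ->
    cut m z = 0 /\ dcut m z = 0.
  move=> nz z0; apply: cut_out => //; rewrite leNgt; apply: contra nz => gm.
  have [h1 h2 h3] := gauge_box z0 gm.
  by move: h3; rewrite ltr_norml => /andP[h3 h4]; apply/and4P; split; lra.
have key z : [&& a <= Re z, Re z <= b, - d <= Im z & Im z <= d] ->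
    cabs (Psi m z) <= M /\ cabs (D m z) <= M.
  move=> /rectP[z0 zb zx zy]; have [h1 h2 _] := HC m z m0 z0.
  have /andP[V0 VMV] := VM z zx zy.
  have MV0 : 0 <= MV by exact: le_trans VMV.
  have CbV : 0 <= C * b * MV by exact: mulr_ge0 (mulr_ge0 C0 b0) MV0.
  have CV : 0 <= C * MV by exact: mulr_ge0.
  split.
    rewrite (le_trans h1)// (@le_trans _ _ (C * b * MV))// ?lerDl//.
    apply: ler_pM => //; first by rewrite mulr_ge0// ltW.
    by rewrite ler_wpM2l.
  rewrite (le_trans h2)// (@le_trans _ _ (C * MV))// ?lerDr//.
  by rewrite ler_wpM2l.
apply: (@green _ (Psi m) (D m) a b (- d) d M u v).
- exact: mPsi.
- exact: mD.
- by move=> z /key[].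
- by move=> z /key[].
- exact: au.
- exact: ub.
- by move: vn; rewrite ltr_norml => /andP[].
- by move: vn; rewrite ltr_norml => /andP[].
- move=> z /rectP[z0 _ _ _] zo.
  have {}zo : z <> o by move=> zE; apply: zo; rewrite zE /u /v; exact: complexP.
  by split; [exact: D_ccont|exact: Psi_wirtinger].
- move=> z nz; have [z0|z0] := boolP (0 < Re z); last exact: Psi_out.
  by rewrite /Psi (out z nz z0).1 mul0r.
- move=> z nz; have [z0|z0] := boolP (0 < Re z); last exact: D_out.
  by rewrite /D (out z nz z0).1 (out z nz z0).2 !mul0r mulr0 subrr.
Qed.

Let W (p : mR R * mR R) : R := wt l p * (cabs (K (pl p)) * (cabs (H (pl p)) + cabs (K (pl p)))).

Let W_int : rintegrable plane W.
Proof.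
have iH := (bergman_sqint bh).2; have iK := (sqint_kfun l w).2.
have mW : measurable_fun setT W.
  have mK := measurable_cabs (cmeas_kfun l w); have mH' := measurable_cabs mH.
  apply: measurable_realfun.measurable_funM; first exact: measurable_wt.
  apply: measurable_realfun.measurable_funM => //.
  exact: measurable_realfun.measurable_funD.
apply: rintegrable_le mW (rintegrableD iH (rintegrableZ 2 iK)) _ => p.
rewrite !cabs_lift2 ger0_norm; last first.
  by rewrite mulr_ge0 ?wt_ge0// mulr_ge0 ?addr_ge0 ?cabs_ge0.
rewrite -/K -/H [leRHS](_ : _ =
  wt l p * (cabs (H (pl p)) ^+ 2 + 2 * cabs (K (pl p)) ^+ 2)); last by ring.
rewrite ler_wpM2l ?wt_ge0//.
have := cabs_ge0 (H (pl p)); have := cabs_ge0 (K (pl p)).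
have := sqr_ge0 (cabs (H (pl p)) - cabs (K (pl p))); nra.
Qed.

Let VW p : 0 < (p.2 : R) -> V (pl p) = pi * W p.
Proof.
move=> p0; have pi0 : (pi : R) != 0 by rewrite gt_eqF// pi_gt0.
rewrite /W /V wt_in// -[Re (pl p)]/(p.2 : R).
by rewrite [RHS]mulrA (mulrC pi) mulfVK.
Qed.

Lemma inner_ker_eq0 : inner plane (lift l (zext h)) (lift l (zext (ker l w))) = 0.
Proof.
have [C C0 HC] := D_bound.
have K0 : cint plane (fun p => - (l.+1%:R / 2) * T (pl p)) = 0.
  apply: (@cint_dominated_eq0 _ _ _ plane (fun n p => D n.+1%:R (pl p)) _
      (fun p => C * (pi * W p))).
  - by move=> n; exact: mD.
  - by apply: cmeasM => //; exact: cmeas_cst.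
  - by do 2 apply: rintegrableZ; exact: W_int.
  - move=> n p; have [p0|p0] := boolP (0 < (p.2 : R)).
      by have [_ h2 _] := HC n.+1%:R (pl p) (ltr0Sn _ _) p0; rewrite -VW.
    rewrite D_out//= cabs0 mulr_ge0// mulr_ge0 ?pi_ge0//.
    by rewrite mulr_ge0 ?wt_ge0// mulr_ge0 ?addr_ge0 ?cabs_ge0.
  - move=> p; have [p0|p0] := boolP (0 < (p.2 : R)).
      exists (C * V (pl p) * gauge (pl p)) => n; rewrite mulNr opprK.
      by have [_ _] := HC n.+1%:R (pl p) (ltr0Sn _ _) p0.
    exists 0 => n; rewrite D_out// T_out// mulr0 subrr cabs0 mul0r//.
  - by move=> n; exact: cintD0.
have iW : cintegrable plane (fun p => T (pl p)).
  apply: cintegrable_le mT (rintegrableZ pi W_int) _ => p.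
  have [p0|p0] := boolP (0 < (p.2 : R)); first by rewrite -VW//; exact: T_le.
  rewrite /= T_out// cabs0 mulr_ge0 ?pi_ge0//.
  by rewrite mulr_ge0 ?wt_ge0// mulr_ge0 ?addr_ge0 ?cabs_ge0.
rewrite cintZ// in K0.
have T0 : cint plane (fun p => T (pl p)) = 0.
  move/eqP: K0; rewrite mulf_eq0 oppr_eq0 mulf_eq0 invr_eq0 !pnatr_eq0 /= => /eqP//.
rewrite lift_ker -[RHS](mulr0 (pi^-1)%:C) -T0 -cintZ//.
apply: eq_cint => p; rewrite lift_mulJ -/H -/K.
have [p0|p0] := boolP (0 < (p.2 : R)); last by rewrite T_out//= wt_out// mulr0 mul0r.
have -> : (wt l p)%:C = (pi^-1)%:C * xr (pl p) ^+ l.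
  by rewrite wt_in// rmorphM rmorphXn mulrC.
by rewrite -mulrA.
Qed.

End Orthogonality.

Section Reproducing.
Variables (R : realType) (l : nat).
Implicit Types (h k : Cplus R -> R[i]) (w v : Cplus R).
Local Notation plane := (plane R).
Local Notation L h := (lift l (zext h)).

Lemma ker_neq0 w v : ker l w v != 0.
Proof.
rewrite invr_eq0 expf_neq0//; apply: Re_neq0; apply: Re_addJ_gt0; exact: Cplus_gt0.
Qed.

Lemma ker_conj w v : cj (ker l w v) = ker l v w.
Proof. by rewrite /ker /kfun conjc_inv conjcX conjcD conjcK addrC. Qed.

Lemma ker_diag w : (2 * Re (val w))%:C ^+ l.+2 * ker l w w = 1.
Proof.
have x0 : 2 * (Re (val w))%:C != 0 :> R[i].
  by rewrite mulf_neq0 ?pnatr_eq0// eq_complex /= eqxx andbT gt_eqF// Cplus_gt0.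
by rewrite /ker /kfun addcJ rmorphM rmorph_nat divff// expf_neq0.
Qed.

Let kc w : R := (2 * Re (val w)) ^+ l.+2 * nsq plane (L (ker l w)).

(** Subtract from [h] the multiple of the kernel with the same value at [w]: the difference vanishes
    at [w], hence is orthogonal to the kernel. The factor [kc w] may still depend on [w]. *)
Let inner_ker h w : bergman l h -> inner plane (L h) (L (ker l w)) = (kc w)%:C * h w.
Proof.
move=> bh; have bk := bergman_ker l w.
have [a aE] : exists a, a = h w * (2 * Re (val w))%:C ^+ l.+2 by eexists.
have br := bergmanD bh (bergmanZ (- a) bk).
have r0 : h w + - a * ker l w w = 0 by rewrite aE mulNr -mulrA ker_diag mulr1 subrr.
have := inner_ker_eq0 br r0; rewrite liftD liftZ.
rewrite innerDl ?innerZl//; try exact: bergman_sqint; last first.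
  by apply: sqintZ; exact: bergman_sqint.
move/eqP; rewrite addr_eq0 => /eqP ->; rewrite mulNr opprK.
rewrite inner_self; last exact: bergman_sqint.
rewrite /kc aE -[LHS]mulrA [LHS]mulrC; congr (_ * _).
by rewrite [RHS]rmorphM rmorphXn.
Qed.

Let nsq_ker_gt0 w : 0 < nsq plane (L (ker l w)).
Proof.
have [mk ik] := bergman_sqint (bergman_ker l w).
pose A := rect (1 : R) 2 0 1.
pose N : R := 3 + Re (val w) + `|Im (val w)|.
have N0 : 0 < N by have := Cplus_gt0 w; have := normr_ge0 (Im (val w)); rewrite /N; lra.
(* On the unit square [A] the weight is at least [1 / pi] since [x > 1], and [|z + cj w| <= N]; so
   the integrand is at least [e] there. *)
pose e : R := pi^-1 * (N ^+ l.+2)^-1 ^+ 2.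
have e0 : 0 < e by rewrite mulr_gt0// ?invr_gt0 ?pi_gt0// exprn_gt0// invr_gt0 exprn_gt0.
have mA : measurable A by exact: measurable_rect.
have A1 : plane A = 1%:E.
  by rewrite /A plane_rect ?ler01// ?ler1n//; congr EFin; ring.
have i1 : rintegrable plane (\1_A : _ -> R).
  apply/integrableP; split; first by apply/measurable_EFinP; exact: measurable_indic.
  rewrite (eq_integral (fun p => (\1_A p)%:E)) => [|p _]; last by rewrite gee0_abs// lee_fin.
  by rewrite integral_indic// setIT [X in (X < _)%E]A1 ltry.
have iA : rintegrable plane (fun p => e * \1_A p) by exact: rintegrableZ.
have eA : \int[plane]_p (e * \1_A p) = e.
  by rewrite rintZ// /Rintegral integral_indic// setIT [X in fine X]A1 /= mulr1.
apply: lt_le_trans (e0) _; rewrite -eA; apply: (rint_le iA ik) => -[y x].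
rewrite cabs_lift2 indicE; case: (boolP ((y, x) \in A)) => [|_]; last first.
  by rewrite mulr0 mulr_ge0 ?sqr_ge0// wt_ge0.
rewrite inE => -[/=]; rewrite !in_itv/= => /andP[y0 y1] /andP[x1 x2].
have x0 : 0 < (x : R) by lra.
rewrite mulr1 wt_in// zextE /ker /kfun /= cabsV cabsX /e.
apply: ler_pM => //.
- by rewrite invr_ge0 pi_ge0.
- by rewrite sqr_ge0.
- by rewrite -[leLHS]mul1r ler_wpM2r ?invr_ge0 ?pi_ge0// exprn_ege1// ltW.
have s0 : 0 < cabs ((x +i* y) + cj (val w)).
  by rewrite cabs_gt0 Re_neq0// Re_addJ_gt0// Cplus_gt0.
rewrite ler_pXn2r ?nnegrE ?invr_ge0 ?exprn_ge0 ?cabs_ge0 ?(ltW N0)//.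
rewrite lef_pV2 ?posrE ?exprn_gt0//; apply: lerXn2r; rewrite ?nnegrE ?cabs_ge0 ?(ltW N0)//.
rewrite (le_trans (cabs_le _))// ReD ImD ReJ ImJ /=.
have w0 := Cplus_gt0 w.
have h1 : `|(x : R) + Re (val w)| <= 2 + Re (val w). by rewrite ger0_norm; lra.
have h2 : `|(y : R) - Im (val w)| <= 1 + `|Im (val w)|.
  by rewrite (le_trans (ler_normB _ _))// lerD2r ger0_norm// ltW.
by rewrite /N; lra.
Qed.

(** The inner product of the kernels at [w] and at 1, evaluated in both orders, shows that the
    factor at [w] equals the factor at 1. *)
Theorem reproducing : exists2 c : R, 0 < c & forall h w, bergman l h ->
  inner plane (L h) (L (ker l w)) = c%:C * h w.
Proof.
have one_gt0 : 0 < Re (1 : R[i]) by rewrite /= ltr01.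
pose one : Cplus R := exist _ 1 one_gt0.
exists (kc one).
  by apply: mulr_gt0; [rewrite exprn_gt0// mulr_gt0// Cplus_gt0|exact: nsq_ker_gt0].
move=> h w bh; rewrite (inner_ker w bh).
have e1 := inner_ker w (bergman_ker l one).
have e2 := inner_ker one (bergman_ker l w).
have e3 := inner_conj (bergman_sqint (bergman_ker l w)) (bergman_sqint (bergman_ker l one)).
have e4 (x : R) : cj (x%:C * ker l w one) = x%:C * ker l one w.
  by rewrite conjcM conjcR ker_conj.
have e := etrans (esym e1) (etrans e3 (etrans (congr1 (@conjc R) e2) (e4 _))).
by have /complexI -> := mulIf (ker_neq0 one w) e.
Qed.

Lemma nsq_eq0 h : bergman l h -> nsq plane (L h) = 0 -> h = fun=> 0.
Proof.
have [c c0 Hc] := reproducing; move=> bh h0; apply/funext => w.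
have bk := bergman_ker l w.
have := Hc h w bh; rewrite inner_conj; try exact: bergman_sqint.
rewrite inner_eq0 ?conjc0//; try exact: bergman_sqint.
move/esym/eqP; rewrite mulf_eq0 => /orP[|/eqP//].
by rewrite eq_complex /= eqxx andbT gt_eqF.
Qed.

End Reproducing.

(** * Translations and inversions *)

Section AdjointPairs.
Variables (R : realType) (l : nat).
Implicit Types (h k : Cplus R -> R[i]) (A B : (Cplus R -> R[i]) -> (Cplus R -> R[i])).
Local Notation plane := (plane R).
Local Notation leb := (leb R).
Local Notation L h := (lift l (zext h)).

Definition bounded_map A := (forall h, bergman l h -> bergman l (A h)) /\
  exists2 M : R, 0 <= M & forall h, bergman l h -> nsq plane (L (A h)) <= M * nsq plane (L h).

Definition adjoint_pair A B := [/\ bounded_map A, (forall h, bergman l h -> bergman l (B h)) &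
  forall h k, bergman l h -> bergman l k ->
    inner plane (L (A h)) (L k) = inner plane (L h) (L (B k))].

Lemma adjoint_pair_comp A B A' B' : adjoint_pair A B -> adjoint_pair A' B' ->
  adjoint_pair (A \o A') (B' \o B).
Proof.
move=> [[Ab [M M0 HM]] Bb AB] [[Ab' [M' M0' HM']] Bb' AB']; split.
- split=> [h bh|]; first exact/Ab/Ab'.
  exists (M * M'); first exact: mulr_ge0.
  move=> h bh; rewrite (le_trans (HM _ (Ab' _ bh)))// -mulrA ler_wpM2l//.
  exact: HM'.
- by move=> h bh; exact/Bb'/Bb.
- move=> h k bh bk; transitivity (inner plane (L (A' h)) (L (B k))).
    exact: (AB _ _ (Ab' _ bh) bk).
  exact: (AB' _ _ bh (Bb _ bk)).
Qed.

Lemma adjoint_pair_scale (d : R) : adjoint_pair (fun h w => d%:C * h w) (fun h w => d%:C * h w).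
Proof.
split.
- split=> [h|]; first exact: bergmanZ.
  exists (cabs d%:C ^+ 2); first exact: sqr_ge0.
  by move=> h bh; rewrite liftZ (nsqZ _ (bergman_sqint bh)).
- by move=> h; exact: bergmanZ.
- move=> h k /bergman_sqint bh /bergman_sqint bk.
  by rewrite !liftZ (innerZl _ bh bk) (innerZr _ bk bh) conjcR.
Qed.

Lemma eq_adjoint_pair A B A' B' :
  (forall h, bergman l h -> A h = A' h) -> (forall h, bergman l h -> B h = B' h) ->
  adjoint_pair A B -> adjoint_pair A' B'.
Proof.
move=> AA BB [[Ab [M M0 HM]] Bb AB]; split.
- split=> [h bh|]; first by have <- := AA h bh; exact: Ab.
  by exists M => // h bh; have <- := AA h bh; exact: HM.
- by move=> h bh; have <- := BB h bh; exact: Bb.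
- by move=> h k bh bk; have <- := AA h bh; have <- := BB k bk; exact: AB.
Qed.

Definition density h (p : mR R * mR R) : R := wt l p * cabs (zext h (pl p)) ^+ 2.

Lemma density_ge0 h p : 0 <= density h p.
Proof. by rewrite mulr_ge0 ?wt_ge0 ?sqr_ge0. Qed.

Lemma measurable_density h : analytic h -> measurable_fun setT (density h).
Proof.
move=> ah; apply: measurable_realfun.measurable_funM; first exact: measurable_wt.
exact/measurable_cabs2/cmeas_zext.
Qed.

Lemma density_out h (p : mR R * mR R) : ~~ (0 < (p.2 : R)) -> density h p = 0.
Proof. by move=> hp; rewrite /density wt_out// mul0r. Qed.

Lemma density_lift h p : cabs (L h p) ^+ 2 = density h p.
Proof. exact: cabs_lift2. Qed.

Lemma nsq_density h : bergman l h ->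
  (nsq plane (L h))%:E = (\int[plane]_p (density h p)%:E)%E.
Proof.
move=> bh; rewrite /nsq rintE; last by case: (bergman_sqint bh).
by apply: eq_integral => p _; rewrite density_lift.
Qed.

(** One inequality between extended integrals yields both membership and the norm bound, before [k]
    is known to be square-integrable. *)
Lemma bergman_le (C : R) h k : 0 <= C -> bergman l h -> analytic k ->
  (\int[plane]_p (density k p)%:E <= C%:E * \int[plane]_p (density h p)%:E)%E ->
  bergman l k /\ nsq plane (L k) <= C * nsq plane (L h).
Proof.
move=> C0 bh ak; rewrite -(nsq_density bh) => H.
have E : bergman_sqnorm l k = (\int[plane]_p (density k p)%:E)%E.
  by rewrite (sqnorm_lift _ ak); apply: eq_integral => p _; rewrite density_lift.
have bk : bergman l k.
  by split=> //; rewrite E (le_lt_trans H)// -EFinM ltry.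
by split=> //; move: H; rewrite -(nsq_density bk) -EFinM lee_fin.
Qed.

Lemma isometry_inner A (C : R) :
  (forall (a : R[i]) h k w, A (fun w => h w + a * k w) w = A h w + a * A k w) ->
  (forall h, bergman l h -> bergman l (A h)) ->
  (forall h, bergman l h -> nsq plane (L (A h)) = C * nsq plane (L h)) ->
  forall h k, bergman l h -> bergman l k ->
    inner plane (L (A h)) (L (A k)) = C%:C * inner plane (L h) (L k).
Proof.
move=> lin Ab AC h k bh bk.
apply: (polarization (bergman_sqint bh) (bergman_sqint bk)
  (bergman_sqint (Ab _ bh)) (bergman_sqint (Ab _ bk)) (AC _ bh) (AC _ bk)) => a.
have := AC _ (bergmanD bh (bergmanZ a bk)).
have -> : A (fun w => h w + a * k w) = fun w => A h w + a * A k w.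
  by apply/funext => w; exact: lin.
by rewrite !liftD !liftZ.
Qed.

End AdjointPairs.

Section Tonelli.
Variable R : realType.
Local Notation plane := (plane R).
Local Notation leb := (leb R).
Variable f : mR R * mR R -> R.
Hypothesis mf : measurable_fun setT f.
Hypothesis f0 : forall p, 0 <= f p.

Lemma plane_tonelli1 : (\int[plane]_p (f p)%:E = \int[leb]_y \int[leb]_x (f (y, x))%:E)%E.
Proof.
have mf' : measurable_fun setT (fun p => (f p)%:E) by exact/measurable_EFinP.
have f0' p : (0 <= (f p)%:E)%E by rewrite lee_fin.
by rewrite -(fubini_tonelli1 (fun p => (f p)%:E) mf' f0').
Qed.

Lemma plane_tonelli2 : (\int[plane]_p (f p)%:E = \int[leb]_x \int[leb]_y (f (y, x))%:E)%E.
Proof.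
have mf' : measurable_fun setT (fun p => (f p)%:E) by exact/measurable_EFinP.
have f0' p : (0 <= (f p)%:E)%E by rewrite lee_fin.
by rewrite plane_tonelli1 (fubini_tonelli (fun p => (f p)%:E) mf' f0').
Qed.

Lemma measurable_section1 : measurable_fun [set: mR R] (fun y => \int[leb]_x (f (y, x))%:E)%E.
Proof.
have mf' : measurable_fun setT (fun p => (f p)%:E) by exact/measurable_EFinP.
have f0' p : (0 <= (f p)%:E)%E by rewrite lee_fin.
exact: (measurable_fun_fubini_tonelli_F (fun p => (f p)%:E) mf' f0').
Qed.

End Tonelli.

Section Translations.
Variables (R : realType) (l : nat).
Implicit Types (h k : Cplus R -> R[i]).
Local Notation plane := (plane R).
Local Notation leb := (leb R).
Local Notation L h := (lift l (zext h)).

(** Through [zext] the formula makes sense for every [t]; it is a genuine translate when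
    [0 <= Re t]. *)
Definition tr (t : R[i]) h : Cplus R -> R[i] := fun w => zext h (val w + t).

Lemma zext_tr t h z : 0 < Re z -> zext (tr t h) z = zext h (z + t).
Proof. by move=> z0; rewrite zextE. Qed.

Lemma analytic_tr t h : 0 <= Re t -> analytic h -> analytic (tr t h).
Proof.
move=> t0 /analyticP ah; apply: (@analytic_ext _ _ (fun z => zext h (z + t))) => // z z0.
have zt : 0 < Re (z + t) by rewrite ReD ltr_pwDl.
have [A dh] := ah _ zt; exists (A * 1).
have dz := wirtingerD (wirtinger_id z) (wirtinger_cst t z); rewrite !addr0 in dz.
by have := @wirtinger_comp _ (zext h) (fun z => z + t) z _ _ _ dh dz; rewrite mulr0.
Qed.

Let mslice h y : analytic h ->
  measurable_fun [set: mR R] (fun x => (density l h (y, x))%:E).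
Proof.
move=> ah; apply/measurable_EFinP.
exact: (measurable_fun_pair2 (y : mR R) (measurable_density l ah)).
Qed.

Lemma density_tr_im (s : R) h : analytic h ->
  (\int[plane]_p (density l (tr (0 +i* s) h) p)%:E = \int[plane]_p (density l h p)%:E)%E.
Proof.
move=> ah; have ah' : analytic (tr (0 +i* s) h) by exact: analytic_tr.
rewrite !plane_tonelli1; try exact: measurable_density; try exact: density_ge0.
rewrite [RHS](@leb_affine R 1 s); last 3 first.
- exact: oner_neq0.
- by apply: measurable_section1; [exact: measurable_density|exact: density_ge0].
- by move=> y; apply: integral_ge0 => x _; rewrite lee_fin density_ge0.
rewrite normr1 mul1e; apply: eq_integral => y _; apply: eq_integral => x _.
have [x0|x0] := boolP (0 < (x : R)); last by rewrite !density_out.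
rewrite /density zext_tr//; congr (_ * cabs (zext h _) ^+ 2)%:E.
by apply: complexP => /=; rewrite ?addr0 ?mul1r.
Qed.

(** Moving to the right only increases the weight, [x ^ l <= (x + g) ^ l], and the image of the
    half-plane lies inside it. *)
Lemma density_tr_re (g : R) h : 0 <= g -> analytic h ->
  (\int[plane]_p (density l (tr g%:C h) p)%:E <= \int[plane]_p (density l h p)%:E)%E.
Proof.
move=> g0 ah; have ah' : analytic (tr g%:C h) by exact: analytic_tr.
rewrite !plane_tonelli1; try exact: measurable_density; try exact: density_ge0.
apply: ge0_le_integral => //.
- by move=> y _; apply: integral_ge0 => x _; rewrite lee_fin density_ge0.
- by apply: measurable_section1; [exact: measurable_density|exact: density_ge0].
- by apply: measurable_section1; [exact: measurable_density|exact: density_ge0].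
move=> y _; rewrite [leRHS](@leb_affine R 1 g); last 3 first.
- exact: oner_neq0.
- exact: mslice.
- by move=> x; rewrite lee_fin density_ge0.
rewrite normr1 mul1e; apply: ge0_le_integral => //.
- by move=> x _; rewrite lee_fin density_ge0.
- exact: mslice.
- apply/measurable_EFinP; apply: (@measurableT_comp _ _ _ _ _ _
    (fun x : mR R => density l h (y, x)) _ (fun x : mR R => (1 * x + g : mR R))).
    exact: (measurable_fun_pair2 (y : mR R) (measurable_density l ah)).
  apply: measurable_realfun.measurable_funD; last exact: measurable_cst.
  exact: (@mulrl_measurable R setT).
move=> x _; rewrite lee_fin.
have [x0|x0] := boolP (0 < (x : R)); last by rewrite density_out// density_ge0.
have xg : 0 < x + g by rewrite ltr_pwDl.
rewrite /density zext_tr// !wt_in ?mul1r//=.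
have -> : pl (y, x : mR R) + g%:C = pl (y, (x + g : mR R)).
  by apply: complexP => /=; rewrite ?addr0.
rewrite ler_wpM2r ?sqr_ge0// ler_wpM2r ?invr_ge0 ?pi_ge0//.
by rewrite lerXn2r ?nnegrE ?(ltW x0) ?(ltW xg)// lerDl.
Qed.

Lemma bounded_tr_re (g : R) : 0 <= g -> bounded_map l (tr g%:C).
Proof.
move=> g0; have H h : bergman l h ->
    bergman l (tr g%:C h) /\ nsq plane (L (tr g%:C h)) <= 1 * nsq plane (L h).
  move=> bh; have ah := bergman_analytic bh.
  apply: (bergman_le ler01 bh (@analytic_tr g%:C h g0 ah)).
  by rewrite mul1e; exact: density_tr_re.
by split=> [h bh|]; [exact: (H h bh).1|exists 1 => // h bh; exact: (H h bh).2].
Qed.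

Lemma bergman_tr_im (s : R) h : bergman l h ->
  bergman l (tr (0 +i* s) h) /\ nsq plane (L (tr (0 +i* s) h)) = nsq plane (L h).
Proof.
move=> bh; have ah := bergman_analytic bh.
have [b _] : bergman l (tr (0 +i* s) h) /\ nsq plane (L (tr (0 +i* s) h)) <= 1 * nsq plane (L h).
  apply: (bergman_le ler01 bh (@analytic_tr (0 +i* s) h (lexx 0) ah)).
  by rewrite mul1e density_tr_im.
split; first exact: b.
by have := nsq_density b; rewrite density_tr_im// -(nsq_density bh) => -[].
Qed.

Lemma tr_imK (s : R) h : tr (0 +i* s) (tr (0 +i* (- s)) h) = h.
Proof.
apply/funext => w; rewrite {1}/tr zext_tr; last by rewrite ReD addr0 Cplus_gt0.
have -> : val w + (0 +i* s) + (0 +i* (- s)) = val w.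
  by case: (val w) => a b; apply: complexP => /=; ring.
exact: zext_val.
Qed.

(** An invertible isometry has its inverse as adjoint: write [k] as the image of its inverse
    translate. *)
Lemma adjoint_tr_im (s : R) : adjoint_pair l (tr (0 +i* s)) (tr (0 +i* (- s))).
Proof.
split.
- split=> [h bh|]; first exact: (bergman_tr_im s bh).1.
  by exists 1 => // h bh; rewrite (bergman_tr_im s bh).2 mul1r.
- by move=> h bh; exact: (bergman_tr_im _ bh).1.
- move=> h k bh bk.
  have := @isometry_inner R l (tr (0 +i* s)) 1 _ _ _ h (tr (0 +i* (- s)) k) bh
    (bergman_tr_im (- s) bk).1.
  rewrite tr_imK mul1r; apply.
  + by move=> a h' k' w; rewrite /tr zextD zextZ.
  + by move=> h' bh'; exact: (bergman_tr_im s bh').1.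
  + by move=> h' bh'; rewrite (bergman_tr_im s bh').2 mul1r.
Qed.

End Translations.

Section Inversion.
Variables (R : realType) (l : nat).
Implicit Types (h k : Cplus R -> R[i]).
Local Notation plane := (plane R).
Local Notation leb := (leb R).
Local Notation L h := (lift l (zext h)).

(* The slopes [t = y / x] are integrated last: at a fixed slope the inversion
   acts on the abscissa by [x |-> A / x]. *)
Lemma plane_slopes (f : mR R * mR R -> R) : measurable_fun setT f ->
  (forall p, 0 <= f p) -> (forall p, ~~ (0 < (p.2 : R)) -> f p = 0) ->
  (\int[plane]_p (f p)%:E =
   \int[leb]_t \int[leb]_x (`|x| * f (x * t : mR R, x))%:E)%E.
Proof.
move=> mf f0 fout; pose q (p : mR R * mR R) : R := `|p.2 : R| * f ((p.2 : R) * p.1 : mR R, p.2).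
have m2 : measurable_fun [set: (mR R * mR R)%type] (fun p => p.2 : R) by exact: measurable_snd.
have m1 : measurable_fun [set: (mR R * mR R)%type] (fun p => p.1 : R) by exact: measurable_fst.
have mq : measurable_fun setT q.
  apply: measurable_realfun.measurable_funM.
    by apply: (measurableT_comp (@normr_measurable R setT)); exact: m2.
  apply: (measurableT_comp mf); apply: measurable_fun_pair; last exact: m2.
  by apply: measurable_realfun.measurable_funM; [exact: m2|exact: m1].
have q0 p : 0 <= q p by rewrite mulr_ge0.
rewrite (plane_tonelli2 mf f0) -[RHS](plane_tonelli1 mq q0) (plane_tonelli2 mq q0).
apply: eq_integral => x _; rewrite /q /=.
have [x0|x0] := boolP (0 < (x : R)); last first.
  by under eq_integral do rewrite (fout (_, x) x0); under [RHS]eq_integral do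
    rewrite (fout (_, x) x0) mulr0.
have ms : measurable_fun [set: mR R] (fun y => (f (y, x))%:E).
  by apply/measurable_EFinP; exact: (measurable_fun_pair1 (x : mR R) mf).
rewrite (@leb_affine R x 0) ?gt_eqF//; last by move=> y; rewrite lee_fin.
rewrite -ge0_integralZl//.
- by apply: eq_integral => t _; rewrite addr0.
- apply/measurable_EFinP.
  apply: (measurableT_comp (measurable_fun_pair1 (x : mR R) mf)
    (g := fun t : mR R => (x * t + 0 : mR R))).
  apply: measurable_realfun.measurable_funD; last exact: measurable_cst.
  exact: (@mulrl_measurable R setT).
- by move=> y _; rewrite lee_fin.
Qed.

Lemma integral_positive (f : R -> R) : (forall x, ~~ (0 < x) -> f x = 0) ->
  (\int[leb]_x (f x)%:E = \int[leb]_(x in `]0%R, +oo[) (f x)%:E)%E.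
Proof.
move=> f0; rewrite [RHS]integral_mkcond; apply: eq_integral => x _; rewrite patchE.
have -> : (x \in `]0, +oo[%classic) = (0 < x).
  by apply/idP/idP; rewrite inE/= in_itv/= andbT.
by case: ifPn => // /f0 ->.
Qed.

Definition invo (kappa : R) h : Cplus R -> R[i] :=
  fun w => (val w)^-1 ^+ l.+2 * zext h (kappa%:C * (val w)^-1).

Lemma zext_invo kappa h z : 0 < Re z ->
  zext (invo kappa h) z = z^-1 ^+ l.+2 * zext h (kappa%:C * z^-1).
Proof. by move=> z0; rewrite zextE. Qed.

Variable kappa : R.
Hypothesis kappa0 : 0 < kappa.

Lemma Re_kinv z : 0 < Re z -> 0 < Re (kappa%:C * z^-1).
Proof.
move=> z0; rewrite ReM /= mul0r subr0 Re_invc mulr_gt0// divr_gt0// exprn_gt0//.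
by rewrite cabs_gt0 Re_neq0.
Qed.

Lemma analytic_invo h : analytic h -> analytic (invo kappa h).
Proof.
move=> /analyticP ah.
apply: (@analytic_ext _ _ (fun z => z^-1 ^+ l.+2 * zext h (kappa%:C * z^-1))) => // z z0.
have [A dh] := ah _ (Re_kinv z0); have d1 := wirtinger_inv (Re_neq0 z0).
have d2 := wirtingerX l.+1 d1; have d3 := wirtingerZ kappa%:C d1.
rewrite mulr0 in d2; rewrite mulr0 in d3.
have d4 := @wirtinger_comp _ (zext h) (fun z => kappa%:C * z^-1) z _ _ _ dh d3.
have d5 := wirtingerM d2 d4; eexists; move: d5; congr wirtinger; rewrite !mulr0 mul0r addr0//.
Qed.

Let slope_cont h (t : R) : analytic h ->
  {in `]0, +oo[, continuous (fun x : R => kappa^-1 ^+ l.+2 *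
     (x * (x ^+ l / pi * cabs (zext h (x%:C * (1 +i* (- t)))) ^+ 2)))}.
Proof.
move=> ah x; rewrite in_itv/= andbT => x0.
have cc : (cabs (zext h (y%:C * (1 +i* (- t)))) : R^o) @[y --> x] -->
    (cabs (zext h (x%:C * (1 +i* (- t)))) : R^o).
  apply/cvgrPdist_lt => e e0.
  have z0 : 0 < Re (x%:C * (1 +i* (- t))) by rewrite ReM /= mulr1 mul0r subr0.
  have [d d0 Hd] := analytic_ccont ah z0 e0.
  pose m := 1 + cabs (1 +i* (- t) : R[i]).
  have m0 : 0 < m by rewrite /m ltr_pwDl// cabs_ge0.
  near=> y.
  have yx : `|x - y| < d / m by near: y; apply: cvgr_dist_lt; [exact: cvg_id|exact: divr_gt0].
  have lipc (a b : R[i]) : `|cabs a - cabs b| <= cabs (a - b).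
    have h1 : cabs a <= cabs (a - b) + cabs b by rewrite -{1}(subrK b a); exact: cabsD.
    have h2 : cabs b <= cabs (a - b) + cabs a.
      by rewrite -{1}(subrK a b) cabs_distC; exact: cabsD.
    by rewrite ler_norml; apply/andP; split; lra.
  rewrite distrC (le_lt_trans (lipc _ _))//; apply: Hd.
  rewrite -mulrBl cabsM -rmorphB cabsR distrC.
  rewrite (@le_lt_trans _ _ (`|x - y| * m))//; last by rewrite -ltr_pdivlMr.
  by rewrite ler_wpM2l// /m lerDr.
apply: cvgM; first exact: cvg_cst.
apply: cvgM; first exact: cvg_id.
apply: cvgM; first by apply: cvgM; [exact: exprn_continuous|exact: cvg_cst].
by under eq_fun do rewrite expr2; rewrite expr2; exact: cvgM.
Unshelve. all: by end_near. Qed.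

Lemma density_invo h : analytic h ->
  (\int[plane]_p (density l (invo kappa h) p)%:E =
   (kappa^-1 ^+ l.+2)%:E * \int[plane]_p (density l h p)%:E)%E.
Proof.
move=> ah; have ah' := analytic_invo ah.
rewrite (plane_slopes (measurable_density l ah') (density_ge0 l _)); last exact: density_out.
rewrite (plane_slopes (measurable_density l ah) (density_ge0 l _)); last exact: density_out.
pose Phi (t : R) : \bar R := (\int[leb]_x (`|x| * density l h (x * t : mR R, x))%:E)%E.
have mPhi : measurable_fun [set: mR R] Phi.
  have m2 : measurable_fun [set: (mR R * mR R)%type] (fun p => p.2 : R) by exact: measurable_snd.
  have m1 : measurable_fun [set: (mR R * mR R)%type] (fun p => p.1 : R) by exact: measurable_fst.
  apply: (@measurable_section1 R (fun p => `|p.2 : R| *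
      density l h ((p.2 : R) * p.1 : mR R, p.2))).
    apply: measurable_realfun.measurable_funM.
      by apply: (measurableT_comp (@normr_measurable R setT)); exact: m2.
    apply: (measurableT_comp (measurable_density l ah)).
    apply: measurable_fun_pair; last exact: m2.
    by apply: measurable_realfun.measurable_funM; [exact: m2|exact: m1].
  by move=> p; rewrite mulr_ge0// density_ge0.
have Phi0 t : (0 <= Phi t)%E.
  by apply: integral_ge0 => x _; rewrite lee_fin mulr_ge0// density_ge0.
(* Inversion reflects slopes: if [w] has slope [t], then [kappa / w] has slope [- t]. *)
have -> : (\int[leb]_t Phi t = \int[leb]_t Phi (- (t : R))%R)%E.
  rewrite (@leb_affine R (-1) 0 Phi) ?oppr_eq0 ?oner_neq0// normrN1 mul1e.
  by apply: eq_integral => t _; rewrite mulN1r addr0.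
have kp0 : 0 <= kappa^-1 ^+ l.+2 by rewrite exprn_ge0// invr_ge0 ltW.
rewrite -ge0_integralZl//; last first.
  by apply: (measurableT_comp mPhi); exact: (@oppr_measurable R setT).
apply: eq_integral => t _; rewrite /Phi.
rewrite integral_positive; last by move=> x x0; rewrite density_out// mulr0.
rewrite integral_positive; last by move=> x x0; rewrite density_out// mulr0.
pose D := 1 + t ^+ 2; have D0 : 0 < D by rewrite ltr_pwDl// sqr_ge0.
have AD : 0 < kappa / D by rewrite divr_gt0.
pose phi (x : R) := kappa^-1 ^+ l.+2 *
     (x * (x ^+ l / pi * cabs (zext h (x%:C * (1 +i* (- t)))) ^+ 2)).
have phi0 x : 0 < x -> 0 <= phi x.
  move=> x0; rewrite mulr_ge0// mulr_ge0 ?(ltW x0)// mulr_ge0 ?sqr_ge0//.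
  by rewrite divr_ge0 ?pi_ge0// exprn_ge0// ltW.
transitivity (\int[leb]_(x in `]0%R, +oo[) (phi x)%:E)%E; last first.
  rewrite -ge0_integralZl//; last 2 first.
  - apply/measurable_EFinP/measurable_funTS.
    apply: measurable_realfun.measurable_funM; first exact: (@normr_measurable R setT).
    apply: (measurableT_comp (measurable_density l ah)
      (g := fun x : mR R => (x * - t : mR R, x))).
    apply: measurable_fun_pair; last exact: measurable_id.
    exact: (@mulrr_measurable R setT).
  - by move=> x _; rewrite lee_fin mulr_ge0// density_ge0.
  apply: eq_integral => x; rewrite inE/= in_itv/= andbT => x0.
  rewrite -EFinM /phi /density wt_in//= gtr0_norm//.
  congr (_ * (_ * (_ * cabs (zext h _) ^+ 2)))%:E.
  by apply: complexP => /=; ring.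
(* On the ray of slope [t], the abscissa of [kappa / w] is [(kappa / D) / x]. *)
rewrite (leb_inversion AD (@slope_cont h t ah) phi0).
apply: eq_integral => x; rewrite inE/= in_itv/= andbT => x0; congr EFin.
have x_neq0 : x != 0 by rewrite gt_eqF.
have D_neq0 : D != 0 by rewrite gt_eqF.
have k_neq0 : kappa != 0 by rewrite gt_eqF.
rewrite /density zext_invo//= wt_in//= gtr0_norm// /phi.
set w := x +i* (x * t).
have w2 : cabs w ^+ 2 = x ^+ 2 * D by rewrite sqr_cabs /= /D; ring.
have -> : kappa%:C * w^-1 = (kappa / D / x)%:C * (1 +i* (- t)).
  apply: complexP; rewrite ?ReM ?ImM ?Re_invc ?Im_invc w2 /=; field; rewrite ?x_neq0 ?D_neq0//.
have -> : cabs (w^-1 ^+ l.+2 * zext h ((kappa / D / x)%:C * (1 +i* (- t)))) ^+ 2 =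
    (x ^+ 2 * D)^-1 ^+ l.+2 * cabs (zext h ((kappa / D / x)%:C * (1 +i* (- t)))) ^+ 2.
  by rewrite cabsM cabsX cabsV exprMn exprAC (exprVn (cabs w)) w2.
move: (cabs _ ^+ 2) => c.
have sp (u : R) : u ^+ l.+2 = u * u * u ^+ l by rewrite !exprS mulrA.
rewrite !sp !expr_div_n !exprVn exprMn exprAC.
have xl : x ^+ l != 0 by rewrite expf_neq0.
have Dl : D ^+ l != 0 by rewrite expf_neq0.
have kl : kappa ^+ l != 0 by rewrite expf_neq0.
have pi0 : (pi : R) != 0 by rewrite gt_eqF// pi_gt0.
move: (x ^+ l) xl (D ^+ l) Dl (kappa ^+ l) kl (pi : R) pi0 => X xl E Dl K kl p pi0.
move: D D_neq0 {w w2 D0 AD phi phi0} => D D_neq0.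
by field; rewrite ?x_neq0 ?D_neq0 ?k_neq0 ?xl ?Dl ?kl ?pi0.
Qed.

Lemma bergman_invo h : bergman l h -> bergman l (invo kappa h) /\
  nsq plane (L (invo kappa h)) = kappa^-1 ^+ l.+2 * nsq plane (L h).
Proof.
move=> bh; have ah := bergman_analytic bh.
have kp0 : 0 <= kappa^-1 ^+ l.+2 by rewrite exprn_ge0// invr_ge0 ltW.
have [b _] : bergman l (invo kappa h) /\
    nsq plane (L (invo kappa h)) <= kappa^-1 ^+ l.+2 * nsq plane (L h).
  apply: (bergman_le kp0 bh (analytic_invo ah)).
  by rewrite density_invo.
split; first exact: b.
by have := nsq_density b; rewrite density_invo// -(nsq_density bh) -EFinM => -[].
Qed.

Lemma invoK h : invo kappa (invo kappa h) = fun w => (kappa^-1 ^+ l.+2)%:C * h w.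
Proof.
apply/funext => w; have w0 := Cplus_gt0 w; rewrite {1}/invo zext_invo; last exact: Re_kinv.
have kC : (kappa%:C : R[i]) != 0 by rewrite -cabs_gt0 cabsR gtr0_norm.
have wC : val w != 0 by rewrite Re_neq0.
have -> : kappa%:C * (kappa%:C * (val w)^-1)^-1 = val w.
  by rewrite invfM invrK mulrA mulfV// mul1r.
have e : (val w)^-1 * (kappa%:C * (val w)^-1)^-1 = (kappa^-1)%:C.
  by rewrite invfM invrK mulrCA mulVf// mulr1 -fmorphV.
by rewrite zext_val mulrA -exprMn e rmorphXn.
Qed.

(** The inversion multiplies inner products by [kappa^-1 ^+ l.+2], and its square is multiplication
    by the same scalar; applying the first fact to [h] and the inverted [k] and cancelling gives the
    symmetry. *)
Lemma adjoint_invo : adjoint_pair l (invo kappa) (invo kappa).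
Proof.
have bI h (bh : bergman l h) := (bergman_invo bh).1.
have nI h (bh : bergman l h) := (bergman_invo bh).2.
have kp0 : 0 < kappa^-1 ^+ l.+2 by rewrite exprn_gt0// invr_gt0.
split; [split; first exact: bI|exact: bI|].
  by exists (kappa^-1 ^+ l.+2) => [|h bh]; [exact: ltW|rewrite nI].
move=> h k bh bk.
have lin (a : R[i]) h' k' w : invo kappa (fun w => h' w + a * k' w) w =
    invo kappa h' w + a * invo kappa k' w.
  by rewrite /invo zextD zextZ mulrDr mulrCA.
have := isometry_inner lin bI nI bh (bI k bk).
rewrite invoK liftZ (innerZr _ (bergman_sqint bk) (bergman_sqint (bI h bh))) conjcR.
apply: mulfI; rewrite -cabs_gt0 cabsR gtr0_norm//.
Qed.

End Inversion.

(** * Symmetry of real translations *)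

Section Fubini.
Context d1 d2 (T1 : measurableType d1) (T2 : measurableType d2) (R : realType).
Variables (m1 : {sigma_finite_measure set T1 -> \bar R})
  (m2 : {sigma_finite_measure set T2 -> \bar R}).

(** The inner integrals are real numbers, the finite parts of extended ones, so every section is
    assumed integrable; [V] supplies the absolute convergence. *)
Lemma rint_swap (f : T1 * T2 -> R) (V : T1 -> R) : measurable_fun setT f ->
  (forall x, rintegrable m2 (fun y => f (x, y))) ->
  (forall y, rintegrable m1 (fun x => f (x, y))) ->
  rintegrable m1 V -> (forall x, \int[m2]_y `|f (x, y)| <= V x) ->
  \int[m1]_x \int[m2]_y f (x, y) = \int[m2]_y \int[m1]_x f (x, y).
Proof.
move=> mf i2 i1 iV fV.
have mf' : measurable_fun setT (EFin \o f) by exact/measurable_EFinP.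
have ilt : (\int[m1]_x \int[m2]_y `|(EFin \o f) (x, y)| < +oo)%E.
  have /integrableP[_] := iV.
  apply: le_lt_trans; apply: ge0_le_integral => //.
  - by move=> x _; exact: integral_ge0.
  - apply: (measurable_fun_fubini_tonelli_F (fun z => `|(EFin \o f) z|%E)) => //.
    exact: measurableT_comp.
  - by apply: measurableT_comp => //; exact: measurable_int iV.
  move=> x _; rewrite -[leLHS]/(\int[m2]_y (`|f (x, y)|)%:E)%E.
  rewrite -rintE; last exact: rintegrable_norm.
  by rewrite lee_fin (le_trans (fV x))// ler_norm.
have i12 := (integrable12ltyP m1 m2 mf').2 ilt.
rewrite /Rintegral; congr fine.
transitivity (\int[m1]_x \int[m2]_y (EFin \o f) (x, y))%E.
  by apply: eq_integral => x _; rewrite -rintE.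
rewrite (Fubini i12).
by apply: eq_integral => y _; rewrite -rintE.
Qed.

Lemma cint_swap (G : T1 * T2 -> R[i]) (V : T1 -> R) : cmeas G ->
  (forall x, cintegrable m2 (fun y => G (x, y))) ->
  (forall y, cintegrable m1 (fun x => G (x, y))) ->
  rintegrable m1 V -> (forall x, \int[m2]_y cabs (G (x, y)) <= V x) ->
  cint m1 (fun x => cint m2 (fun y => G (x, y))) =
  cint m2 (fun y => cint m1 (fun x => G (x, y))).
Proof.
move=> [mR mI] i2 i1 iV GV; apply: complexP => /=.
- apply: (rint_swap mR _ _ iV) => [x|y|x]; first exact: (i2 x).1.
    exact: (i1 y).1.
  apply: le_trans (GV x); apply: rint_le => [||y]; last exact: absRe_le.
    exact/rintegrable_norm/(i2 x).1.
  exact/cintegrable_cabs/i2.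
- apply: (rint_swap mI _ _ iV) => [x|y|x]; first exact: (i2 x).2.
    exact: (i1 y).2.
  apply: le_trans (GV x); apply: rint_le => [||y]; last exact: absIm_le.
    exact/rintegrable_norm/(i2 x).2.
  exact/cintegrable_cabs/i2.
Qed.

End Fubini.

Section Damping.
Variables (R : realType) (l : nat).
Implicit Types (h k : Cplus R -> R[i]).
Local Notation plane := (plane R).
Local Notation L h := (lift l (zext h)).

Lemma holder2 d (T : measurableType d) (mu : {measure set T -> \bar R}) (F G : T -> R[i]) :
  sqint mu F -> sqint mu G ->
  (\int[mu]_t (cabs (F t) * cabs (G t))) ^+ 2 <= nsq mu F * nsq mu G.
Proof.
have E (H : T -> R[i]) t : cabs (cabs (H t))%:C = cabs (H t).
  by rewrite cabsR ger0_norm// cabs_ge0.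
have S (H : T -> R[i]) : sqint mu H -> sqint mu (fun t => (cabs (H t))%:C).
  move=> [mH iH]; split; first exact/cmeasR/measurable_cabs.
  by under eq_fun do rewrite E.
have N (H : T -> R[i]) : nsq mu (fun t => (cabs (H t))%:C) = nsq mu H.
  by apply: eq_Rintegral => t _; rewrite E.
move=> hF hG; have := cauchy_schwarz (S _ hF) (S _ hG); rewrite !N; apply: le_trans.
have -> : inner mu (fun t => (cabs (F t))%:C) (fun t => (cabs (G t))%:C) =
    (\int[mu]_t (cabs (F t) * cabs (G t)))%:C.
  apply: complexP => /=; first by apply: eq_Rintegral => t _; rewrite oppr0 mulr0 subr0.
  transitivity (\int[mu]_t (0 : R)).
    by apply: eq_Rintegral => t _; rewrite oppr0 mulr0 mul0r addr0.
  by rewrite Rintegral_cst// mul0r.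
by rewrite cabsR real_normK// num_real.
Qed.

(** The factor is holomorphic on the half-plane for [0 <= e], has modulus at most 1 and tends to 1
    with [e]; for fixed [e > 0] its square decays integrably in the imaginary direction. *)
Definition damp (e : R) h : Cplus R -> R[i] := fun w => (1 + e%:C * val w)^-1 * h w.

Lemma zext_damp e h z : 0 < Re z -> zext (damp e h) z = (1 + e%:C * z)^-1 * zext h z.
Proof. by move=> z0; rewrite !zextE. Qed.

Lemma damp_ge1 (e : R) z : 0 <= e -> 0 < Re z -> 1 <= cabs (1 + e%:C * z).
Proof.
move=> e0 z0; apply: le_trans (absRe_le _); apply: le_trans (ler_norm _).
by rewrite ReD ReM /= mul0r subr0 lerDl mulr_ge0// ltW.
Qed.

Lemma damp_decay (e : R) z : 0 < e -> e <= 1 -> 0 < Re z ->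
  cabs (1 + e%:C * z)^-1 ^+ 2 <= 4 / e ^+ 2 * decay (Im z).
Proof.
move=> e0 e1 z0; have D1 := damp_ge1 (ltW e0) z0.
have D2 : e * `|Im z| <= cabs (1 + e%:C * z).
  apply: le_trans (absIm_le _).
  by rewrite ImD ImM /= mul0r addr0 add0r normrM (gtr0_norm e0).
have D3 : e * (1 + `|Im z|) <= 2 * cabs (1 + e%:C * z) by rewrite mulrDr mulr1; lra.
have i0 : 0 < 1 + `|Im z| by rewrite ltr_pwDl.
have D0 : 0 < cabs (1 + e%:C * z) by rewrite (lt_le_trans _ D1).
rewrite /decay cabsV -expr2 exprVn -exprVn.
rewrite (_ : 4 / e ^+ 2 * _ = (2 / (e * (1 + `|Im z|))) ^+ 2); last first.
  by field; rewrite !gt_eqF.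
rewrite ler_pXn2r ?nnegrE ?invr_ge0 ?(ltW D0) ?divr_ge0 ?mulr_ge0 ?(ltW e0) ?(ltW i0)//.
by rewrite ler_pdivlMr ?mulr_gt0// mulrC ler_pdivrMr.
Qed.

Lemma damp_dist (e : R) z : 0 <= e -> 0 < Re z ->
  cabs ((1 + e%:C * z)^-1 - 1) <= e * cabs z.
Proof.
move=> e0 z0; have D1 := damp_ge1 e0 z0.
have D0 : 1 + e%:C * z != 0 by rewrite -cabs_gt0 (lt_le_trans _ D1).
have -> : (1 + e%:C * z)^-1 - 1 = - (e%:C * z) / (1 + e%:C * z) by field.
rewrite cabsM cabsN cabsM cabsR ger0_norm// cabsV.
by rewrite ler_piMr ?mulr_ge0 ?cabs_ge0// invf_le1 ?(lt_le_trans _ D1).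
Qed.

Lemma analytic_damp (e : R) h : 0 <= e -> analytic h -> analytic (damp e h).
Proof.
move=> e0 /analyticP ah.
apply: (@analytic_ext _ _ (fun z => (1 + e%:C * z)^-1 * zext h z)) => [w|z z0].
  by rewrite zext_val.
have [A dh] := ah z z0.
have D0 : 1 + e%:C * z != 0 by rewrite -cabs_gt0 (lt_le_trans _ (damp_ge1 e0 z0)).
have d1 := wirtingerD (wirtinger_cst 1 z) (wirtingerZ e%:C (wirtinger_id z)).
have d2 := wirtingerM (@wirtingerV _ (fun z => 1 + e%:C * z) z _ _ D0 d1) dh.
by eexists; move: d2; congr wirtinger; rewrite !(mulr0, addr0, mul0r).
Qed.

Lemma bergman_damp (e : R) h : 0 <= e -> bergman l h -> bergman l (damp e h).
Proof.
move=> e0 bh; have ah := bergman_analytic bh; have ad := analytic_damp e0 ah.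
apply: (bergman_le ler01 bh ad _).1; rewrite mul1e; apply: ge0_le_integral => //.
- by move=> p _; rewrite lee_fin density_ge0.
- by apply/measurable_EFinP; exact: measurable_density.
- by apply/measurable_EFinP; exact: measurable_density.
move=> p _; rewrite lee_fin.
have [p0|p0] := boolP (0 < (p.2 : R)); last by rewrite !density_out.
rewrite /density zext_damp// cabsM exprMn ler_wpM2l ?wt_ge0//.
rewrite ler_piMl ?sqr_ge0// expr_le1 ?cabs_ge0// cabsV.
by have D1 := @damp_ge1 e (pl p) e0 p0; rewrite invf_le1 ?(lt_le_trans _ D1).
Qed.

End Damping.

Lemma cmeas_comp d1 d2 (T1 : measurableType d1) (T2 : measurableType d2) (R : realType)
    (F : T2 -> R[i]) (phi : T1 -> T2) : cmeas F -> measurable_fun setT phi ->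
  cmeas (fun t => F (phi t)).
Proof.
by move=> [mr mi] mp; split; [exact: measurableT_comp mr mp|exact: measurableT_comp mi mp].
Qed.

Section RealTranslations.
Variables (R : realType) (l : nat).
Implicit Types (h k : Cplus R -> R[i]).
Local Notation plane := (plane R).
Local Notation L h := (lift l (zext h)).

Lemma nsq_ker (c : R) : (forall h w, bergman l h ->
    inner plane (L h) (L (ker l w)) = c%:C * h w) ->
  forall w : Cplus R, nsq plane (L (ker l w)) = c / (2 * Re (val w)) ^+ l.+2.
Proof.
move=> Hc w; have bk := bergman_ker l w.
have x0 : (2 * Re (val w)) ^+ l.+2 != 0 by rewrite expf_neq0// gt_eqF// mulr_gt0// Cplus_gt0.
have := Hc _ w bk; rewrite inner_self; last exact: bergman_sqint.
move=> /(congr1 (fun z => (2 * Re (val w))%:C ^+ l.+2 * z)).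
rewrite [RHS]mulrCA ker_diag mulr1 -rmorphXn -rmorphM => /complexI <-.
by rewrite mulrAC mulfV// mul1r.
Qed.

Variable g : R.
Hypothesis g0 : 0 < g.

Let shifted_gt0 (p : mR R * mR R) : 0 < (p.2 : R) -> 0 < Re (pl p + g%:C).
Proof. by move=> p0; rewrite ReD addr_gt0. Qed.

Let shifted (p : mR R * mR R) (p0 : 0 < (p.2 : R)) : Cplus R :=
  exist _ (pl p + g%:C) (shifted_gt0 p0).

Let L_tr h (p : mR R * mR R) (p0 : 0 < (p.2 : R)) :
  L (tr g%:C h) p = (Num.sqrt (wt l p))%:C * h (shifted p0).
Proof. by rewrite /lift zext_tr// (zextE h (shifted_gt0 p0)). Qed.

Let kern (p q : mR R * mR R) : R[i] := lift l (kfun l (pl p + g%:C)) q.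

(** Both sides involve only [p + cj q + g]: translating one argument of the kernel by a real number
    or the other amounts to the same. *)
Let kern_swap p q :
  (Num.sqrt (wt l p))%:C * cj (kern p q) = (Num.sqrt (wt l q))%:C * kern q p.
Proof.
rewrite /kern /lift conjcM conjcR mulrCA; congr (_ * (_ * _)).
rewrite /kfun conjc_inv conjcX conjcD conjcK conjcD conjcR; congr ((_ ^+ _)^-1); ring.
Qed.

Let L_kern p (p0 : 0 < (p.2 : R)) : L (ker l (shifted p0)) = kern p.
Proof. exact: lift_ker. Qed.

Let cmeas_kern : cmeas (fun pq => kern pq.1 pq.2).
Proof.
have m1 : measurable_fun setT (fst : (mR R * mR R) * (mR R * mR R) -> _) by exact: measurable_fst.
have m2 : measurable_fun setT (snd : (mR R * mR R) * (mR R * mR R) -> _) by exact: measurable_snd.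
have c1 : cmeas (fun pq : (mR R * mR R) * (mR R * mR R) => pl pq.1).
  exact: cmeas_comp (cmeas_pl R) m1.
have c2 : cmeas (fun pq : (mR R * mR R) * (mR R * mR R) => pl pq.2).
  exact: cmeas_comp (cmeas_pl R) m2.
apply: cmeasM.
  apply: cmeasR; apply: (@measurableT_comp _ _ _ _ _ _ (@Num.sqrt R)).
    by apply: continuous_measurable_fun; exact: sqrt_continuous.
  exact: measurableT_comp (measurable_wt l) m2.
apply/cmeasV/cmeasX/cmeasD => //; apply/cmeasJ/cmeasD => //; exact: cmeas_cst.
Qed.

(** By [nsq_ker] the quantity is a constant times [x ^ l / (x + g) ^ (l + 2)]. The shift by [g > 0]
    keeps it bounded near the boundary, where it would otherwise behave like [x ^ (- 2)]. *)
Let kern_integrable : exists2 C, 0 <= C & forall (p : mR R * mR R), 0 < (p.2 : R) ->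
  sqint plane (kern p) /\ wt l p * nsq plane (kern p) <= C * decay (p.2 : R).
Proof.
have [c c0 Hc] := reproducing R l.
exists (c / pi * (1 + g^-1) ^+ 2) => [|p p0].
  by rewrite mulr_ge0 ?sqr_ge0// divr_ge0 ?pi_ge0// ltW.
rewrite -(L_kern p0); split; first exact/bergman_sqint/bergman_ker.
rewrite (nsq_ker Hc) wt_in//= /decay; case: p p0 => y x /= x0; move: (x : R) x0 => {}x x0.
have xg : 0 < x + g by rewrite addr_gt0.
have xg2 : 0 < 2 * (x + g) by rewrite mulr_gt0.
have gi : 0 < g^-1 by rewrite invr_gt0.
have x1 : 0 < 1 + x by rewrite addr_gt0.
have pi0 := pi_gt0 R.
rewrite gtr0_norm// !exprS.
have h1 : x ^+ l / (2 * (x + g)) ^+ l <= 1.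
  rewrite ler_pdivrMr ?exprn_gt0// mul1r; apply: lerXn2r; rewrite ?nnegrE; try exact: ltW.
  by move: x0 g0; lra.
have h2 : (2 * (x + g))^-1 <= (1 + g^-1) / (1 + x).
  rewrite ler_pdivlMr// mulrC ler_pdivrMr//.
  have : 1 = g^-1 * g by rewrite mulVf ?gt_eqF.
  have := mulr_gt0 gi x0; nra.
have h20 : 0 <= (2 * (x + g))^-1 by rewrite invr_ge0 ltW.
have h3 := ler_pM h20 h20 h2 h2.
have h4 : 0 <= (2 * (x + g))^-1 * (2 * (x + g))^-1 by rewrite mulr_ge0.
have h5 : 0 <= x ^+ l / (2 * (x + g)) ^+ l by rewrite divr_ge0 ?exprn_ge0 ?ltW.
have h6 := ler_pM h5 h4 h1 h3.
have cp : 0 < c / pi by rewrite divr_gt0.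
have := ler_wpM2l (ltW cp) h6.
have e1 : (2 * (x + g)) ^+ l != 0 by rewrite expf_neq0// gt_eqF.
have e2 : x + g != 0 by rewrite gt_eqF.
have e3 : 1 + x != 0 by rewrite gt_eqF.
have e4 : (pi : R) != 0 by rewrite gt_eqF.
have e5 : g != 0 by rewrite gt_eqF.
move: e1 e4; move: (_ ^+ l) (x ^+ l) (pi : R) => P X p e1 e4.
set a := (X in X <= _ -> _); set b := (X in _ <= X -> _).
set a' := (X in _ -> X <= _); set b' := (X in _ -> _ <= X).
rewrite (_ : a' = a); last by rewrite /a /a'; field; rewrite ?e1 ?e2 ?e4.
by rewrite (_ : b' = b)//; rewrite /b /b' mul1r; field; rewrite ?e3 ?e4 ?e5.
Qed.

(* Reproduce [h] at the translated points and exchange the two integrals; the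
   damping makes the double integral absolutely convergent. *)
Lemma inner_tr_damp (e : R) h k : 0 < e -> e <= 1 -> bergman l h -> bergman l k ->
  inner plane (L (tr g%:C h)) (L (damp e k)) = inner plane (L h) (L (tr g%:C (damp e k))).
Proof.
move=> e0 e1 bh bk; have [c c0 Hc] := reproducing R l.
have cC : (c%:C : R[i]) != 0 by rewrite -cabs_gt0 cabsR gtr0_norm.
have bd := bergman_damp (ltW e0) bk; have sh := bergman_sqint bh.
have sd := bergman_sqint bd; have sk := bergman_sqint bk.
have [bT _] := bounded_tr_re l (ltW g0).
have [C C0 HC] := kern_integrable.
pose G (pq : (mR R * mR R) * (mR R * mR R)) : R[i] :=
  ((Num.sqrt (wt l pq.1))%:C * cj (L (damp e k) pq.1)) *
  (L h pq.2 * cj (kern pq.1 pq.2)).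
have Gout p q : ~~ (0 < (p.2 : R)) -> G (p, q) = 0.
  by move=> p0; rewrite /G /= wt_out// sqrtr0 !mul0r.
have iG1 p : cintegrable plane (fun q => G (p, q)).
  have [p0|p0] := boolP (0 < (p.2 : R)).
    exact: (cintegrableZ ((Num.sqrt (wt l p))%:C * cj (L (damp e k) p))
      (sqint_mulJ sh (HC p p0).1)).
  have := cintegrableZ 0 (sqint_mulJ sh sh); congr cintegrable.
  by apply/funext => q; rewrite Gout// mul0r.
have G2 p q : G (p, q) = ((Num.sqrt (wt l q))%:C * L h q) * cj (L (damp e k) p * cj (kern q p)).
  transitivity ((Num.sqrt (wt l p))%:C * cj (kern p q) * (L h q * cj (L (damp e k) p))).
    by rewrite /G [(p, q).1]/= [(p, q).2]/=; ring.
  by rewrite kern_swap conjcM conjcK; ring.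
have iG2 q : cintegrable plane (fun p => G (p, q)).
  rewrite (funext (fun p => G2 p q)).
  have [q0|q0] := boolP (0 < (q.2 : R)).
    exact: (cintegrableZ ((Num.sqrt (wt l q))%:C * L h q)
      (cintegrableJ (sqint_mulJ sd (HC q q0).1))).
  have := cintegrableZ 0 (sqint_mulJ sh sh); congr cintegrable.
  by apply/funext => p; rewrite wt_out// sqrtr0 !mul0r.
have mG : cmeas G.
  have m1 : measurable_fun setT (fst : (mR R * mR R) * (mR R * mR R) -> _) by exact: measurable_fst.
  have m2 : measurable_fun setT (snd : (mR R * mR R) * (mR R * mR R) -> _) by exact: measurable_snd.
  apply: cmeasM; apply: cmeasM; last exact: cmeasJ.
  - apply: cmeasR; apply: (@measurableT_comp _ _ _ _ _ _ (@Num.sqrt R)).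
      by apply: continuous_measurable_fun; exact: sqrt_continuous.
    exact: measurableT_comp (measurable_wt l) m1.
  - by apply: cmeasJ; exact: cmeas_comp sd.1 m1.
  - exact: cmeas_comp sh.1 m2.
(* The integral of [|G|] in the second point is a product [X * Y] with [X = |L k p|], hence at most
   [X ^ 2 + Y ^ 2]. Cauchy-Schwarz bounds [Y ^ 2]: the damping gives the decay in the ordinate, the
   shifted kernel that in the abscissa. *)
pose V (p : mR R * mR R) : R := cabs (L k p) ^+ 2 +
  nsq plane (L h) * (4 / e ^+ 2) * C * (decay (p.1 : R) * decay (p.2 : R)).
have iV : rintegrable plane V.
  by apply: rintegrableD; [case: sk|apply: rintegrableZ; exact: decay2_integrable].
have GV p : \int[plane]_q cabs (G (p, q)) <= V p.
  have d1 := ltW (decay_gt0 (p.1 : R)); have d2 := ltW (decay_gt0 (p.2 : R)).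
  have V0 : 0 <= nsq plane (L h) * (4 / e ^+ 2) * C * (decay (p.1 : R) * decay (p.2 : R)).
    by rewrite !mulr_ge0 ?nsq_ge0 ?invr_ge0 ?sqr_ge0.
  have [p0|p0] := boolP (0 < (p.2 : R)); last first.
    rewrite (_ : \int[plane]_q cabs (G (p, q)) = \int[plane]_q (0 : R)).
      by rewrite Rintegral_cst// mul0r addr_ge0 ?sqr_ge0.
    by apply: eq_Rintegral => q _; rewrite Gout// cabs0.
  have [sp nk] := HC p p0.
  set r := Num.sqrt (wt l p); have r0 : 0 <= r by exact: sqrtr_ge0.
  set m := cabs (1 + e%:C * pl p)^-1; have m0 : 0 <= m by exact: cabs_ge0.
  set X := cabs (L k p).
  have iS : rintegrable plane (fun q => cabs (L h q) * cabs (kern p q)).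
    have := cintegrable_cabs (sqint_mulJ sh sp).
    by apply: eq_rintegrable => q; rewrite cabsM cabsJ.
  set S := \int[plane]_q (cabs (L h q) * cabs (kern p q)).
  have -> : \int[plane]_q cabs (G (p, q)) = r * (m * X) * S.
    rewrite -rintZ//; apply: eq_Rintegral => q _; rewrite /G [(p, q).1]/= [(p, q).2]/=.
    rewrite (cabsM (_ * _) (_ * _)) (cabsM (L h q)) cabsJ; congr (_ * _).
    rewrite (cabsM _%:C) cabsR cabsJ ger0_norm//; congr (_ * _).
    by rewrite /lift zext_damp// mulrCA cabsM.
  have hS : S ^+ 2 <= nsq plane (L h) * nsq plane (kern p) := holder2 sh sp.
  have hm : m ^+ 2 <= 4 / e ^+ 2 * decay (p.1 : R) := @damp_decay R e (pl p) e0 e1 p0.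
  have r2 : r ^+ 2 = wt l p by rewrite sqr_sqrtr ?wt_ge0.
  have hr : r ^+ 2 * S ^+ 2 <= nsq plane (L h) * (C * decay (p.2 : R)).
    rewrite r2 (le_trans (ler_wpM2l (wt_ge0 l p) hS))// mulrCA.
    by rewrite ler_wpM2l ?nsq_ge0.
  have hmr := ler_pM (sqr_ge0 m) (mulr_ge0 (sqr_ge0 r) (sqr_ge0 S)) hm hr.
  have := sqr_ge0 (X - r * m * S); have := sqr_ge0 X; have := sqr_ge0 (r * m * S).
  move: hmr; rewrite /V -/X.
  rewrite (_ : m ^+ 2 * _ = (r * m * S) ^+ 2); last by ring.
  rewrite (_ : 4 / e ^+ 2 * decay (p.1 : R) * _ =
    nsq plane (L h) * (4 / e ^+ 2) * C * (decay (p.1 : R) * decay (p.2 : R))); last by ring.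
  rewrite (_ : r * (m * X) * S = X * (r * m * S)); last by ring.
  move: (r * m * S) (_ * (decay _ * decay _)) => Y B; clearbody X; nra.
have c00 : cint plane (fun=> 0) = 0.
  have := cintZ 0 (sqint_mulJ sh sh); rewrite mul0r; apply: etrans.
  by apply: eq_cint => q; rewrite mul0r.
have F1 p : cint plane (fun q => G (p, q)) = c%:C * (L (tr g%:C h) p * cj (L (damp e k) p)).
  have [p0|p0] := boolP (0 < (p.2 : R)); last first.
    rewrite (_ : (fun q => _) = (fun=> 0)); last by apply/funext => q; rewrite Gout.
    by rewrite c00 [L (tr _ _) p]/lift wt_out// sqrtr0 !mul0r mulr0.
  transitivity ((Num.sqrt (wt l p))%:C * cj (L (damp e k) p) * inner plane (L h) (kern p)).
    exact: (@cintZ _ _ _ plane ((Num.sqrt (wt l p))%:C * cj (L (damp e k) p)) _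
      (sqint_mulJ sh (HC p p0).1)).
  by rewrite -(L_kern p0) Hc// (L_tr h p0); ring.
have F2 q : cint plane (fun p => G (p, q)) = c%:C * (L h q * cj (L (tr g%:C (damp e k)) q)).
  rewrite (funext (fun p => G2 p q)).
  have [q0|q0] := boolP (0 < (q.2 : R)); last first.
    rewrite (_ : (fun p => _) = (fun=> 0)); last first.
      by apply/funext => p; rewrite wt_out// sqrtr0 !mul0r.
    by rewrite c00 [L h q]/lift wt_out// sqrtr0 !mul0r mulr0.
  transitivity ((Num.sqrt (wt l q))%:C * L h q * cj (inner plane (L (damp e k)) (kern q))).
    have ii := sqint_mulJ sd (HC q q0).1.
    rewrite -(cintJ ii).
    exact: (@cintZ _ _ _ plane ((Num.sqrt (wt l q))%:C * L h q) _ (cintegrableJ ii)).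
  by rewrite -(L_kern q0) Hc// (L_tr _ q0) !conjcM !conjcR; ring.
have := cint_swap mG iG1 iG2 iV GV.
rewrite (funext F1) (funext F2) !cintZ; first exact: mulfI.
- exact: sqint_mulJ sh (bergman_sqint (bT _ bd)).
- exact: sqint_mulJ (bergman_sqint (bT _ bh)) sd.
Qed.

End RealTranslations.

Section RealTranslationsSymmetric.
Variables (R : realType) (l : nat).
Implicit Types (h k : Cplus R -> R[i]).
Local Notation plane := (plane R).
Local Notation L h := (lift l (zext h)).

Lemma tr0 h : tr 0 h = h.
Proof. by apply/funext => w; rewrite /tr addr0 zext_val. Qed.

Lemma lift_tr_damp (t e : R) k (p : mR R * mR R) : 0 <= t -> 0 <= e ->
  cabs (L (tr t%:C (damp e k)) p) <= cabs (L (tr t%:C k) p) /\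
  cabs (L (tr t%:C (damp e k)) p - L (tr t%:C k) p) <=
    e * cabs (pl p + t%:C) * cabs (L (tr t%:C k) p).
Proof.
move=> t0 e0; have [p0|p0] := boolP (0 < (p.2 : R)); last first.
  by rewrite /lift wt_out// sqrtr0 !mul0r subr0 cabs0 mulr0.
have z0 : 0 < Re (pl p + t%:C) by rewrite ReD ltr_pwDl.
have -> : L (tr t%:C (damp e k)) p = (1 + e%:C * (pl p + t%:C))^-1 * L (tr t%:C k) p.
  by rewrite /lift !zext_tr// zext_damp// mulrCA.
have D1 := damp_ge1 e0 z0; have D0 := lt_le_trans ltr01 D1; split.
  by rewrite cabsM ler_piMl ?cabs_ge0// cabsV invf_le1.
by rewrite -{2}[L _ p]mul1r -mulrBl cabsM ler_wpM2r ?cabs_ge0// damp_dist.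
Qed.

(** The difference of the two inner products is written as a single integral; it is zero for each
    damped [k], and the damping is removed by dominated convergence. *)
Lemma adjoint_tr_re (g : R) : 0 <= g -> adjoint_pair l (tr g%:C) (tr g%:C).
Proof.
rewrite le_eqVlt => /predU1P[<-|g0].
  (* The translation by 0 is also an imaginary one. *)
  by have := adjoint_tr_im l (0 : R); rewrite oppr0.
have bT := (bounded_tr_re l (ltW g0)).1; split; [exact: bounded_tr_re (ltW g0)|exact: bT|].
move=> h k bh bk; apply/eqP; rewrite -subr_eq0; apply/eqP.
have sh := bergman_sqint bh; have sTh := bergman_sqint (bT _ bh).
have sk := bergman_sqint bk; have sTk := bergman_sqint (bT _ bk).
pose F (u v : mR R * mR R -> R[i]) p := L (tr g%:C h) p * cj (u p) - L h p * cj (v p).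
have FE u v : sqint plane u -> sqint plane v ->
    cint plane (F u v) = inner plane (L (tr g%:C h)) u - inner plane (L h) v.
  move=> su sv; have iv := sqint_mulJ sh sv.
  transitivity (inner plane (L (tr g%:C h)) u + -1 * inner plane (L h) v).
    rewrite -(cintZ (-1) iv) -(cintD (sqint_mulJ sTh su) (cintegrableZ (-1) iv)).
    by apply: eq_cint => p; rewrite /F mulN1r.
  by rewrite mulN1r.
have mF u v : sqint plane u -> sqint plane v -> cmeas (F u v).
  move=> [mu _] [mv _]; apply: cmeasB; apply: cmeasM.
  - exact: sTh.1.
  - exact: cmeasJ.
  - exact: sh.1.
  - exact: cmeasJ.
pose e (n : nat) : R := n.+1%:R^-1.
have e0 n : 0 < e n by rewrite invr_gt0.
have e1 n : e n <= 1 by rewrite invf_le1// ler1n.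
have bd n := bergman_damp (ltW (e0 n)) bk.
have sd n := bergman_sqint (bd n); have sTd n := bergman_sqint (bT _ (bd n)).
rewrite -FE//.
pose v p := cabs (L (tr g%:C h) p) * cabs (L k p) + cabs (L h p) * cabs (L (tr g%:C k) p).
have A n p := lift_tr_damp k p (ltW g0) (ltW (e0 n)).
(* With [t = 0] the same estimate covers the untranslated function. *)
have A0 n p : _ /\ _ := lift_tr_damp k p (lexx 0) (ltW (e0 n)).
apply: (@cint_dominated_eq0 _ _ _ plane
  (fun n => F (L (damp (e n) k)) (L (tr g%:C (damp (e n) k)))) _ v).
- by move=> n; apply: mF.
- exact: mF.
- apply: rintegrableD.
    have := cintegrable_cabs (sqint_mulJ sTh sk).
    by apply: eq_rintegrable => q; rewrite cabsM cabsJ.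
  have := cintegrable_cabs (sqint_mulJ sh sTk).
  by apply: eq_rintegrable => q; rewrite cabsM cabsJ.
- move=> n p; have [a _] := A n p; have [a0 _] := A0 n p; rewrite !tr0 in a0.
  rewrite /F /v (le_trans (cabsB _ _))// (cabsM (L (tr g%:C h) p)) (cabsM (L h p)) !cabsJ.
  by apply: lerD; apply: ler_wpM2l; rewrite ?cabs_ge0.
- move=> p.
  exists (cabs (L (tr g%:C h) p) * (cabs (pl p + 0%:C) * cabs (L k p)) +
          cabs (L h p) * (cabs (pl p + g%:C) * cabs (L (tr g%:C k) p))) => n.
  have [_ a] := A n p; have [_ a0] := A0 n p; rewrite !tr0 in a0.
  rewrite /F.
  have -> : forall a b c d x y : R[i], a * cj c - b * cj d - (a * cj x - b * cj y) =
      a * cj (c - x) - b * cj (d - y) by move=> *; rewrite !conjcB; ring.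
  rewrite (le_trans (cabsB _ _))// (cabsM (L (tr g%:C h) p)) (cabsM (L h p)) !cabsJ.
  rewrite -/(e n) [leRHS]mulrC [leRHS]mulrDr; apply: lerD.
    by rewrite [leRHS]mulrCA ler_wpM2l ?cabs_ge0// mulrA.
  by rewrite [leRHS]mulrCA ler_wpM2l ?cabs_ge0// mulrA.
- by move=> n; rewrite FE// inner_tr_damp// subrr.
Qed.

End RealTranslationsSymmetric.

(** * Self-adjoint symbols *)

Section SelfAdjointSymbols.
Variables (R : realType) (l : nat).
Implicit Types (h k : Cplus R -> R[i]).
Local Notation plane := (plane R).
Local Notation L h := (lift l (zext h)).

Definition wcomp (f : Cplus R -> R[i]) (g : Cplus R -> Cplus R) h : Cplus R -> R[i] :=
  fun w => f w * h (g w).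

Lemma tr_tr (s t : R[i]) h : 0 <= Re s -> tr s (tr t h) = tr (s + t) h.
Proof.
move=> s0; apply/funext => w.
have w0 : 0 < Re (val w + s) by rewrite ReD ltr_pwDl// Cplus_gt0.
by rewrite [LHS]/tr zext_tr// -addrA.
Qed.

Lemma adjoint_tr (p : R[i]) : 0 <= Re p -> adjoint_pair l (tr p) (tr (cj p)).
Proof.
move=> p0; have A1 := adjoint_tr_re l p0; have A2 := adjoint_tr_im l (Im p).
apply: eq_adjoint_pair (adjoint_pair_comp A1 A2) => h _; rewrite /= tr_tr//.
  by congr tr; case: (p) => a b; apply: complexP => /=; ring.
by congr tr; case: (p) => a b; apply: complexP => /=; ring.
Qed.

Lemma adjoint_sandwich X (p : R[i]) : 0 <= Re p -> adjoint_pair l X X ->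
  adjoint_pair l (fun h => tr (cj p) (X (tr p h))) (fun h => tr (cj p) (X (tr p h))).
Proof.
move=> p0 AX; have A1 := adjoint_tr p0.
have A2 : adjoint_pair l (tr (cj p)) (tr p).
  by rewrite -{2}(conjcK p); apply: adjoint_tr; rewrite ReJ.
exact: adjoint_pair_comp A2 (adjoint_pair_comp AX A1).
Qed.

(** The scalar stands to the left of [X] in the operator and to the right of it in the adjoint;
    homogeneity brings the two to the same form. *)
Lemma adjoint_wcomp (d : R) X f g : adjoint_pair l X X ->
  (forall h w, d%:C * X h w = f w * h (g w)) ->
  (forall h w, X (fun v => d%:C * h v) w = d%:C * X h w) ->
  adjoint_pair l (wcomp f g) (wcomp f g).
Proof.
move=> AX Xfg XZ; apply: eq_adjoint_pair (adjoint_pair_comp (adjoint_pair_scale l d) AX) => h _;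
  apply/funext => w /=; first exact: Xfg.
by rewrite XZ Xfg.
Qed.

(** By the reproducing property this is the rank one operator [h |-> (e / c) <h, K_mu> K_mu],
    symmetric because [e] and [c] are real. *)
Lemma adjoint_constant (mu : Cplus R) (e : R) f g :
  (forall w, g w = mu /\ f w = e%:C / (val w + cj (val mu)) ^+ l.+2) ->
  adjoint_pair l (wcomp f g) (wcomp f g).
Proof.
move=> fg; have bk := bergman_ker l mu; have sk := bergman_sqint bk.
have [c c0 Hc] := reproducing R l.
have E h : wcomp f g h = fun w => (e%:C * h mu) * ker l mu w.
  apply/funext => w; have [gw fw] := fg w.
  by rewrite /wcomp gw fw /ker /kfun mulrAC.
split=> [|h bh|h k bh bk']; rewrite ?E; last 2 first.
- exact: bergmanZ.
- have sh := bergman_sqint bh; have sk' := bergman_sqint bk'.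
  rewrite !liftZ (innerZl _ sk sk') (innerZr _ sk sh) (Hc h mu bh) (inner_conj sk' sk).
  rewrite (Hc k mu bk') !conjcM !conjcR.
  by ring.
split=> [h bh|]; first by rewrite E; exact: bergmanZ.
exists (e ^+ 2 * (nsq plane (L (ker l mu)) / c) ^+ 2) => [|h bh].
  by rewrite mulr_ge0 ?sqr_ge0.
rewrite E liftZ nsqZ// cabsM exprMn cabsR real_normK ?num_real//.
rewrite -[leLHS]mulrA -[leRHS]mulrA; apply: ler_wpM2l; first exact: sqr_ge0.
have sh := bergman_sqint bh.
have := cauchy_schwarz sh sk; rewrite (Hc h mu bh) cabsM exprMn cabsR real_normK ?num_real//.
have c2 : 0 < c ^+ 2 by rewrite exprn_gt0.
rewrite mulrC -ler_pdivlMr// => H.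
have N0 := nsq_ge0 plane (L (ker l mu)).
apply: (le_trans (ler_wpM2r N0 H)).
by rewrite le_eqVlt; apply/orP; left; apply/eqP; field; rewrite gt_eqF.
Qed.

Lemma adjoint_translation (g0 d : R) f g : 0 <= g0 ->
  (forall w, val (g w) = val w + g0%:C /\ f w = d%:C) ->
  adjoint_pair l (wcomp f g) (wcomp f g).
Proof.
move=> g00 fg; apply: (@adjoint_wcomp d (tr g0%:C)); first exact: adjoint_tr_re.
  by move=> h w; have [gw ->] := fg w; rewrite /tr -gw zext_val.
by move=> h w; rewrite /tr zextZ.
Qed.

(** The symbol is [w + cj p], followed by [q / w] and by the addition of [p]: a symmetric inversion
    between two translations adjoint to each other. *)
Lemma adjoint_frac_pos (p : R[i]) (q d : R) f g : 0 < q -> 0 <= Re p ->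
  (forall w, val (g w) = p + q%:C / (val w + cj p) /\ f w = d%:C / (val w + cj p) ^+ l.+2) ->
  adjoint_pair l (wcomp f g) (wcomp f g).
Proof.
move=> q0 p0 fg.
have zp (w : Cplus R) : 0 < Re (val w + cj p) by rewrite ReD ReJ ltr_pwDl// Cplus_gt0.
apply: (@adjoint_wcomp d (fun h => tr (cj p) (invo l q (tr p h)))).
- exact: (adjoint_sandwich p0 (adjoint_invo l q0)).
- move=> h w; have [gw ->] := fg w; rewrite {1}/tr (zext_invo _ _ _ (zp w)).
  rewrite zext_tr; last exact: Re_kinv.
  by rewrite (addrC (q%:C * _) p) -gw zext_val mulrA exprVn.
- move=> h w; have zk := Re_kinv q0 (zp w).
  rewrite /tr !(zext_invo _ _ _ (zp w)) -!/(tr p _) !(zext_tr _ _ zk) zextZ.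
  exact: mulrCA.
Qed.

(* [w |-> r - r ^ 2 / (w + r)] is an inversion followed by the translation by
   [1 / r] and by another inversion. *)
Lemma adjoint_frac_neg (p : R[i]) (r d : R) f g : 0 < r -> r <= Re p ->
  (forall w, val (g w) = p - (r ^+ 2)%:C / (val w + cj p) /\
     f w = d%:C / (val w + cj p) ^+ l.+2) ->
  adjoint_pair l (wcomp f g) (wcomp f g).
Proof.
move=> r0 rp fg; pose p' := p - r%:C; pose s : R := r^-1.
have p'0 : 0 <= Re p' by rewrite ReB subr_ge0.
have s0 : 0 < s by rewrite invr_gt0.
pose X h := invo l 1 (tr s%:C (invo l 1 h)).
have AX : adjoint_pair l X X.
  exact: adjoint_pair_comp (adjoint_invo l ltr01)
    (adjoint_pair_comp (adjoint_tr_re l (ltW s0)) (adjoint_invo l ltr01)).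
have XE h z : 0 < Re z -> 0 < Re (r%:C - (r ^+ 2)%:C / (z + r%:C)) /\
    zext (X h) z =
    (r%:C / (z + r%:C)) ^+ l.+2 * zext h (r%:C - (r ^+ 2)%:C / (z + r%:C)).
  move=> z0; have zk := Re_kinv (@ltr01 R) z0; have z1 := Re_neq0 z0.
  have zr : z + r%:C != 0 by apply: Re_neq0; rewrite ReD addr_gt0.
  have rC : (r%:C : R[i]) != 0 by rewrite -cabs_gt0 cabsR gtr0_norm.
  have zs : 0 < Re (1%:C * z^-1 + s%:C) by rewrite ReD addr_gt0.
  have e1 : 1%:C * z^-1 + s%:C = (z + r%:C) / (z * r%:C).
    by rewrite /s fmorphV mul1r; field; rewrite z1 rC.
  have e2 : 1%:C * (1%:C * z^-1 + s%:C)^-1 = r%:C - (r ^+ 2)%:C / (z + r%:C).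
    by rewrite e1 rmorphXn mul1r; field; rewrite z1 rC zr.
  split; first by rewrite -e2; exact: Re_kinv.
  rewrite /X (zext_invo _ _ _ z0) (zext_tr _ _ zk) (zext_invo _ _ _ zs) mulrA -exprMn e2.
  by rewrite e1; congr (_ ^+ _ * _); field; rewrite z1 rC zr.
have zw (w : Cplus R) : 0 < Re (val w + cj p') by rewrite ReD ReJ ltr_pwDl// Cplus_gt0.
have zE (w : Cplus R) : val w + cj p' + r%:C = val w + cj p.
  by rewrite /p' conjcB conjcR -addrA subrK.
(* [X] brings in the factor [(r / (z + r)) ^ (l + 2)]; the scalar cancels its numerator. *)
apply: (@adjoint_wcomp (d / r ^+ l.+2) (fun h => tr (cj p') (X (tr p' h)))).
- exact: (adjoint_sandwich p'0 AX).
- move=> h w; have [gw ->] := fg w; have [z1 E] := XE (tr p' h) _ (zw w).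
  have zp : val w + cj p != 0.
    by rewrite -zE; apply: Re_neq0; rewrite ReD addr_gt0.
  have rC : (r%:C : R[i]) != 0 by rewrite -cabs_gt0 cabsR gtr0_norm.
  rewrite {1}/tr E (zext_tr _ _ z1) zE.
  have -> : r%:C - (r ^+ 2)%:C / (val w + cj p) + p' = val (g w) by rewrite gw /p'; ring.
  rewrite zext_val mulrA; congr (_ * _).
  rewrite expr_div_n rmorphM fmorphV rmorphXn.
  by field; rewrite !expf_neq0.
- move=> h w; have [z1 E] := XE (tr p' h) _ (zw w).
  have [_ E'] := XE (tr p' (fun v => (d / r ^+ l.+2)%:C * h v)) _ (zw w).
  rewrite {1}/tr E' [tr (cj p') _ w]/tr E !(zext_tr _ _ z1) zextZ.
  exact: mulrCA.
Qed.

End SelfAdjointSymbols.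

(** * The functional equation *)

Section HalfPlaneAlgebra.
Variable R : realType.

Definition Cpoint (x y : R) (x0 : 0 < x) : Cplus R := exist _ (x +i* y) x0.

Lemma half_plane_affine (a b : R[i]) : (forall w : Cplus R, 0 < Re (a * val w + b)) ->
  [/\ Im a = 0, 0 <= Re a & 0 <= Re b].
Proof.
move=> H; have {}H (t s : R) : 0 < t -> 0 < Re a * t - Im a * s + Re b.
  by move=> t0; have := H (Cpoint s t0); rewrite ReD ReM.
have Ia : Im a = 0.
  (* At [t = 1] this [s] would make the real part vanish. *)
  apply/eqP/negP => /negP Ia; have := H 1 ((Re a + Re b) / Im a) ltr01.
  by rewrite mulrCA divff// !mulr1 addrAC subrr ltxx.
have {}H t : 0 < t -> 0 < Re a * t + Re b by move=> /(H t 0); rewrite mulr0 subr0.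
have Ra : 0 <= Re a.
  rewrite leNgt; apply/negP => Ra.
  have t0 : 0 < (`|Re b| + 1) / - Re a by rewrite divr_gt0 ?oppr_gt0// ltr_wpDl.
  have := H _ t0; rewrite invrN mulrN mulrN mulrCA divff ?lt_eqF// mulr1.
  by have := ler_norm (Re b); lra.
split=> //; rewrite leNgt; apply/negP => Rb.
have t0 : 0 < - Re b / (2 * (1 + Re a)).
  by rewrite divr_gt0 ?oppr_gt0// mulr_gt0// ltr_pwDl.
have := H _ t0; rewrite mulrA ltNge => /negP; apply.
have a1 : 0 < 2 * (1 + Re a) by rewrite mulr_gt0// ltr_pwDl.
rewrite -lerBrDr sub0r ler_pdivrMr//; nra.
Qed.

(** The values at 1, 2 and 3 suffice: their second difference is [2 * a], and a first difference
    then gives [b]. *)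
Lemma quadratic_eq0 (a b c : R[i]) :
  (forall w : Cplus R, a * val w ^+ 2 + b * val w + c = 0) -> [/\ a = 0, b = 0 & c = 0].
Proof.
move=> H; have r0 n : (0 : R) < n.+1%:R by rewrite ltr0n.
have E n : a * n.+1%:R ^+ 2 + b * n.+1%:R + c = 0.
  have := H (Cpoint 0 (r0 n)); rewrite (_ : val _ = n.+1%:R)//.
  by rewrite -(rmorph_nat (@real_complex R)).
have E1 := E 0; have E2 := E 1; have E3 := E 2%N.
have a0 : a = 0.
  apply: (@mulfI _ 2); first by rewrite pnatr_eq0.
  transitivity ((a * 3 ^+ 2 + b * 3 + c) - 2 * (a * 2 ^+ 2 + b * 2 + c) +
    (a * 1 ^+ 2 + b * 1 + c)); first by ring.
  by rewrite E1 E2 E3 !mulr0 subr0 addr0.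
have b0 : b = 0.
  transitivity ((a * 2 ^+ 2 + b * 2 + c) - (a * 1 ^+ 2 + b * 1 + c) - 3 * a); first by ring.
  by rewrite E1 E2 a0 mulr0 !subr0.
by split=> //; move: E1; rewrite a0 b0 !mul0r !add0r.
Qed.

End HalfPlaneAlgebra.

Section Classification.
Variables (R : realType) (l : nat).
Variables (f : Cplus R -> R[i]) (g : Cplus R -> Cplus R).
Hypothesis hf : analytic f.
Hypothesis hg : analytic (fun w => val (g w)).
Hypothesis FE : forall z w, f z * (val z + cj (val (g w))) ^+ l.+2 =
  cj (f w) * (val (g z) + cj (val w)) ^+ l.+2.

Let addJ_neq0 (z w : Cplus R) : val z + cj (val w) != 0.
Proof. by apply/Re_neq0/Re_addJ_gt0; exact: Cplus_gt0. Qed.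

Lemma symbol_eq0 z0 : f z0 = 0 -> forall w, f w = 0.
Proof.
move=> f0 w; have := FE z0 w; rewrite f0 mul0r => /esym/eqP.
rewrite mulf_eq0 expf_eq0 (negPf (addJ_neq0 _ _)) andbF orbF => /eqP /(congr1 cj).
by rewrite conjcK conjc0.
Qed.

Hypothesis f_neq0 : forall w, f w != 0.

(* Compare the logarithmic derivatives in [z] of the two sides of [FE]; the
   values at [z] are then constants and only [w] varies. *)
Lemma mobius_identity (z : Cplus R) : exists A B : R[i], forall w,
  (cj (val z) + val (g w)) * (A - B * (cj (val (g z)) + val w)) = cj (val (g z)) + val w.
Proof.
have [f' df] := analytic_deriv z hf; have [G dg] := analytic_deriv z hg.
exists (cj G), (cj (f' / (l.+2%:R * f z))) => w.
set b := cj (val (g w)); set u := cj (val w).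
have zb : val z + b != 0 by exact: addJ_neq0.
have gu : val (g z) + u != 0 by exact: addJ_neq0.
have n0 : l.+2%:R != 0 :> R[i] by rewrite pnatr_eq0.
have d1 := wirtingerM df (wirtingerX l.+1
  (wirtingerD (wirtinger_id (val z)) (wirtinger_cst b (val z)))).
have d2 := wirtingerZ (cj (f w)) (wirtingerX l.+1
  (wirtingerD dg (wirtinger_cst u (val z)))).
rewrite /= !(mulr0, mul0r, addr0) in d1.
rewrite /= !(mulr0, mul0r, addr0) in d2.
have d3 : wirtinger (fun v => zext f v * (v + b) ^+ l.+2) (val z)
    (cj (f w) * (l.+2%:R * (zext (fun w => val (g w)) (val z) + u) ^+ l.+1 * G)) 0.
  apply: wirtinger_near (Cplus_gt0 z) _ d2 => v /Re_near v0.
  by rewrite !(zextE _ v0) -FE.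
have := wirtinger_unique d1 d3; rewrite !zext_val mulr1 => E.
have F := FE z w; rewrite -/b -/u in F.
(* Multiplying by the right powers and using [FE] eliminates [f w]: the resulting relation depends
   on [w] only through [b] and [u]. *)
have F' : f' * (val z + b) * (val (g z) + u) + l.+2%:R * f z * (val (g z) + u) =
    l.+2%:R * G * f z * (val z + b).
  apply: (mulIf (expf_neq0 l.+2 zb)).
  have -> : l.+2%:R * G * f z * (val z + b) * (val z + b) ^+ l.+2 =
    l.+2%:R * G * (val z + b) * (f z * (val z + b) ^+ l.+2) by ring.
  rewrite F [(val (g z) + u) ^+ l.+2]exprS.
  transitivity ((f' * (val z + b) ^+ l.+2 + f z * (l.+2%:R * (val z + b) ^+ l.+1)) *
    ((val z + b) * (val (g z) + u))); first by rewrite [(val z + b) ^+ l.+2]exprS; ring.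
  by rewrite E; ring.
have F2 : (val z + b) * (G - f' / (l.+2%:R * f z) * (val (g z) + u)) = val (g z) + u.
  apply: (mulfI (mulf_neq0 n0 (f_neq0 z))); rewrite mulrBr mulrBr.
  have := f_neq0 z; move: F'; move: (f z) (l.+2%:R) n0 => fz N n0 F' fz0.
  have -> : N * fz * ((val z + b) * G) = N * G * fz * (val z + b) by ring.
  by rewrite -F'; field; rewrite fz0 n0.
have := congr1 cj F2; rewrite /b /u; move: (f' / _) => c.
by rewrite !(conjcM, conjcD, conjcN, conjcK).
Qed.

Let one : Cplus R := Cpoint 0 (@ltr01 R).

Lemma translation_symbol (A : R[i]) :
  (forall w, (1 + val (g w)) * A = cj (val (g one)) + val w) -> translation_case f g.
Proof.
move=> H; have A0 : A != 0.
  apply: contraTneq (addJ_neq0 one (g one)) => A0.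
  by rewrite addrC -H A0 mulr0 eqxx.
have gE w : val (g w) = A^-1 * val w + (A^-1 * cj (val (g one)) - 1).
  have -> : val w = (1 + val (g w)) * A - cj (val (g one)) by rewrite H addrAC subrr add0r.
  by field.
have pos (w : Cplus R) : 0 < Re (A^-1 * val w + (A^-1 * cj (val (g one)) - 1)).
  by rewrite -gE Cplus_gt0.
have [Ia Ra Rb] := half_plane_affine pos.
(* At the point 1 the identity says that [(1 + g 1) * A] is the conjugate of [1 + g 1], so [A] has
   modulus 1; its inverse is real and nonnegative by [half_plane_affine]. *)
have A1 : A = 1.
  have g10 : 0 < cabs (1 + val (g one)).
    by rewrite cabs_gt0; apply: Re_neq0; rewrite ReD addr_gt0// Cplus_gt0.
  have := congr1 (@cabs R) (H one); rewrite cabsM.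
  rewrite (_ : cj (val (g one)) + val one = cj (1 + val (g one))); last first.
    by rewrite conjcD conjc1 addrC.
  rewrite cabsJ => /(congr1 (fun x => (cabs (1 + val (g one)))^-1 * x)).
  rewrite mulrA mulVf ?gt_eqF// mul1r => cA.
  have aR : A^-1 = (Re A^-1)%:C by apply: complexP.
  have := cabsV A; rewrite cA invr1 aR cabsR ger0_norm// => Ra1.
  by rewrite -[A]invrK aR Ra1 invr1.
move: H gE Rb; rewrite A1 invr1 => H gE Rb.
have g1E : cj (val (g one)) = (Re (val (g one)))%:C.
  have := H one; rewrite mulr1 (_ : val one = 1)// addrC => /addIr E.
  by apply: complexP; rewrite ?ReJ// ImJ; have := congr1 (@complex.Im R) E; rewrite ImJ /=; lra.
have [c cE] : exists c, c = Re (val (g one)) - 1 by eexists.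
have gE' w : val (g w) = val w + c%:C.
  by rewrite gE !mul1r g1E cE rmorphB.
(* For a real translation the two powers in [FE] coincide, so [f] is constant and real. *)
have fC z w : f z = cj (f w).
  have := FE z w; rewrite !gE'.
  have -> : val z + cj (val w + c%:C) = val z + c%:C + cj (val w).
    by rewrite conjcD conjcR; ring.
  apply: mulIf; rewrite expf_neq0// -gE'; exact: addJ_neq0.
exists c, (Re (f one)); split; first by move: Rb; rewrite mul1r g1E ReB cE.
move=> w; split; first exact: gE'.
rewrite (fC w one); apply: complexP; rewrite ?ReJ ?ImJ//.
by have /(congr1 (@complex.Im R)) := fC one one; rewrite ImJ /=; lra.
Qed.

Lemma constant_symbol : (forall w, g w = g one) -> constant_case l f g.
Proof.
move=> gc; set mu := g one.
have mu0 (z : Cplus R) : (val mu + cj (val z)) ^+ l.+2 != 0 by rewrite expf_neq0// addJ_neq0.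
have fC z w : f z * (val z + cj (val mu)) ^+ l.+2 = cj (f w * (val w + cj (val mu)) ^+ l.+2).
  have := FE z w; rewrite !gc -/mu => ->.
  by rewrite conjcM conjcX conjcD conjcK (addrC (val mu)).
exists mu, (Re (f one * (val one + cj (val mu)) ^+ l.+2)) => w; split; first exact: gc.
have zw : (val w + cj (val mu)) ^+ l.+2 != 0 by rewrite expf_neq0// addJ_neq0.
apply: (canRL (mulfK zw)); rewrite (fC w one).
apply: complexP; rewrite ?ReJ ?ImJ//.
by have /(congr1 (@complex.Im R)) := fC one one; rewrite ImJ /=; lra.
Qed.

(* Without denominators [mobius_identity] is an identity of polynomials in [w],
   so that it may be evaluated at [w = - cj (g z)], outside the half-plane. *)
Lemma fractional_symbol (p q r : R[i]) : q != 0 ->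
  (forall w : Cplus R, val w + r != 0) ->
  (forall w, val (g w) = p + q / (val w + r)) -> r = cj p /\ q = cj q.
Proof.
move=> q0 wr0 gE.
have key (z : Cplus R) : (cj (val z) + p) * (r - cj (val (g z))) + q = 0.
  have [A [B H]] := mobius_identity z; set a := cj (val (g z)) in H *.
  set P := cj (val z) + p; pose Q := P * r + q.
  (* If [A] were 0, the identity would force [g] to be constant, which [q != 0] excludes, as the
     points 1 and 2 show. *)
  have A0 : A != 0.
    apply/eqP => A0; have {}H w : - B * (cj (val z) + val (g w)) = 1.
      have aw : a + val w != 0 by rewrite addrC addJ_neq0.
      by apply: (mulIf aw); rewrite mul1r -[RHS]H A0; ring.
    have B0 : - B != 0.
      by apply/eqP => B0; have /eqP := H one; rewrite B0 mul0r eq_sym oner_eq0.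
    have two0 : (0 : R) < 2 by [].
    have /(mulfI B0)/addrI := etrans (H one) (esym (H (Cpoint 0 two0))).
    rewrite !gE => /addrI/(mulfI q0)/invr_inj/addIr/(congr1 (@complex.Re R)) /=.
    by lra.
  have [e2 e1 e0] : [/\ - P * B - 1 = 0, P * (A - B * a) - Q * B - (a + r) = 0 &
      Q * (A - B * a) - a * r = 0].
    apply: quadratic_eq0 => w.
    have := congr1 (fun x => x * (val w + r)) (H w); rewrite gE => E.
    transitivity ((cj (val z) + (p + q / (val w + r))) * (A - B * (a + val w)) * (val w + r) -
      (a + val w) * (val w + r)); last by rewrite E subrr.
    by rewrite /Q /P; field; exact: wr0.
  apply: (mulIf A0); rewrite mul0r.
  transitivity ((- P * B - 1) * a ^+ 2 - (P * (A - B * a) - Q * B - (a + r)) * a +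
    (Q * (A - B * a) - a * r)); first by rewrite /Q; ring.
  by rewrite e2 e1 e0 mul0r mul0r subr0 addr0.
(* After conjugation and multiplication by [z + r], [key] is a quadratic identity in [z]; its
   leading coefficient gives [r = cj p], and the next one then gives [q = cj q]. *)
have [e2 e1 e0] : [/\ cj r - p = 0, (cj r - p) * (r + cj p) - q + cj q = 0 &
    cj p * ((cj r - p) * r - q) + cj q * r = 0].
  apply: quadratic_eq0 => z.
  have := congr1 (fun x => cj x * (val z + r)) (key z).
  rewrite !(conjcD, conjcM, conjcN, conjcK) gE conjc0 mul0r => <-.
  by field; exact: wr0.
split; first by move/eqP: e2; rewrite subr_eq0 => /eqP <-; rewrite conjcK.
by move: e1; rewrite e2 mul0r sub0r addrC => /eqP; rewrite subr_eq0 => /eqP.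
Qed.

End Classification.

Section Fractional.
Variables (R : realType) (l : nat).
Implicit Types (f : Cplus R -> R[i]) (g : Cplus R -> Cplus R).

(* The substitution is [p = - beta / alpha], [q = - 2 / alpha] and
   [d = delta / alpha ^ (l + 2)]. *)
Lemma fractional_caseP f g : fractional_case l f g <->
  exists (p : R[i]) (q d : R),
    [/\ d != 0, (0 < q /\ 0 <= Re p) \/ [/\ q < 0, 0 < Re p & - q <= Re p ^+ 2] &
      forall w, val (g w) = p + q%:C / (val w + cj p) /\
        f w = d%:C / (val w + cj p) ^+ l.+2].
Proof.
have ReMl (a : R) (z : R[i]) : Re (a%:C * z) = a * Re z by rewrite ReM /= mul0r subr0.
have c2 : (-2 : R)%:C = -2 :> R[i].
  by rewrite rmorphN; congr (- _); exact: (rmorph_nat (@real_complex R) 2).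
have cE (x : R) : (-2 / x)%:C = -2 / x%:C :> R[i].
  transitivity ((-2 : R)%:C * (x^-1)%:C); first exact: (rmorphM (@real_complex R)).
  by rewrite c2; congr (_ * _); exact: (fmorphV (@real_complex R)).
have C0 (a : R) : a != 0 -> a%:C != 0 :> R[i] by move=> a0; rewrite -cabs_gt0 cabsR normr_gt0.
split=> [[a [d [b [a0 d0 ab fg]]]]|[p [q [d [d0 pq fg]]]]].
  have aC := C0 _ a0; pose p := - (b / a%:C).
  have bE : b = - (a%:C * p) by rewrite /p; field.
  have bR : Re b = - (a * Re p) by rewrite bE ReN ReMl.
  have dE (w : Cplus R) : a%:C * val w - cj b = a%:C * (val w + cj p).
    by rewrite bE conjcN conjcM conjcR opprK mulrDr.
  exists p, (- 2 / a), (d / a ^+ l.+2); split.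
  - by rewrite mulf_neq0// invr_eq0 expf_neq0.
  - have aV : a / a = 1 by rewrite divff.
    case: ab => [[b0 /andP[ap ab]]|[an b0]].
      right; have pp : 0 < Re p by move: b0; rewrite bR oppr_lt0 pmulr_rgt0.
      split=> //; first by rewrite mulNr oppr_lt0 divr_gt0.
      rewrite mulNr opprK ler_pdivrMr//; move: ab; rewrite bR sqrrN exprMn.
      by move=> ab; rewrite -(ler_pM2l ap); lra.
    left; split; first by rewrite mulNr oppr_gt0 pmulr_rlt0// invr_lt0.
    by move: b0; rewrite bR oppr_ge0 nmulr_rle0.
  - move=> w; have [-> ->] := fg w; rewrite dE; split.
      rewrite -/p; congr (_ + _); rewrite invfM mulrA.
      by rewrite cE !mulNr.
    by rewrite exprMn invfM mulrA rmorphM fmorphV rmorphXn.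
have q0 : q != 0 by case: pq => [[]|[]]; [move=> h _; rewrite gt_eqF|move=> h _ _; rewrite lt_eqF].
have qC := C0 _ q0; pose a := - 2 / q.
have a0 : a != 0 by rewrite mulf_neq0 ?oppr_eq0 ?pnatr_eq0// invr_eq0.
have aC := C0 _ a0; have aE : a%:C = - 2 / q%:C by exact: cE.
have dE (w : Cplus R) : a%:C * val w - cj (- (a%:C * p)) = a%:C * (val w + cj p).
  by rewrite conjcN conjcM conjcR opprK mulrDr.
exists a, (d * a ^+ l.+2), (- (a%:C * p)); split => //.
- by rewrite mulf_neq0// expf_neq0.
- rewrite ReN ReMl; case: pq => [[qp p0]|[qn pp qq]].
    have an : a < 0 by rewrite /a mulNr oppr_lt0 divr_gt0.
    by right; split=> //; rewrite oppr_ge0 nmulr_rle0.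
  have ap : 0 < a by rewrite /a mulNr oppr_gt0 pmulr_rlt0// invr_lt0.
  left; split; first by rewrite oppr_lt0 mulr_gt0.
  rewrite ap sqrrN exprMn.
  have := ler_wpM2l (ltW ap) qq; rewrite (_ : a * - q = 2); last by rewrite /a; field.
  by move=> /(ler_wpM2l (ltW ap)); lra.
- move=> w; have [-> ->] := fg w; rewrite dE; split.
    have -> : - (- (a%:C * p) / a%:C) = p by field.
    have e : 2 / a%:C = - q%:C by rewrite aE; field.
    by rewrite invfM mulrA e mulNr opprK.
  have -> : (d * a ^+ l.+2)%:C = d%:C * a%:C ^+ l.+2 by rewrite rmorphM rmorphXn.
  have h (x u y : R[i]) : u != 0 -> x / y = x * u / (u * y).
    by move=> u0; rewrite (mulrC x u) -[RHS]mulf_div divff// mul1r.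
  by rewrite exprMn; apply: h; rewrite expf_neq0.
Qed.

End Fractional.

(** * Hermitian operators *)

Section Assembly.
Variables (R : realType) (l : nat).
Implicit Types (f h k u v : Cplus R -> R[i]) (g : Cplus R -> Cplus R) (W : operator R).
Local Notation plane := (plane R).
Local Notation L h := (lift l (zext h)).

Lemma adjoint_symbols f g : (forall w, f w = 0) \/
    [\/ constant_case l f g, translation_case f g | fractional_case l f g] ->
  adjoint_pair l (wcomp f g) (wcomp f g).
Proof.
case=> [f0|[[mu [e fg]]|[c [d [c0 fg]]]|/fractional_caseP[p [q [d [d0 pq fg]]]]]].
- have E h : bergman l h -> (fun w => 0%:C * h w) = wcomp f g h.
    by move=> _; apply/funext => w; rewrite /wcomp f0 !mul0r.
  exact: (eq_adjoint_pair E E (adjoint_pair_scale l 0)).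
- exact: adjoint_constant fg.
- exact: adjoint_translation fg.
- case: pq => [[q0 p0]|[q0 p0 qp]]; first exact: (adjoint_frac_pos q0 p0 fg).
  (* With [r ^ 2 = - q], the bound [- q <= Re p ^+ 2] is exactly [r <= Re p]. *)
  have r0 : 0 < Num.sqrt (- q) by rewrite sqrtr_gt0 oppr_gt0.
  have rp : Num.sqrt (- q) <= Re p.
    by rewrite -(ger0_norm (ltW p0)) -sqrtr_sqr ler_wsqrtr.
  apply: (adjoint_frac_neg r0 rp (d := d)) => w; have [-> ->] := fg w; split=> //.
  by rewrite sqr_sqrtr ?oppr_ge0 ?ltW// rmorphN mulNr opprK.
Qed.

Lemma classification f g : analytic f -> analytic (fun w => val (g w)) ->
  (forall z w, f z * (val z + cj (val (g w))) ^+ l.+2 =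
    cj (f w) * (val (g z) + cj (val w)) ^+ l.+2) ->
  (forall w, f w = 0) \/
    [\/ constant_case l f g, translation_case f g | fractional_case l f g].
Proof.
move=> hf hg FE; have [[z0 f0]|fn0] := pselect (exists z, f z = 0).
  by left; exact: (symbol_eq0 FE f0).
have {}fn0 w : f w != 0 by apply/eqP => fw; apply: fn0; exists w.
right; pose one : Cplus R := Cpoint 0 (@ltr01 R).
have [A [B H]] := mobius_identity hf hg FE fn0 one; set a := cj (val (g one)) in H.
have {}H w : (1 + val (g w)) * (A - B * (a + val w)) = a + val w.
  have one1 : cj (val one) = 1 by apply: complexP => /=; rewrite ?oppr0.
  by rewrite -[RHS]H one1.
have [B0|B0] := eqVneq B 0.
  apply: Or32; apply: (translation_symbol FE (A := A)) => w.
  by rewrite -[RHS]H B0 mul0r subr0.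
(* These come from solving the identity for [g]: the denominator is
   [A - B * (a + w) = - B * (w + r)], and [a + w = (w + r) + A / B]. *)
pose p := - 1 - B^-1; pose q := - (A / B ^+ 2); pose r := a - A / B.
have aw (w : Cplus R) : a + val w != 0.
  by rewrite addrC; apply/Re_neq0/Re_addJ_gt0; exact: Cplus_gt0.
have DE (w : Cplus R) : A - B * (a + val w) = - B * (val w + r) by rewrite /r; field.
have wr (w : Cplus R) : val w + r != 0.
  by apply: contraNneq (aw w) => wr; rewrite -H DE wr !mulr0.
have gE w : val (g w) = p + q / (val w + r).
  apply: (mulIf (mulf_neq0 (_ : - B != 0) (wr w))); first by rewrite oppr_eq0.
  transitivity ((1 + val (g w)) * (A - B * (a + val w)) - (A - B * (a + val w))).
    by rewrite DE; ring.
  have e : q / (val w + r) * (- B * (val w + r)) = - B * q by field; exact: wr.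
  by rewrite H DE mulrDl e /p /q /r; field.
have [q0|q0] := eqVneq q 0.
  apply: Or31; apply: (constant_symbol FE) => w.
  by apply: val_inj; rewrite !gE q0 !mul0r.
apply: Or33; have [rE qE] := fractional_symbol hf hg FE fn0 q0 wr gE.
clearbody p q r.
rewrite rE in wr gE; set b := Re q.
have qb : q = b%:C.
  apply: complexP => //=; have := congr1 (@complex.Im R) qE; rewrite ImJ; lra.
have b0 : b != 0 by move: q0; rewrite qb; apply: contraNneq => ->.
(* Otherwise [- cj p] would be a point of the half-plane at which the denominator of [g]
   vanishes. *)
have p0 : 0 <= Re p.
  rewrite leNgt -oppr_gt0; apply/negP => p0; have := wr (Cpoint (Im p) p0).
  move/eqP; apply; apply: complexP; first by rewrite ReD ReJ [Re (val _)]/= addNr.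
  by rewrite ImD ImJ [Im (val _)]/= subrr.
(* Both bases in [FE] have the same numerator [(z + cj p) * (cj w + p) + q]; cancelling its power
   leaves a quantity in [z] equal to the conjugate of the same one in [w], hence a real constant. *)
have FC z w : f z * (val z + cj p) ^+ l.+2 = cj (f w * (val w + cj p) ^+ l.+2).
  have N1 : (val z + cj (val (g w))) * (cj (val w) + p) = (val z + cj p) * (cj (val w) + p) + q.
    rewrite gE conjcD conjcM conjc_inv conjcD conjcK -qE addrA [LHS]mulrDl.
    by rewrite divfK// -(conjcK p) -conjcD -cabs_eq0 cabsJ cabs_eq0.
  have N2 : (val (g z) + cj (val w)) * (val z + cj p) = (val z + cj p) * (cj (val w) + p) + q.
    by rewrite gE; field; exact: wr.
  have n0 : (val z + cj p) * (cj (val w) + p) + q != 0.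
    rewrite -N2; apply: mulf_neq0 (wr z); apply/Re_neq0/Re_addJ_gt0; exact: Cplus_gt0.
  apply: (mulIf (expf_neq0 l.+2 n0)); rewrite -{1}N1 -N2 !exprMn.
  have := FE z w; rewrite conjcM conjcX conjcD conjcK => E.
  rewrite mulrACA E; ring.
pose d := Re (f one * (val one + cj p) ^+ l.+2).
have Fd z : f z * (val z + cj p) ^+ l.+2 = d%:C.
  rewrite (FC z one); apply: complexP; rewrite ?ReJ ?ImJ//=.
  by have := congr1 (@complex.Im R) (FC one one); rewrite ImJ; lra.
apply/fractional_caseP; exists p, b, d; split.
- apply/eqP => d0; have := Fd one; rewrite d0 => /eqP.
  by rewrite mulf_eq0 expf_eq0 (negPf (fn0 _)) (negPf (wr _)) andbF.
- have [bp|bn] := ltrP 0 b; [by left|right].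
  have {}bn : b < 0 by rewrite lt_neqAle b0.
  (* This is [0 < Re (g w)] on the horizontal line where [w + cj p = t + Re p] is real; small [t]
     gives the bound on [- b]. *)
  have K t : 0 < t -> - b < Re p * (t + Re p).
    move=> t0; have tp : 0 < t + Re p by rewrite ltr_pwDl.
    have := Cplus_gt0 (g (Cpoint (Im p) t0)).
    rewrite gE qb (_ : val _ + cj p = (t + Re p)%:C); last first.
      apply: complexP; first by rewrite ReD ReJ.
      by rewrite ImD ImJ [Im (val _)]/= subrr.
    rewrite ReD -fmorphV -rmorphM /= => h.
    by rewrite -ltr_pdivrMr// mulNr; lra.
  have pp : 0 < Re p.
    rewrite lt_neqAle p0 andbT eq_sym; apply/eqP => pE.
    by have := K 1 ltr01; rewrite pE mul0r; lra.
  split=> //; rewrite leNgt; apply/negP => bp.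
  have t0 : 0 < (- b - Re p ^+ 2) / Re p by rewrite divr_gt0// subr_gt0.
  by have := K _ t0; rewrite mulrDr mulrC divfK ?gt_eqF// -expr2 subrK ltxx.
- move=> w; split; first by rewrite gE qb.
  by rewrite -(Fd w) mulfK// expf_neq0// wr.
Qed.

End Assembly.

Section Hermitian.
Variables (R : realType) (l : nat) (f : Cplus R -> R[i]) (g : Cplus R -> Cplus R).
Variable W : operator R.
Implicit Types (h k u v : Cplus R -> R[i]).
Local Notation plane := (plane R).
Local Notation L h := (lift l (zext h)).
Hypothesis hW : linear_operator l W.
Hypothesis hWle : op_le W (wcomp_max l f g).

(** The difference [d] of two values is orthogonal to the domain. If it had positive norm, some [k]
    of the domain would be closer to [d] than that norm, and [<d, d> = <d - k, d>] would contradict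
    Cauchy-Schwarz. *)
Lemma adjoint_value_unique u v v' : densely_defined l W ->
  is_adjoint_value l W u v -> is_adjoint_value l W u v' -> v = v'.
Proof.
have [Wb _ _ _] := hW; move=> dW [bv Hv] [bv' Hv'].
have bd := bergmanB bv bv'; have sd := bergman_sqint bd.
have orth k : dom W k -> inner plane (L k) (L (fun w => v w - v' w)) = 0.
  move=> Wk; have bk := Wb _ Wk; have sk := bergman_sqint bk.
  have e : inner plane (L k) (L v) = inner plane (L k) (L v').
    by rewrite -(bergman_innerE bk bv) -(bergman_innerE bk bv') -(Hv _ Wk) (Hv' _ Wk).
  have -> : L (fun w => v w - v' w) = fun p => L v p + L (fun w => -1 * v' w) p.
    by rewrite -liftD; congr (L _); apply/funext => w; rewrite mulN1r.
  rewrite liftZ (innerDr (bergman_sqint bv) (sqintZ (-1) (bergman_sqint bv')) sk).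
  by rewrite (innerZr _ (bergman_sqint bv') sk) e conjcN conjc1 mulN1r subrr.
suff d0 : nsq plane (L (fun w => v w - v' w)) = 0.
  apply/funext => w; apply/eqP; rewrite -subr_eq0; apply/eqP.
  exact: (congr1 (@^~ w) (nsq_eq0 bd d0)).
set d := fun w => v w - v' w in bd sd orth *.
apply/eqP/negPn/negP => d0.
have {}d0 : 0 < nsq plane (L d) by rewrite lt_def d0 nsq_ge0.
have s0 : 0 < Num.sqrt (nsq plane (L d)) by rewrite sqrtr_gt0.
have [k Wk] := dW d bd _ s0; have bk := Wb _ Wk; have sk := bergman_sqint bk.
have bdk := bergmanB bd bk; have sdk := bergman_sqint bdk.
rewrite (bergman_normE bdk) ltr_sqrt// => lt.
have e : inner plane (L d) (L d) = inner plane (L (fun w => d w - k w)) (L d).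
  have E : L d = fun p => L (fun w => d w - k w) p + L k p.
    by rewrite -liftD; congr (L _); apply/funext => w; rewrite subrK.
  by rewrite {1}E (innerDl sdk sk sd) (orth _ Wk) addr0.
have := cauchy_schwarz sdk sd; rewrite -e (inner_self sd) cabsR gtr0_norm// expr2.
by rewrite ler_pM2r// leNgt lt.
Qed.

Lemma wcomp_dom h : dom W h -> bergman l h /\ bergman l (wcomp f g h) /\
  app W h = wcomp f g h.
Proof.
move=> Wh; have [Wm WE] := hWle; have [bh bAh] := Wm _ Wh.
by split; [exact: bh|split; [exact: bAh|exact: WE]].
Qed.

(* The adjoint sends the kernel at [w] to [cj (f w)] times the kernel at [g w],
   so the kernel belongs to the domain of [W]. *)
Lemma hermitian_symbols : hermitian_operator l W -> forall z w,
  f z * (val z + cj (val (g w))) ^+ l.+2 = cj (f w) * (val (g z) + cj (val w)) ^+ l.+2.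
Proof.
move=> [dW [Wdom Wapp]] z w; have [c c0 Hc] := reproducing R l.
have bk := bergman_ker l w; have bkg := bergman_ker l (g w).
have av : is_adjoint_value l W (ker l w) (fun z => cj (f w) * ker l (g w) z).
  split=> [|h Wh]; first exact: bergmanZ.
  have [bh [bAh ->]] := wcomp_dom Wh.
  rewrite (bergman_innerE bAh bk) (bergman_innerE bh (bergmanZ _ bkg)) (Hc _ w bAh).
  rewrite liftZ (innerZr _ (bergman_sqint bkg) (bergman_sqint bh)) (Hc _ (g w) bh) conjcK.
  by rewrite /wcomp mulrCA.
have Wk : dom W (ker l w) by rewrite Wdom; split; [exact: bk|eexists; exact: av].
have [_ [_ kE]] := wcomp_dom Wk.
have := xgetPex (fun=> 0)
  (ex_intro _ _ av : exists v, [set v | is_adjoint_value l W (ker l w) v] v).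
rewrite -[xget _ _]/(app (adjoint l W) (ker l w)) -(Wapp _ Wk) kE => av'.
have := congr1 (@^~ z) (adjoint_value_unique dW av' av); rewrite /wcomp /ker /kfun => E.
have n1 : (val (g z) + cj (val w)) ^+ l.+2 != 0.
  by rewrite expf_neq0//; apply/Re_neq0/Re_addJ_gt0; exact: Cplus_gt0.
have n2 : (val z + cj (val (g w))) ^+ l.+2 != 0.
  by rewrite expf_neq0//; apply/Re_neq0/Re_addJ_gt0; exact: Cplus_gt0.
by apply/eqP; rewrite -eqr_div// E.
Qed.

Hypothesis adj : adjoint_pair l (wcomp f g) (wcomp f g).

(** Symmetry of the maximal operator places its domain inside that of the adjoint of [W], which is
    the domain of [W]. *)
Lemma hermitian_maximal : hermitian_operator l W -> op_eq W (wcomp_max l f g).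
Proof.
move=> [dW [Wdom _]]; have [Wm WE] := hWle; split; last exact: WE.
apply/seteqP; split=> [|u [bu bAu]]; first exact: Wm.
rewrite Wdom; split; first exact: bu.
exists (wcomp f g u); split; first exact: bAu.
move=> h Wh.
have [bh [bAh ->]] := wcomp_dom Wh; have [_ _ AE] := adj.
by rewrite (bergman_innerE bAh bu) (bergman_innerE bh bAu) (AE _ _ bh bu).
Qed.

Hypothesis Wmax : op_eq W (wcomp_max l f g).

Lemma maximal_dom : dom W = bergman l.
Proof.
have [[Ab _] _ _] := adj; rewrite Wmax.1.
by apply/seteqP; split=> [h [bh _]|h bh]; [exact: bh|split; [exact: bh|exact: Ab]].
Qed.

Lemma maximal_hermitian : hermitian_operator l W.
Proof.
have [[Ab _] _ AE] := adj; have WA h : bergman l h -> app W h = wcomp f g h.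
  by rewrite -maximal_dom => /wcomp_dom[_ [_ ->]].
have dW : densely_defined l W.
  move=> h bh e e0; exists h; first by rewrite maximal_dom.
  rewrite (bergman_normE (bergmanB bh bh)).
  have -> : (fun w => h w - h w) = fun w => 0 * h w.
    by apply/funext => w; rewrite subrr mul0r.
  by rewrite liftZ (nsqZ 0 (bergman_sqint bh)) cabs0 expr0n mul0r sqrtr0.
have av u : bergman l u -> is_adjoint_value l W u (wcomp f g u).
  move=> bu; split=> [|h]; first exact: Ab.
  rewrite maximal_dom => bh; rewrite (WA _ bh).
  by rewrite (bergman_innerE (Ab _ bh) bu) (bergman_innerE bh (Ab _ bu)) (AE _ _ bh bu).
split; [exact: dW|split=> [|h]].
  rewrite maximal_dom; apply/seteqP; split=> [u bu|u [bu _]]; last exact: bu.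
  by split; [exact: bu|exists (wcomp f g u); exact: av].
rewrite maximal_dom => bh; rewrite (WA _ bh); apply: (adjoint_value_unique dW (av _ bh)).
exact: (xgetPex (fun=> 0) (ex_intro _ _ (av _ bh))).
Qed.

Lemma maximal_bounded : bounded_operator l W.
Proof.
have [[Ab [M M0 HM]] _ _] := adj; split; first exact: maximal_dom.
(* The added 1 keeps the constant positive when [M = 0]. *)
exists (Num.sqrt M + 1) => [|h bh]; first by rewrite ltr_wpDl ?sqrtr_ge0.
have Wh : dom W h by rewrite maximal_dom.
have [_ [bAh ->]] := wcomp_dom Wh.
rewrite (bergman_normE bAh) (bergman_normE bh).
apply: (@le_trans _ _ (Num.sqrt M * Num.sqrt (nsq plane (L h)))).
  by rewrite -sqrtrM// ler_wsqrtr// HM.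
by rewrite ler_wpM2r ?sqrtr_ge0// lerDl.
Qed.

End Hermitian.

(** The case [f = 0] stands apart because the maximal operator is then the zero operator on the
    whole space, hence hermitian, whatever [g] is, whereas the three families prescribe [g]. *)
Theorem theorem3p4 (R : realType) (l : nat)
    (f : Cplus R -> R[i]) (g : Cplus R -> Cplus R) (W : operator R)
    (hf : analytic f) (hg : analytic (fun w => val (g w)))
    (hW : linear_operator l W) (hWle : op_le W (wcomp_max l f g)) :
  (hermitian_operator l W <->
     op_eq W (wcomp_max l f g) /\
     ((forall w, f w = 0%R) \/
      [\/ constant_case l f g, translation_case f g | fractional_case l f g])) /\
  (hermitian_operator l W -> bounded_operator l W).
Proof.
have H : hermitian_operator l W -> op_eq W (wcomp_max l f g) /\
     ((forall w, f w = 0%R) \/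
      [\/ constant_case l f g, translation_case f g | fractional_case l f g]).
  move=> hh; have cl := classification hf hg (hermitian_symbols hW hWle hh).
  by split; [exact: (hermitian_maximal hWle (adjoint_symbols cl) hh)|exact: cl].
split; first split; [exact: H|move=> -[Wmax cl]|].
  exact: (maximal_hermitian hW hWle (adjoint_symbols cl) Wmax).
move=> /H[Wmax cl]; exact: (maximal_bounded hWle (adjoint_symbols cl) Wmax).
Qed.
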